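(* Let $z_1,z_2\in\mathfrak H$ with $z_2\neq\gamma z_1$ for all $\gamma\in\Gamma=SL_2(\mathbb Z)$. For $n=1$, the function $$s\longmapsto \Xi_1(z_1,z_2,s)=\sum_{\gamma\in\Gamma}\frac{\overline{\mu_\gamma(z_1,-z_2)}\;\overline{\mu_\gamma(z_1,-\bar z_2)}}{|\mu_\gamma(z_1,-z_2)|^{2s}\,|\mu_\gamma(z_1,-\bar z_2)|^{2s}},$$ defined by an absolutely convergent series for $\Re(s)>1$, can be analytically continued to the point $s=1$; that is, there is a connected open set $U\subset\mathbb C$ containing $\{s:\Re(s)>1\}\cup\{1\}$ and a holomorphic function on $U$ which agrees with $\Xi_1(z_1,z_2,s)$ for $\Re(s)>1$.
   Context: $\mathfrak H=\{z\in\mathbb C:\Im(z)>0\}$ is the upper half-plane and $\Gamma=SL_2(\mathbb Z)$ acts on it by $\gamma z=\frac{az+b}{cz+d}$. For $\gamma=\begin{pmatrix}a&b\\c&d\end{pmatrix}$ put $$\mu_\gamma(z_1,-z_2)=cz_1z_2+dz_2-az_1-b,\qquad \mu_\gamma(z_1,-\bar z_2)=cz_1\bar z_2+d\bar z_2-az_1-b.$$ For a non-negative integer $n$ and complex $s$, the general series is $$\Xi_n(z_1,z_2,s)=\sum_{\gamma\in\Gamma}\frac{\overline{\mu_\gamma(z_1,-z_2)}^{\,n}\,\overline{\mu_\gamma(z_1,-\bar z_2)}^{\,n}}{|\mu_\gamma(z_1,-z_2)|^{2s}|\mu_\gamma(z_1,-\bar z_2)|^{2s}},$$ which is absolutely convergent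 for $\Re(s)>\frac{n+1}{2}$. *)

(* Defs.v *)
(* MathComp-Analysis, with complex numbers R[i] over R : realType.
   The topology on the complex plane is that of the normed module R[i]^o,
   so that differentiability in R[i]^o is complex differentiability. *)
From HB Require Import structures.
From mathcomp Require Import all_boot all_order all_algebra.
From mathcomp Require Import complex.
From mathcomp Require Import all_classical all_reals all_analysis.
From mathcomp Require summability.

Set Implicit Arguments.
Unset Strict Implicit.
Unset Printing Implicit Defensive.

Import Order.TTheory GRing.Theory Num.Theory.
Import numFieldNormedType.Exports.

Local Open Scope classical_set_scope.
Local Open Scope ring_scope.

Definition SL2Z : Type := {A : 'M[int]_2 | \det A == 1}.

Section Definitions.
Variable R : realType.
Local Notation C := R[i].

Implicit Types (g : SL2Z) (z w s : C).

Definition upper_half_plane : set C := [set z | 0 < complex.Im z].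

Definition entry g (i j : 'I_2) : C := (val g i j)%:~R.

Definition moebius g z : C :=
  (entry g 0 0 * z + entry g 0 1) / (entry g 1 0 * z + entry g 1 1).

(* [mu g z w] is \mu_g(z, -w): the minus sign is built into the definition. *)
Definition mu g z w : C :=
  entry g 1 0 * z * w + entry g 1 1 * w - entry g 0 0 * z - entry g 0 1.

Definition cexp z : C :=
  (expR (complex.Re z))%:C%C *
  (cos (complex.Im z) +i* sin (complex.Im z))%C.

(* a ^ s = exp (s log a), meaningful for a > 0 (here ln 0 = 0). *)
Definition cpowR (a : R) s : C := cexp (s * (ln a)%:C%C).

Definition cabs z : R := complex.Re `|z|.

Definition Xi_term (n : nat) z1 z2 s g : C :=
  ((mu g z1 z2)^* ^+ n * (mu g z1 z2^*)^* ^+ n) /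
  (cpowR (cabs (mu g z1 z2)) (2 * s) * cpowR (cabs (mu g z1 z2^*)) (2 * s)).

Definition Xi_abs_cvg (n : nat) z1 z2 s : Prop :=
  summable [set: SL2Z] (fun g => (cabs (Xi_term n z1 z2 s g))%:E).

(* Unordered sum: limit of the finite partial sums along the net of finite
   subsets of SL2Z. *)
Definition Xi (n : nat) z1 z2 s : C :=
  summability.sum (fun g => Xi_term n z1 z2 s g : C^o).

Definition holomorphic_on (U : set C^o) (F : C^o -> C^o) : Prop :=
  forall s, U s -> derivable F s 1.

End Definitions.

(* Main.v *)
Require Import Defs.
From mathcomp Require Import all_boot all_order all_algebra.
From mathcomp Require Import complex.
From mathcomp Require Import all_classical all_reals all_analysis.
From mathcomp Require Import finmap ring lra zify.
From mathcomp Require summability.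
Set Implicit Arguments.
Unset Strict Implicit.
Unset Printing Implicit Defensive.
Import Order.TTheory GRing.Theory Num.Theory.
Import numFieldNormedType.Exports.
Local Open Scope classical_set_scope.
Local Open Scope ring_scope.

(** For [n = 1] the general term of the series is [Pf (mu * mu') s], where
[Pf v s = conj v * |v| ^ (- 2 s)] is multiplicative in [v], and [mu], [mu'] are the
values of [mu] at [t = z2] and at its conjugate; put [z = z1].

The matrices are grouped by [n = |c|]. Those with [c = 0] are translations up to sign,
and their terms are summable near [s = 1]. For [n > 0] a matrix is given by the sign of
[c] and a pair of integers [(d, a)] with [a d = 1] modulo [n], and up to sign
[n * mu = (n z + d) (n t - a) + 1]. Hence, up to a relative error [O(n ^ -2)], its term
is [n ^ (2 - 4 s) * G (d / n) * K (a / n)], with functions [G], [K] on the line that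
depend on [s], decay like [|x| ^ (- 3 / 2)] and have bounded variation
([admissible_term_bound]).

The sum of [G (d / n) * K (a / n)] over these pairs is computed by Fourier analysis
modulo [n]. The zero frequencies give [phi(n) / n ^ 2] times the sum over all [d] and
[a]; the others are controlled by Kloosterman sums. Any power saving is enough, so
Kloosterman's own bound suffices: the fourth moment over all frequencies counts the
solutions of a pair of equations, and every value of the sum is repeated along an orbit
of [phi(n)] frequencies ([kloosterman_moment4], [kloosterman_orbit_bound]). Together
with the divisor bound this leaves an error [O(n ^ (7 / 8))] ([kloosterman_saving]).
The two full sums are [n] times Riemann sums, that is [n I + O(1)] and [n J + O(1)]
with the mean values [I], [J] of [G], [K]. Altogether the matrices with [|c| = n]
contribute [2 n ^ (2 - 4 s) phi(n) I(s) J(s) + O(n ^ (- 17 / 16))], uniformly near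
[s = 1] ([pair_sum_asymptotic]).

The errors add up to a holomorphic function near 1. The main terms add up to
[2 I(s) J(s)] times the Dirichlet series of [phi] at [4 s - 2], which is
[zeta(4 s - 3) / zeta(4 s - 2)] and has a simple pole at [s = 1]
([totient_series_continuation]). But [G] is [(x + z) ^ -2] at [s = 1], the derivative of
a function vanishing at both ends of the line, so [I(1) = 0] ([riemann_d_profile_at1])
and the pole disappears ([Xi_near_one]). The domain of the continuation is the union of
the half-plane and a disc around 1, which is star-shaped about 1.

Holomorphy is carried by [uholo], the class of uniform limits of polynomials on a
bounded set. It is closed under products and uniform limits, and contains the
exponentials. A discrete form of Cauchy's estimates, averaging over roots of unity,
shows that a zero can be divided out within the class ([uholo_quotient]); this yields
both differentiability in the complex sense and the cancellation of the pole. *)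

(** * Modulus and exponential of complex numbers *)

Section ComplexModulus.
Variable R : realType.
Local Notation C := R[i].
Implicit Types (z w : C) (x y : R).

Lemma cabsE z : `|z| = (cabs z)%:C%C.
Proof. by rewrite /cabs normc_def. Qed.

Lemma cabs_sqrt z : cabs z = Num.sqrt (complex.Re z ^+ 2 + complex.Im z ^+ 2).
Proof. by rewrite /cabs normc_def. Qed.

Lemma cabs_ge0 z : 0 <= cabs z.
Proof. by rewrite cabs_sqrt sqrtr_ge0. Qed.

Lemma cabsM z w : cabs (z * w) = cabs z * cabs w.
Proof. by apply: (@complexI R); rewrite -cabsE normrM !cabsE rmorphM. Qed.

Lemma cabs0 : cabs (0 : C) = 0.
Proof. by rewrite /cabs normr0. Qed.

Lemma cabs1 : cabs (1 : C) = 1.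
Proof. by rewrite /cabs normr1. Qed.

Lemma cabsN z : cabs (- z) = cabs z.
Proof. by rewrite /cabs normrN. Qed.

Lemma cabsBC z w : cabs (z - w) = cabs (w - z).
Proof. by rewrite /cabs distrC. Qed.

Lemma cabsV z : cabs z^-1 = (cabs z)^-1.
Proof. by apply: (@complexI R); rewrite -cabsE normfV cabsE fmorphV. Qed.

Lemma cabsX z n : cabs (z ^+ n) = cabs z ^+ n.
Proof. by apply: (@complexI R); rewrite -cabsE normrX cabsE rmorphXn. Qed.

Lemma cabs_eq0 z : (cabs z == 0) = (z == 0).
Proof. by rewrite -(inj_eq (@complexI R)) -cabsE normr_eq0. Qed.

Lemma cabs_gt0 z : (0 < cabs z) = (z != 0).
Proof. by rewrite lt_neqAle eq_sym cabs_eq0 cabs_ge0 andbT. Qed.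

Lemma cabsD z w : cabs (z + w) <= cabs z + cabs w.
Proof. by rewrite -lecR rmorphD /= -!cabsE ler_normD. Qed.

Lemma cabsB z w : cabs (z - w) <= cabs z + cabs w.
Proof. by rewrite -(cabsN w) cabsD. Qed.

Lemma cabs_sum (I : Type) (r : seq I) (P : pred I) (F : I -> C) :
  cabs (\sum_(i <- r | P i) F i) <= \sum_(i <- r | P i) cabs (F i).
Proof.
elim/big_ind2: _ => [|u z v w h1 h2|//]; first by rewrite cabs0.
by apply: le_trans (cabsD _ _) _; apply: lerD.
Qed.

Lemma cabs_conj z : cabs z^* = cabs z.
Proof. by rewrite /cabs norm_conjC. Qed.

Lemma cabs_real x : cabs x%:C%C = `|x|.
Proof. by rewrite cabs_sqrt /= expr0n addr0 sqrtr_sqr. Qed.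

Lemma cabs_nat n : cabs (n%:R : C) = n%:R.
Proof. by rewrite -(rmorph_nat (real_complex R)) cabs_real ger0_norm. Qed.

Lemma normRe_le z : `|complex.Re z| <= cabs z.
Proof. by rewrite cabs_sqrt -sqrtr_sqr ler_wsqrtr// lerDl sqr_ge0. Qed.

Lemma normIm_le z : `|complex.Im z| <= cabs z.
Proof. by rewrite cabs_sqrt -sqrtr_sqr ler_wsqrtr// lerDr sqr_ge0. Qed.

Lemma cabs_le z : cabs z <= `|complex.Re z| + `|complex.Im z|.
Proof.
rewrite cabs_sqrt -[leRHS]ger0_norm ?addr_ge0// -sqrtr_sqr ler_wsqrtr//.
rewrite sqrrD !real_normK ?num_real//.
have : 0 <= `|complex.Re z| * `|complex.Im z| by rewrite mulr_ge0.
lra.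
Qed.

Lemma ge_cabsB z w : cabs z - cabs w <= cabs (z - w).
Proof. by rewrite lerBlDr (le_trans _ (cabsD _ _))// subrK. Qed.

Lemma complex_ReIm z : z = (complex.Re z)%:C%C + 'i%C * (complex.Im z)%:C%C.
Proof.
case: z => a b; apply/eqP; rewrite eq_complex /=.
by apply/andP; split; apply/eqP; ring.
Qed.

End ComplexModulus.

Section ComplexExponential.
Variable R : realType.
Local Notation C := R[i].
Implicit Types (z w : C) (x y : R).

Lemma cexpD z w : cexp (z + w) = cexp z * cexp w.
Proof.
case: z w => a b [c d]; rewrite /cexp /= expRD cosD sinD.
by apply/eqP; rewrite eq_complex /=; apply/andP; split; apply/eqP; ring.
Qed.

Lemma cexp0 : cexp (0 : C) = 1.
Proof.
rewrite /cexp /= expR0 cos0 sin0.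
by apply/eqP; rewrite eq_complex /=; apply/andP; split; apply/eqP; ring.
Qed.

Lemma cabs_cexp z : cabs (cexp z) = expR (complex.Re z).
Proof.
rewrite /cexp cabsM cabs_real ger0_norm ?expR_ge0// cabs_sqrt /= cos2Dsin2.
by rewrite sqrtr1 mulr1.
Qed.

Lemma cexpN z : cexp (- z) = (cexp z)^-1.
Proof.
have nz : cexp z != 0 by rewrite -cabs_gt0 cabs_cexp expR_gt0.
by apply: (mulIf nz); rewrite -cexpD addNr cexp0 mulVf.
Qed.

Lemma cexp_real x : cexp x%:C%C = (expR x)%:C%C.
Proof.
rewrite /cexp /= cos0 sin0.
by apply/eqP; rewrite eq_complex /=; apply/andP; split; apply/eqP; ring.
Qed.

End ComplexExponential.

(** * Bounds for finite partial sums *)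

Section NonnegativeSums.
Variable R : realType.

(** An upper bound for all finite partial sums; for nonnegative families this is
the bound on the unordered sum, in a form that needs no limit. *)
Definition sum_le (I : choiceType) (g : I -> R) (M : R) : Prop :=
  forall B : {fset I}, \sum_(i <- B) g i <= M.

Lemma sum_le_uniq (I : choiceType) (g : I -> R) M (r : seq I) :
  sum_le g M -> uniq r -> \sum_(i <- r) g i <= M.
Proof.
move=> h ur; have := h [fset x in r]%fset.
rewrite (perm_big r)//=; apply: uniq_perm => //.
by move=> x; rewrite !inE.
Qed.

Lemma sum_le_ge0 (I : choiceType) (g : I -> R) M : sum_le g M -> 0 <= M.
Proof. by move=> /(_ fset0); rewrite big_seq_fset0. Qed.

Lemma sum_le_le (I : choiceType) (f g : I -> R) M :
  (forall i, f i <= g i) -> sum_le g M -> sum_le f M.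
Proof. by move=> fg h B; apply: le_trans (h B); apply: ler_sum. Qed.

Lemma sum_leZ (I : choiceType) (g : I -> R) M k :
  0 <= k -> sum_le g M -> sum_le (fun i => k * g i) (k * M).
Proof. by move=> k0 h B; rewrite -mulr_sumr ler_wpM2l. Qed.

Lemma sum_leD (I : choiceType) (f g : I -> R) M N :
  sum_le f M -> sum_le g N -> sum_le (fun i => f i + g i) (M + N).
Proof. by move=> hf hg B; rewrite big_split /= lerD. Qed.

Lemma sum_le_inj (I J : choiceType) (h : I -> J) (f : I -> R) (g : J -> R) M :
  (forall i j, f i != 0 -> f j != 0 -> h i = h j -> i = j) ->
  (forall i, f i <= g (h i)) -> (forall j, 0 <= g j) ->
  sum_le g M -> sum_le f M.
Proof.
move=> inj fg g0 hg B.
apply: (@le_trans _ _ (\sum_(i <- B | f i != 0) f i)).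
  rewrite big_mkcond [leRHS]big_mkcond /=; apply: ler_sum => i _.
  by case: eqP => [->|].
apply: (@le_trans _ _ (\sum_(i <- B | f i != 0) g (h i))).
  by apply: ler_sum => i _.
rewrite -big_filter -(big_map h xpredT); apply: sum_le_uniq hg _.
rewrite map_inj_in_uniq ?filter_uniq ?fset_uniq//.
by move=> i j; rewrite !mem_filter => /andP[fi _] /andP[fj _]; apply: inj.
Qed.

Lemma sum_le_pair (I J : choiceType) (g : I -> J -> R) (b : I -> R) M :
  (forall i j, 0 <= g i j) -> (forall i, sum_le (g i) (b i)) -> sum_le b M ->
  sum_le (fun p : I * J => g p.1 p.2) M.
Proof.
move=> g0 hg hb B.
pose r1 : seq I := undup [seq p.1 | p <- B].
pose r2 : seq J := undup [seq p.2 | p <- B].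
apply: (@le_trans _ _ (\sum_(i <- r1) \sum_(j <- r2) g i j)).
  pose r := [seq (i, j) | i <- r1, j <- r2].
  have -> : \sum_(i <- r1) \sum_(j <- r2) g i j = \sum_(p <- r) g p.1 p.2.
    by rewrite big_allpairs.
  have ur : uniq r.
    by rewrite allpairs_uniq ?undup_uniq// => -[? ?] [? ?].
  have sub : {subset enum_fset B <= r}.
    move=> [i j] ij; apply/allpairsP; exists (i, j) => /=; rewrite !mem_undup.
    by split=> //; [apply/mapP; exists (i, j)|apply/mapP; exists (i, j)].
  rewrite (perm_big (seq.filter (mem B) r)) /=; last first.
    apply: uniq_perm; rewrite ?filter_uniq//.
    move=> x; rewrite mem_filter /=; case xB : (x \in B) => //=.
    by rewrite sub.
  rewrite big_filter big_mkcond /=.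

  by apply: ler_sum => p _; case: ifP.
apply: (@le_trans _ _ (\sum_(i <- r1) b i)); last first.
  exact: sum_le_uniq hb (undup_uniq _).
by apply: ler_sum => i _; apply: sum_le_uniq (hg i) (undup_uniq _).
Qed.

Lemma sum_le_prod (I J : choiceType) (u : I -> R) (v : J -> R) M N :
  (forall i, 0 <= u i) -> (forall j, 0 <= v j) ->
  sum_le u M -> sum_le v N -> sum_le (fun p : I * J => u p.1 * v p.2) (M * N).
Proof.
move=> u0 v0 hu hv; apply: (@sum_le_pair _ _ (fun i j => u i * v j) (fun i => u i * N)).
- by move=> i j; rewrite mulr_ge0.
- by move=> i; apply: sum_leZ.
- move=> B; rewrite -mulr_suml ler_wpM2r//; exact: sum_le_ge0 hv.
Qed.

Lemma sum_le_nat (g : nat -> R) M : (forall i, 0 <= g i) ->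
  (forall n, \sum_(0 <= k < n) g k <= M) -> sum_le g M.
Proof.
move=> g0 h B.
pose n := (\max_(i <- B) i).+1.
apply: le_trans (h n); rewrite /index_iota subn0.
rewrite (perm_big (seq.filter (mem B) (iota 0 n))); last first.
  apply: uniq_perm; [exact: fset_uniq|exact/filter_uniq/iota_uniq|].
  move=> x; rewrite mem_filter mem_iota add0n /=.
  case xB : (x \in B) => //=; rewrite /n ltnS.
  by have := @leq_bigmax_seq _ (enum_fset B) xpredT id x xB isT.
by rewrite big_filter big_mkcond /=; apply: ler_sum => p _; case: ifP.
Qed.

Lemma sum_le_int (g : int -> R) M N : (forall i, 0 <= g i) ->
  sum_le (fun n : nat => g n%:Z) M -> sum_le (fun n : nat => g (- n.+1%:Z)) N ->
  sum_le g (M + N).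
Proof.
move=> g0 hM hN B.
rewrite (bigID (fun i => 0 <= i)) /=; apply: lerD.
- rewrite -big_filter.
  have -> : \sum_(i <- seq.filter (fun i : int => 0 <= i) B) g i =
     \sum_(n <- [seq absz i | i <- seq.filter (fun i : int => 0 <= i) B]) g n%:Z.
    rewrite big_map !big_filter; apply: eq_bigr => i i0.
    by rewrite gez0_abs.
  apply: sum_le_uniq hM _; rewrite map_inj_in_uniq ?filter_uniq ?fset_uniq//.
  move=> i j; rewrite !mem_filter => /andP[i0 _] /andP[j0 _]; lia.
- rewrite -big_filter.
  have -> : \sum_(i <- seq.filter (fun i : int => ~~ (0 <= i)) B) g i =
     \sum_(n <- [seq (absz i).-1 | i <- seq.filter (fun i : int => ~~ (0 <= i)) B])
        g (- n.+1%:Z).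
    rewrite big_map !big_filter; apply: eq_bigr => i i0.
    by congr g; lia.
  apply: sum_le_uniq hN _; rewrite map_inj_in_uniq ?filter_uniq ?fset_uniq//.
  move=> i j; rewrite !mem_filter => /andP[i0 _] /andP[j0 _]; lia.
Qed.

Lemma sum_le_tail (I : choiceType) (g : I -> R) M (e : R) :
  (forall i, 0 <= g i) -> sum_le g M -> 0 < e ->
  exists A : {fset I}, forall B : {fset I}, [disjoint A & B]%fset ->
    \sum_(i <- B) g i <= e.
Proof.
move=> g0 h e0.
pose S := [set x | exists B : {fset I}, x = \sum_(i <- B) g i].
have S0 : has_sup S.
  split; first by exists 0; exists fset0; rewrite big_seq_fset0.
  by exists M => x [B ->].
have [x [A ->] hA] := sup_adherent e0 S0.
exists A => B dis.
have : \sum_(i <- (A `|` B)%fset) g i <= sup S by apply: sup_upper_bound => //; exists (A `|` B)%fset.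
have -> : \sum_(i <- (A `|` B)%fset) g i = \sum_(i <- A) g i + \sum_(i <- B) g i.
  rewrite -big_cat /=; apply: perm_big; apply: uniq_perm => //.
    rewrite cat_uniq !fset_uniq /= andbT; apply/hasPn => y /= yB.
    by apply/negP => yA; move/fdisjointP: dis => /(_ y yA); rewrite yB.
  by move=> y; rewrite mem_cat in_fsetU.
lra.
Qed.

End NonnegativeSums.

(** * Absolutely convergent unordered sums *)

Section UnorderedSums.
Variable R : realType.
Local Notation C := R[i].

Definition has_sum (I : choiceType) (f : I -> C) (l : C) : Prop :=
  forall e : R, 0 < e -> exists A : {fset I}, forall B : {fset I},
    (A `<=` B)%fset -> cabs (\sum_(i <- B) f i - l) <= e.

Definition tsum (I : choiceType) (f : I -> C) : C :=
  summability.sum (f : I -> R[i]^o).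

Definition abs_summable (I : choiceType) (f : I -> C) : Prop :=
  exists M, sum_le (fun i => cabs (f i)) M.

Lemma cabs_small_eq0 (z : C) : (forall e : R, 0 < e -> cabs z <= e) -> z = 0.
Proof.
move=> h; apply/eqP; rewrite -cabs_eq0 eq_le cabs_ge0 andbT.
by apply/ler_addgt0Pl => e e0; rewrite addr0; apply: h.
Qed.

(** [has_sum] spells out the convergence of the net of finite partial sums, whose
limit is unique since the plane is Hausdorff. *)
Lemma has_sum_tsum (I : choiceType) (f : I -> C) l : has_sum f l -> tsum f = l.
Proof.
move=> hl; rewrite /tsum /summability.sum.
have FF := @summability.totally_filter I.
have sep : hausdorff_space R[i]^o by exact: norm_hausdorff.
suff : (summability.partial_sum (f : I -> R[i]^o) @ summability.totally --> (l : R[i]^o)).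
  exact: cvg_lim.
apply/cvgrPdist_le => e e0.
have eE : e = (complex.Re e)%:C%C.
  by move: (e0); rewrite ltcE => /andP[/eqP h _]; case: e h {e0} => a b /= ->.
have e0' : 0 < complex.Re e by move: e0; rewrite {1}eE ltcR.
have [A hA] := hl _ e0'.
exists A => // B /= AB.
rewrite distrC cabsE eE lecR; apply: le_trans (hA _ AB).
rewrite /summability.partial_sum.
by rewrite (big_seq_fsetE _ _ xpredT f).
Qed.

Lemma has_sum_bound (I : choiceType) (f : I -> C) l (M : R) :
  (forall B : {fset I}, cabs (\sum_(i <- B) f i) <= M) -> has_sum f l ->
  cabs l <= M.
Proof.
move=> hB hl; apply/ler_addgt0Pl => e e0.
have [A hA] := hl _ e0; have := hA _ (fsubset_refl A).
rewrite cabsBC => h.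
have -> : l = (l - \sum_(i <- A) f i) + \sum_(i <- A) f i by ring.
by apply: le_trans (cabsD _ _) _; apply: lerD.
Qed.

Lemma has_sum_le (I : choiceType) (f : I -> C) l (M : R) :
  sum_le (fun i => cabs (f i)) M -> has_sum f l -> cabs l <= M.
Proof.
by move=> h; apply: has_sum_bound => B; apply: le_trans (cabs_sum _ _ _) (h B).
Qed.

Lemma has_sumD (I : choiceType) (f g : I -> C) l m :
  has_sum f l -> has_sum g m -> has_sum (fun i => f i + g i) (l + m).
Proof.
move=> hl hm e e0.
have [A hA] := hl _ (divr_gt0 e0 (ltr0n _ 2)).
have [B hB] := hm _ (divr_gt0 e0 (ltr0n _ 2)).
exists (A `|` B)%fset => D; rewrite fsubUset => /andP[AD BD].
rewrite big_split /= opprD addrACA.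
by apply: le_trans (cabsD _ _) _; have := hA _ AD; have := hB _ BD; lra.
Qed.

Lemma has_sumZ (I : choiceType) (f : I -> C) l k :
  has_sum f l -> has_sum (fun i => k * f i) (k * l).
Proof.
move=> hl e e0.
have k0 : 0 < cabs k + 1 by rewrite ltr_wpDl ?cabs_ge0.
have [A hA] := hl _ (divr_gt0 e0 k0); exists A => B /hA.
rewrite -mulr_sumr -mulrBr cabsM ler_pdivlMr// => h.
apply: le_trans h; rewrite mulrC ler_wpM2l ?cabs_ge0//.
by rewrite lerDl.
Qed.

Lemma has_sumB (I : choiceType) (f g : I -> C) l m :
  has_sum f l -> has_sum g m -> has_sum (fun i => f i - g i) (l - m).
Proof.
move=> hl /(has_sumZ (-1)) hm.
have := has_sumD hl hm; rewrite mulN1r; congr has_sum.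
by apply/funext => i; rewrite mulN1r.
Qed.

Lemma has_sum0 (I : choiceType) : has_sum (fun _ : I => 0) 0.
Proof.
by move=> e e0; exists fset0 => B _; rewrite big1// subrr cabs0 ltW.
Qed.

Lemma has_sum_finsum (I : choiceType) (J : Type) (r : seq J) (f : J -> I -> C)
  (l : J -> C) : (forall j, has_sum (f j) (l j)) ->
  has_sum (fun i => \sum_(j <- r) f j i) (\sum_(j <- r) l j).
Proof.
move=> h; elim: r => [|j r IH].
  rewrite big_nil; have -> : (fun i : I => \sum_(j <- [::]) f j i) = fun=> 0.
    by apply/funext => i; rewrite big_nil.
  exact: has_sum0.
rewrite big_cons; have -> : (fun i : I => \sum_(j <- j :: r) f j i) =
    fun i => f j i + \sum_(j <- r) f j i.
  by apply/funext => i; rewrite big_cons.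
exact: has_sumD.
Qed.

Lemma nonneg_has_sum (I : choiceType) (g : I -> R) M :
  (forall i, 0 <= g i) -> sum_le g M ->
  exists l, has_sum (fun i => (g i)%:C%C) l.
Proof.
move=> g0 h.
pose S := [set x | exists B : {fset I}, x = \sum_(i <- B) g i].
have S0 : has_sup S.
  split; first by exists 0; exists fset0; rewrite big_seq_fset0.
  by exists M => x [B ->].
exists (sup S)%:C%C => e e0.
have [x [A ->] hA] := sup_adherent e0 S0; exists A => B AB.
rewrite -rmorph_sum -rmorphB cabs_real ler_distlC.
have : \sum_(i <- B) g i <= sup S by apply: sup_upper_bound => //; exists B.
have : \sum_(i <- A) g i <= \sum_(i <- B) g i.
  rewrite (perm_big (seq.filter (mem A) B)) /=; last first.
    apply: uniq_perm; rewrite ?filter_uniq ?fset_uniq//.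
    move=> y; rewrite mem_filter /=; case yA : (y \in A) => //=.
    by rewrite (fsubsetP AB).
  by rewrite big_filter big_mkcond /=; apply: ler_sum => p _; case: ifP.
lra.
Qed.

Lemma real_has_sum (I : choiceType) (g : I -> R) M :
  sum_le (fun i => `|g i|) M -> exists l, has_sum (fun i => (g i)%:C%C) l.
Proof.
move=> h.
have [|l hl] := @nonneg_has_sum I (fun i => `|g i|) M _ h; first by move=> i.
have [||m hm] := @nonneg_has_sum I (fun i => `|g i| - g i) (2 * M).
- by move=> i; rewrite subr_ge0 ler_norm.
- apply: sum_le_le (sum_leZ (ler0n _ 2) h) => i.
  by have := ler_norm (- g i); rewrite normrN; lra.
exists (l - m); have := has_sumB hl hm; congr has_sum.
by apply/funext => i; rewrite -rmorphB /=; congr (_%:C%C); ring.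
Qed.

Lemma summable_has_sum (I : choiceType) (f : I -> C) :
  abs_summable f -> has_sum f (tsum f).
Proof.
move=> [M h].
have [a ha] : exists l, has_sum (fun i => (complex.Re (f i))%:C%C) l.
  by apply: (@real_has_sum _ _ M); apply: sum_le_le h => i; apply: normRe_le.
have [b hb] : exists l, has_sum (fun i => (complex.Im (f i))%:C%C) l.
  by apply: (@real_has_sum _ _ M); apply: sum_le_le h => i; apply: normIm_le.
have hf : has_sum f (a + 'i%C * b).
  have -> : f = fun i => (complex.Re (f i))%:C%C + 'i%C * (complex.Im (f i))%:C%C.
    by apply: funext => i; exact: complex_ReIm.
  exact: has_sumD ha (has_sumZ 'i%C hb).
by rewrite (has_sum_tsum hf).
Qed.

Lemma tsum_le (I : choiceType) (f : I -> C) (M : R) :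
  sum_le (fun i => cabs (f i)) M -> cabs (tsum f) <= M.
Proof. by move=> h; apply: (has_sum_le h); apply: summable_has_sum; exists M. Qed.

Lemma eq_tsum (I : choiceType) (f g : I -> C) : f =1 g -> tsum f = tsum g.
Proof. by move=> /funext ->. Qed.

Lemma abs_summable_le (I : choiceType) (f g : I -> C) :
  (forall i, cabs (f i) <= cabs (g i)) -> abs_summable g -> abs_summable f.
Proof. by move=> fg [M h]; exists M; apply: sum_le_le h. Qed.

Lemma abs_summableZ (I : choiceType) (f : I -> C) k :
  abs_summable f -> abs_summable (fun i => k * f i).
Proof.
move=> [M h]; exists (cabs k * M).
by apply: sum_le_le (sum_leZ (cabs_ge0 k) h) => i; rewrite cabsM.
Qed.

Lemma abs_summableD (I : choiceType) (f g : I -> C) :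
  abs_summable f -> abs_summable g -> abs_summable (fun i => f i + g i).
Proof.
move=> [M hM] [N hN]; exists (M + N).
by apply: sum_le_le (sum_leD hM hN) => i; rewrite cabsD.
Qed.

Lemma tsumD (I : choiceType) (f g : I -> C) :
  abs_summable f -> abs_summable g ->
  tsum (fun i => f i + g i) = tsum f + tsum g.
Proof.
by move=> /summable_has_sum hf /summable_has_sum hg; apply/has_sum_tsum/has_sumD.
Qed.

Lemma tsumZ (I : choiceType) (f : I -> C) k :
  abs_summable f -> tsum (fun i => k * f i) = k * tsum f.
Proof. by move=> /summable_has_sum hf; apply/has_sum_tsum/has_sumZ. Qed.

Lemma tsumB (I : choiceType) (f g : I -> C) :
  abs_summable f -> abs_summable g ->
  tsum (fun i => f i - g i) = tsum f - tsum g.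
Proof.
by move=> /summable_has_sum hf /summable_has_sum hg; apply/has_sum_tsum/has_sumB.
Qed.

Lemma has_sum_reindex (I J : choiceType) (h : I -> J) (f : J -> C) l :
  injective h -> (forall j, f j != 0 -> exists i, j = h i) ->
  has_sum (fun i => f (h i)) l -> has_sum f l.
Proof.
move=> inj fh hl e e0; have [A hA] := hl _ e0.
pose g (j : J) : option I :=
  if pselect (exists i, h i = j) is left P then Some (projT1 (cid P)) else None.
have gP j i : (g j == Some i) = (h i == j).
  rewrite /g; case: pselect => [P|nP]; last first.
    by apply/esym/negbTE/eqP => hij; apply: nP; exists i.
  case: (cid P) => i' hi' /=; rewrite -hi' (inj_eq inj) eq_sym.
  by apply/eqP/eqP => [[<-]//|->].
exists (h @` A)%fset => B AB.
pose B' := [fset i in pmap g B]%fset.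
have inB' i : (i \in B') = (h i \in B).
  rewrite !inE /= mem_pmap; apply/mapP/idP => [[j jB /esym/eqP]|hB].
    by rewrite gP => /eqP ->.
  by exists (h i) => //; apply/esym/eqP; rewrite gP.
have -> : \sum_(i <- B) f i = \sum_(i <- B') f (h i).
  rewrite -(big_map h xpredT) /=.
  have nz (r : seq J) : \sum_(j <- r) f j = \sum_(j <- seq.filter (fun j => f j != 0) r) f j.
    rewrite big_filter big_mkcond [RHS]big_mkcond; apply: eq_bigr => j _.
    by case: eqP.
  rewrite nz [RHS]nz; apply: perm_big; apply: uniq_perm.
  - exact/filter_uniq/fset_uniq.
  - by apply: filter_uniq; rewrite map_inj_uniq// fset_uniq.
  - move=> j; rewrite !mem_filter; case: eqP => //= /eqP /fh[i ->].
    by rewrite mem_map// inB'.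
apply: hA; apply/fsubsetP => i iA; rewrite inB'.
by apply: (fsubsetP AB); apply/imfsetP; exists i.
Qed.

Lemma tsum_reindex (I J : choiceType) (h : I -> J) (f : J -> C) :
  injective h -> (forall j, f j != 0 -> exists i, j = h i) ->
  abs_summable f -> tsum f = tsum (fun i => f (h i)).
Proof.
move=> inj fh [M hM].
apply/has_sum_tsum/(has_sum_reindex inj fh)/summable_has_sum; exists M.
apply: sum_le_inj hM => // [i j _ _|j]; [exact: inj|exact: cabs_ge0].
Qed.

Lemma abs_summable_restr (I : choiceType) (f : I -> C) (P : pred I) :
  abs_summable f -> abs_summable (fun i => if P i then f i else 0).
Proof.
by apply: abs_summable_le => i; case: ifP => // _; rewrite cabs0 cabs_ge0.
Qed.

(** Fibration of an absolutely convergent sum: the fibres of [p] are represented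
by restricting [f], which keeps a single index type. *)
Lemma has_sum_fiber (I J : choiceType) (p : I -> J) (f : I -> C) :
  abs_summable f ->
  has_sum (fun j => tsum (fun i => if p i == j then f i else 0)) (tsum f).
Proof.
move=> sf e e0; have [M hM] := sf.
have [|A hA] := sum_le_tail _ hM e0; first by move=> i; apply: cabs_ge0.
exists (p @` A)%fset => B AB.
have hB : has_sum (fun i => if p i \in B then f i else 0)
    (\sum_(j <- B) tsum (fun i => if p i == j then f i else 0)).
  have := @has_sum_finsum I J (enum_fset B)
    (fun j i => if p i == j then f i else 0) _
    (fun j => summable_has_sum (abs_summable_restr _ sf)).
  congr has_sum; apply/funext => i.
  rewrite -big_mkcond /=; case: ifPn => pB.
    rewrite -big_filter (_ : seq.filter _ _ = [:: p i]) ?big_seq1//.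
    have := filter_pred1_uniq (fset_uniq B) pB; congr (_ = _).
    by apply: eq_filter => j /=; rewrite eq_sym.
  rewrite big_seq_cond big1// => j /andP[jB /eqP E].
  by move: pB; rewrite E jB.
rewrite cabsBC; have := has_sumB (summable_has_sum sf) hB.
apply: has_sum_bound => D.
rewrite (_ : \sum_(i <- D) _ = \sum_(i <- (D `\` A)%fset) (if p i \in B then 0 else f i)).
  apply: le_trans (cabs_sum _ _ _) _.
  apply: le_trans (hA (D `\` A)%fset _); last first.
    by apply/fdisjointP => x xA; rewrite !inE xA.
  by apply: ler_sum => i _; case: ifP => // _; rewrite cabs0 cabs_ge0.
have -> : \sum_(i <- D) (f i - (if p i \in B then f i else 0)) =
    \sum_(i <- D) (if p i \in B then 0 else f i).
  by apply: eq_bigr => i _; case: ifP => _; rewrite ?subrr ?subr0.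
rewrite (bigID (mem A)) /= big1 ?add0r; last first.
  move=> i iA; rewrite (_ : p i \in B)//.
  by apply: (fsubsetP AB); apply/imfsetP; exists i.
rewrite -big_filter; apply: perm_big; apply: uniq_perm.
- exact/filter_uniq/fset_uniq.
- exact: fset_uniq.
- by move=> i; rewrite mem_filter in_fsetD.
Qed.

Lemma tsum_fiber_le (I J : choiceType) (p : I -> J) (f : I -> C) M :
  sum_le (fun i => cabs (f i)) M ->
  sum_le (fun j => cabs (tsum (fun i => if p i == j then f i else 0))) M.
Proof.
move=> hM B; have sf : abs_summable f by exists M.
(* a unimodular factor per fibre turns the moduli into one partial sum of [f] twisted *)
pose t j := tsum (fun i => if p i == j then f i else 0).
pose u j : C := if t j == 0 then 0 else (cabs (t j))%:C%C / t j.
have ut j : u j * t j = (cabs (t j))%:C%C.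
  rewrite /u; case: eqP => [->|/eqP nz]; first by rewrite mulr0 cabs0.
  by rewrite -mulrA mulVf// mulr1.
have u1 j : cabs (u j) <= 1.
  rewrite /u; case: eqP => [_|/eqP nz]; first by rewrite cabs0.
  by rewrite cabsM cabsV cabs_real ger0_norm ?cabs_ge0// divff// cabs_eq0.
have hB : has_sum (fun i => \sum_(j <- B) u j * (if p i == j then f i else 0))
    (\sum_(j <- B) u j * t j).
  apply: has_sum_finsum => j; apply: has_sumZ; apply: summable_has_sum.
  exact: abs_summable_restr.
have : cabs (\sum_(j <- B) u j * t j) <= M.
  apply: has_sum_le hB; apply: sum_le_le hM => i /=.
  have [pB|pB] := boolP (p i \in B); last first.
    rewrite big_seq big1 ?cabs0 ?cabs_ge0// => j jB.
    by case: eqP => [E|_]; [move: pB; rewrite E jB|rewrite mulr0].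
  rewrite (bigD1_seq (p i)) ?fset_uniq//= eqxx big1 ?addr0.
    by rewrite cabsM ler_piMl ?cabs_ge0.
  by move=> j; rewrite eq_sym => /negbTE ->; rewrite mulr0.
apply: le_trans.
have -> : \sum_(j <- B) u j * t j = (\sum_(j <- B) cabs (t j))%:C%C.
  by rewrite rmorph_sum; apply: eq_bigr => j _; rewrite ut.
by rewrite cabs_real ler_norm.
Qed.

Lemma tsum_fiber (I J : choiceType) (p : I -> J) (f : I -> C) :
  abs_summable f ->
  tsum f = tsum (fun j => tsum (fun i => if p i == j then f i else 0)).
Proof. by move=> sf; apply/esym/has_sum_tsum/has_sum_fiber. Qed.

Lemma abs_summable_prod (I J : choiceType) (f : I -> C) (g : J -> C) :
  abs_summable f -> abs_summable g ->
  abs_summable (fun p : I * J => f p.1 * g p.2).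
Proof.
move=> [M hM] [N hN]; exists (M * N).
apply: sum_le_le (sum_le_prod (fun=> cabs_ge0 _) (fun=> cabs_ge0 _) hM hN) => p.
by rewrite cabsM.
Qed.

Lemma tsum_prod (I J : choiceType) (f : I -> C) (g : J -> C) :
  abs_summable f -> abs_summable g ->
  tsum (fun p : I * J => f p.1 * g p.2) = tsum f * tsum g.
Proof.
move=> sf sg; have sfg := abs_summable_prod sf sg.
rewrite (tsum_fiber fst sfg) mulrC -tsumZ//; apply: eq_tsum => i /=.
rewrite (@tsum_reindex J _ (fun j => (i, j)))/=.
- by under eq_tsum => j do rewrite eqxx; rewrite tsumZ// mulrC.
- by move=> j j' [].
- by move=> [i' j] /=; case: (i' =P i) => [->|_]; [exists j|rewrite eqxx].
- exact: abs_summable_restr.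
Qed.

Lemma has_sum_exhaust (I : choiceType) (f : I -> C) l (S : nat -> {fset I}) :
  (forall m n, (m <= n)%N -> (S m `<=` S n)%fset) ->
  (forall i, exists n, i \in S n) -> has_sum f l ->
  forall e : R, 0 < e -> exists N, forall n, (N <= n)%N ->
    cabs (\sum_(i <- S n) f i - l) <= e.
Proof.
move=> mono ex hl e e0; have [A hA] := hl _ e0.
have [N hN] : exists N, forall i, i \in enum_fset A -> i \in S N.
  elim: (enum_fset A) => [|i r [N hN]]; first by exists 0%N.
  have [n hn] := ex i; exists (maxn n N) => j; rewrite inE => /orP[/eqP ->|jr].
    exact: (fsubsetP (mono _ _ (leq_maxl n N))).
  exact: (fsubsetP (mono _ _ (leq_maxr n N))) (hN _ jr).
exists N => n Nn; apply: hA; apply/fsubsetP => i iA.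
exact: (fsubsetP (mono _ _ Nn)) (hN _ iA).
Qed.

End UnorderedSums.

(** * Elementary bounds for the sine, the cosine and the exponential *)

Section TrigonometricBounds.
Variable R : realType.
Local Notation C := R[i].
Implicit Types (x y : R).

Lemma sin_MVT x : 0 < x -> exists2 c, 0 < c < x & sin x = cos c * x.
Proof.
move=> x0.
have ds y : y \in `]0, x[%R -> is_derive y 1 (@sin R) (cos y).
  by move=> _; apply: is_derive_sin.
have cs : {within `[0, x], continuous (@sin R)}.
  by apply: continuous_subspaceT => y; apply: continuous_sin.
have [c] := MVT x0 ds cs.
by rewrite in_itv /= => cx; rewrite sin0 !subr0 => E; exists c.
Qed.

Lemma norm_sin_le x : `|sin x| <= `|x|.
Proof.
wlog x0 : x / 0 < x.
  move=> H; case: (ltrgt0P x) => [x0|x0|->]; last by rewrite sin0 normr0.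
    by have := H _ x0; rewrite (gtr0_norm x0).
  have := H (- x); rewrite oppr_gt0 => /(_ x0).
  by rewrite sinN !normrN (ltr0_norm x0).
have [c _ ->] := sin_MVT x0.
by rewrite normrM ler_piMl ?normr_ge0// cos_max.
Qed.

Lemma one_sub_cos x : 1 - cos x = 2 * sin (x / 2) ^+ 2.
Proof.
have {1}-> : x = (x / 2) *+ 2 by rewrite -mulr_natr divfK.
by rewrite cos_mulr2n sin2cos2 mulr2n; ring.
Qed.

Lemma one_sub_cos_le x : 1 - cos x <= x ^+ 2 / 2.
Proof.
rewrite one_sub_cos; have := norm_sin_le (x / 2).
rewrite -(ler_pXn2r (n := 2)) ?nnegrE// !real_normK ?num_real// => h.
nra.
Qed.

Lemma norm_sin_sub_le x : `|x| <= 1 -> `|sin x - x| <= x ^+ 2.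
Proof.
wlog x0 : x / 0 < x.
  move=> H; case: (ltrgt0P x) => [x0 x1|x0 x1|->]; last first.
  - by rewrite sin0 subr0 normr0 expr0n.
  - have := H (- x); rewrite oppr_gt0 sinN sqrrN -opprD normrN normrN.
    by move/(_ x0); rewrite (ltr0_norm x0) => /(_ x1).
  - by apply: H => //; rewrite gtr0_norm.
rewrite gtr0_norm// => x1.
have [c /andP[c0 cx] ->] := sin_MVT x0.
rewrite -{2}(mul1r x) -mulrBl normrM (gtr0_norm x0) distrC expr2 ler_wpM2r ?ltW//.
rewrite ger0_norm ?subr_ge0 ?cos_le1//.
apply: le_lt_trans (one_sub_cos_le c) _; nra.
Qed.

(** A crude form of the concavity of the sine on the quarter period. *)
Lemma sin_lower x : 0 <= x <= pi / 2 -> x / 3 <= sin x.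
Proof.
move=> /andP[x0 x1]; have p4 := @pihalf_lt2 R; have p0 := @pi_gt0 R.
have s4 : sin (pi / 4) = cos (pi / 4) :> R.
  by rewrite -cosBpihalf -cosN; congr cos; field.
have c4 : 2 / 3 <= cos (pi / 4 : R).
  have c0 : 0 <= cos (pi / 4 : R) by apply: cos_ge0_pihalf; lra.
  have := cos2Dsin2 (pi / 4 : R); rewrite s4 => E; nra.
have [x4|x4] := leP x (pi / 4).
  move: x0; rewrite le_eqVlt => /predU1P[<-|x0]; first by rewrite mul0r sin0.
  have [c /andP[c0 cx] ->] := sin_MVT x0.
  have : cos (pi / 4) <= cos c.
    by rewrite le_eqVlt ltr_cos ?in_itv /=; [lra|lra|lra].
  nra.
have : sin (pi / 4) <= sin x.
  by rewrite le_eqVlt ltr_sin ?in_itv /=; [apply/orP; right; lra|lra|lra].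
rewrite s4; lra.
Qed.

End TrigonometricBounds.

Section ExponentialSeries.
Variable R : realType.
Local Notation C := R[i].

Definition cis (x : R) : C := (cos x +i* sin x)%C.

Lemma cisD (x y : R) : cis (x + y) = cis x * cis y.
Proof.
rewrite /cis cosD sinD; apply/eqP; rewrite eq_complex /=.
by apply/andP; split; apply/eqP; ring.
Qed.

Lemma cis0 : cis 0 = 1.
Proof. by rewrite /cis cos0 sin0. Qed.

Lemma cabs_cis x : cabs (cis x) = 1.
Proof. by rewrite cabs_sqrt /= cos2Dsin2 sqrtr1. Qed.

Lemma cis2pi : cis (pi *+ 2) = 1.
Proof. by rewrite /cis cos2pi sin2pi. Qed.

Lemma cis_natmul (x : R) n : cis (x *+ n) = cis x ^+ n.
Proof.
elim: n => [|n IH]; first by rewrite mulr0n cis0.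
by rewrite mulrS cisD IH exprS.
Qed.

Lemma cis_sub1_lower x : 0 <= x <= pi -> x / 3 <= cabs (cis x - 1).
Proof.
move=> /andP[x0 x1].
have -> : cabs (cis x - 1) = 2 * sin (x / 2).
  have s0 : 0 <= 2 * sin (x / 2) by have := @sin_lower R (x / 2); lra.
  rewrite cabs_sqrt /= -[RHS]ger0_norm// -sqrtr_sqr subr0; congr Num.sqrt.
  rewrite sqrrB1 -[LHS]addrA -[LHS]addrA.
  have := cos2Dsin2 x; have := one_sub_cos x; lra.
have := @sin_lower R (x / 2); lra.
Qed.

Lemma expR_quad (x : R) : `|x| <= 2^-1 -> `|expR x - 1 - x| <= 2 * x ^+ 2.
Proof.
move=> hx; rewrite ger0_norm; last by have := expR_ge1Dx x; lra.
have h := expR_ge1Dx (- x); have E := expRxMexpNx_1 x; have e0 := expR_gt0 x.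
move: hx; rewrite ler_norml => /andP[h1 h2].
have : expR x * (1 - x) <= 1 by nra.
nra.
Qed.

Lemma cexp_quad (v : C) : cabs v <= 2^-1 ->
  cabs (cexp v - 1 - v) <= 10 * cabs v ^+ 2.
Proof.
case: v => x y; set v := (x +i* y)%C => hv.
have hx := normRe_le v; have hy := normIm_le v; rewrite /= in hx hy.
have v0 := cabs_ge0 v.
have x2 : x ^+ 2 <= cabs v ^+ 2.
  by rewrite -real_normK ?num_real// ler_pXn2r ?nnegrE.
have y2 : y ^+ 2 <= cabs v ^+ 2.
  by rewrite -[y ^+ 2]real_normK ?num_real// ler_pXn2r ?nnegrE.
have ex := expR_quad (le_trans hx hv).
have c1 := one_sub_cos_le y; have c2 := cos_le1 y.
have s1 := @norm_sin_sub_le R y _; have {}s1 := s1 (le_trans hy (le_trans hv _)).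
have {}s1 : `|sin y - y| <= y ^+ 2 by apply: s1; lra.
have eh : expR x <= 3.
  move: ex hx; rewrite !ler_norml => /andP[_ ex] /andP[_ hx]; nra.
have e0 := expR_gt0 x.
apply: le_trans (cabs_le _) _ => /=.

have -> : expR x * cos y - 0 * sin y - 1 - x =
   (expR x - 1 - x) - expR x * (1 - cos y) by ring.
have -> : expR x * sin y + 0 * cos y - 0 - y =
   expR x * (sin y - y) + (expR x - 1 - x) * y + x * y by ring.
have b1 : `|(expR x - 1 - x) - expR x * (1 - cos y)| <= 2 * cabs v ^+ 2 + 3 * (cabs v ^+ 2 / 2).
  apply: le_trans (ler_normB _ _) _; apply: lerD; first lra.
  by rewrite normrM gtr0_norm// ger0_norm ?subr_ge0// ler_pM ?subr_ge0//; lra.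
have b2 : `|expR x * (sin y - y) + (expR x - 1 - x) * y + x * y| <=
   3 * cabs v ^+ 2 + 2 * cabs v ^+ 2 * 2^-1 + cabs v * cabs v.
  apply: le_trans (ler_normD _ _) _; apply: lerD; last first.
    by rewrite normrM ler_pM.
  apply: le_trans (ler_normD _ _) _; apply: lerD.
    by rewrite normrM gtr0_norm// ler_pM//; lra.
  by rewrite normrM ler_pM//; lra.
move: b1 b2; rewrite -expr2; lra.
Qed.

End ExponentialSeries.

(** * Roots of unity and discrete Cauchy estimates *)

Section CauchyEstimates.
Variable R : realType.
Local Notation C := R[i].

Definition unit_root (n : nat) : C := cis (pi *+ 2 / n%:R).

Lemma unit_root_pow n k : unit_root n ^+ k = cis (pi *+ 2 * k%:R / n%:R).
Proof. by rewrite -cis_natmul; congr cis; rewrite -mulr_natr; ring. Qed.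

Lemma unit_root_n n : (0 < n)%N -> unit_root n ^+ n = 1.
Proof. by move=> n0; rewrite unit_root_pow mulfK ?pnatr_eq0 -?lt0n// cis2pi. Qed.

Lemma cabs_unit_root n : cabs (unit_root n) = 1.
Proof. exact: cabs_cis. Qed.

Lemma unit_root_neq0 n : unit_root n != 0.
Proof. by rewrite -cabs_eq0 cabs_unit_root oner_eq0. Qed.

Lemma unit_root_sub1_lower n k : (k <= n)%N -> (0 < n)%N ->
  (minn k (n - k))%:R / n%:R <= cabs (unit_root n ^+ k - 1).
Proof.
move=> kn n0.
wlog k2 : k kn / (k.*2 <= n)%N.
  move=> H; have [k2|nk] := leqP k.*2 n; first exact: H.
  have := H (n - k)%N; rewrite subKn// minnC => /(_ (leq_subr _ _)) h.
  have {}h := h _; apply: le_trans (h _) _; first by rewrite -addnn; lia.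
  have u0 := unit_root_neq0 n.
  have -> : unit_root n ^+ (n - k) - 1 = (1 - unit_root n ^+ k) / unit_root n ^+ k.
    have -> : unit_root n ^+ (n - k) = 1 / unit_root n ^+ k.
      apply: (mulIf (expf_neq0 k u0)); rewrite -exprD subnK// unit_root_n//.
      by rewrite mul1r mulVf ?expf_neq0.
    by rewrite mulrBl mulfV ?expf_neq0.
  by rewrite cabsM cabsV cabsX cabs_unit_root expr1n invr1 mulr1 cabsBC.
have -> : minn k (n - k) = k by rewrite -addnn in k2; lia.
rewrite unit_root_pow; have n0' : (0 : R) < n%:R by rewrite ltr0n.
have p0 := @pi_ge2 R.
have kn' : (k%:R : R) / n%:R <= 2^-1.
  by rewrite ler_pdivrMr// mulrC ler_pdivlMr// -natrM ler_nat muln2.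
have k0 : 0 <= (k%:R : R) / n%:R by rewrite divr_ge0.
rewrite -mulrA; apply: le_trans (cis_sub1_lower _); first by rewrite mulr2n; nra.
by rewrite mulr2n; nra.
Qed.

Lemma unit_root_neq1 n k : (0 < k < n)%N -> unit_root n ^+ k != 1.
Proof.
move=> /andP[k0 kn]; rewrite -subr_eq0 -cabs_gt0.
apply: lt_le_trans (unit_root_sub1_lower (ltnW kn) (leq_ltn_trans _ kn)) => //.
by rewrite divr_gt0// ltr0n; lia.
Qed.

Lemma geometric_sum0 (q : C) n : q ^+ n = 1 -> q != 1 -> \sum_(j < n) q ^+ j = 0.
Proof.
move=> qn q1; apply: (mulfI (x := q - 1)); first by rewrite subr_eq0.
by rewrite -subrX1 qn subrr mulr0.
Qed.

(** Averaging over the [n]-th roots of unity isolates a coefficient as soon as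
[n] exceeds the degree: a discrete form of Cauchy's formula. *)
Lemma poly_coef_bound (q : {poly C}) (M r : R) k : 0 < r ->
  (forall t, cabs t <= r -> cabs q.[t] <= M) -> cabs q`_k * r ^+ k <= M.
Proof.
move=> r0 h; pose n := (maxn (size q) k).+1.
have n0 : (0 < n)%N by [].
pose w := unit_root n; have w0 : w != 0 by apply: unit_root_neq0.
pose t j : C := r%:C%C * w ^+ j.
have tr j : cabs (t j) = r.
  by rewrite /t cabsM cabsX cabs_unit_root expr1n mulr1 cabs_real gtr0_norm.
have E : \sum_(j < n) q.[t j] / w ^+ (j * k) = n%:R * (q`_k * r%:C%C ^+ k).
  under eq_bigr => j _ do rewrite (@horner_coef_wide _ n) ?leqW ?leq_maxl// mulr_suml.
  rewrite exchange_big /= (bigD1 (Ordinal (leq_maxr (size q) k : (k < n)%N))) //=.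
  rewrite [X in _ + X]big1 ?addr0; last first.
    move=> i ik.
    rewrite (eq_bigr (fun j : 'I_n => q`_i * r%:C%C ^+ i * (w ^+ i / w ^+ k) ^+ j)); last first.
      move=> j _; rewrite /t exprMn exprMn exprVn -!exprM (mulnC i) (mulnC k).
      by rewrite !mulrA.
    rewrite -mulr_sumr geometric_sum0 ?mulr0//.
      rewrite exprMn exprVn -!exprM mulnC (mulnC k) !exprM unit_root_n//.
      by rewrite !expr1n invr1 mulr1.
    apply/eqP => /(congr1 (fun x => x * w ^+ k)).
    rewrite mul1r divfK ?expf_neq0// => wik.
    have {}ik : (i : nat) != k by apply: contra ik => /eqP ik; apply/eqP/val_inj.
    have kn : (k < n)%N by rewrite ltnS leq_maxr.
    have [ltik|ltki|E] := ltngtP i k; last by rewrite E eqxx in ik.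
      have := @unit_root_neq1 n (k - i); rewrite subn_gt0 ltik (leq_ltn_trans (leq_subr _ _) kn).
      by move=> /(_ isT); rewrite -/w expfB// -wik mulfV ?expf_neq0// eqxx.
    have := @unit_root_neq1 n (i - k); rewrite subn_gt0 ltki (leq_ltn_trans (leq_subr _ _) (ltn_ord i)).
    by move=> /(_ isT); rewrite -/w expfB// wik mulfV ?expf_neq0// eqxx.
  rewrite (eq_bigr (fun j : 'I_n => q`_k * r%:C%C ^+ k)); last first.
    move=> j _; rewrite /t exprMn -exprM mulrA mulfK ?expf_neq0//.
  by rewrite sumr_const card_ord mulr_natl.
have : cabs (\sum_(j < n) q.[t j] / w ^+ (j * k)) <= \sum_(j < n) M.
  apply: le_trans (cabs_sum _ _ _) _; apply: ler_sum => j _.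
  rewrite cabsM cabsV cabsX cabs_unit_root expr1n invr1 mulr1.
  by apply: h; rewrite tr.
rewrite E sumr_const card_ord cabsM cabs_nat -[M *+ _]mulr_natl ler_pM2l ?ltr0n//.
by rewrite cabsM cabsX cabs_real gtr0_norm.
Qed.

Lemma geometric_half n : \sum_(i < n) (2^-1 : R) ^+ i <= 2.
Proof.
have E : (2^-1 - 1) * (\sum_(i < n) (2^-1 : R) ^+ i) = 2^-1 ^+ n - 1 by rewrite -subrX1.
have : 0 <= (2^-1 : R) ^+ n by rewrite exprn_ge0.
lra.
Qed.

(** Dividing out a zero costs a factor [4 / r] in the sup norm of the disc. *)
Lemma poly_quotient_bound (h : {poly C}) (c : C) (M r : R) : 0 < r ->
  (forall t, cabs t <= r -> cabs (c%:P + 'X * h).[t] <= M) ->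
  forall t, cabs t <= r -> cabs h.[t] <= 4 * M / r.
Proof.
move=> r0 hM t tr.
have M0 : 0 <= M by apply: le_trans (hM t tr); apply: cabs_ge0.
have hE u : (c%:P + 'X * h).[u] = c + u * h.[u] by rewrite !hornerE.
have [tr2|tr2] := leP (cabs t) (r / 2); last first.
  have h1 := hM t tr; have := hM 0; rewrite cabs0 => /(_ (ltW r0)).
  rewrite !hE mul0r addr0 in h1 * => h2.
  have : cabs (t * h.[t]) <= M + M.
    have -> : t * h.[t] = (c + t * h.[t]) - c by ring.
    by apply: le_trans (cabsB _ _) _; apply: lerD.
  rewrite cabsM ler_pdivlMr// => h3.
  have := cabs_ge0 h.[t]; nra.
have ck k : cabs h`_k <= M / r ^+ k.+1.
  rewrite ler_pdivlMr ?exprn_gt0//.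
  have := poly_coef_bound k.+1 r0 hM.
  by rewrite coefD coefC coefXM /= add0r.
rewrite horner_coef; apply: le_trans (cabs_sum _ _ _) _.
apply: (@le_trans _ _ (\sum_(i < size h) M / r * 2^-1 ^+ i)).
  apply: ler_sum => i _; rewrite cabsM cabsX.
  have -> : M / r * 2^-1 ^+ i = (M / r ^+ i.+1) * (r / 2) ^+ i.
    rewrite exprMn exprS; field.
    by rewrite expf_neq0 ?gt_eqF.
  apply: ler_pM; rewrite ?exprn_ge0 ?cabs_ge0// lerXn2r ?nnegrE ?cabs_ge0//.
  by rewrite divr_ge0// ltW.
rewrite -mulr_sumr mulrAC -mulrA.
have := @geometric_half (size h); set S := \sum_(i < _) _ => hS.
have : 0 <= M / r by rewrite divr_ge0// ltW.
nra.
Qed.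

Lemma real_cauchy_limit (u : nat -> R) (K : R) :
  (forall m n, u m - u n <= K / m.+1%:R + K / n.+1%:R) ->
  exists l, forall n, `|u n - l| <= K / n.+1%:R.
Proof.
move=> h; pose S := [set x | exists n, x = u n - K / n.+1%:R].
have S0 : has_sup S.
  split; first by exists (u 0%N - K / 1); exists 0%N.
  exists (u 0%N + K / 1%:R) => x [n ->]; have := h n 0%N.
  move: (K / n.+1%:R) (K / 1%:R) => k k'; lra.
exists (sup S) => n; rewrite ler_norml; apply/andP; split; last first.
  have : u n - K / n.+1%:R <= sup S by apply: sup_upper_bound => //; exists n.
  move: (K / n.+1%:R) => k; lra.
have : sup S <= u n + K / n.+1%:R.
  apply: ge_sup; first by case: S0.
  move=> x [m ->]; have := h m n.
  move: (K / n.+1%:R) (K / m.+1%:R) => k k'; lra.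
move: (K / n.+1%:R) => k; lra.
Qed.

Lemma cauchy_limit (u : nat -> C) (K : R) :
  (forall m n, cabs (u m - u n) <= K / m.+1%:R + K / n.+1%:R) ->
  exists l, forall n, cabs (u n - l) <= 2 * K / n.+1%:R.
Proof.
move=> h.
have [|a ha] := @real_cauchy_limit (fun n => complex.Re (u n)) K.
  move=> m n; apply: le_trans (h m n); apply: le_trans (normRe_le _).
  by rewrite raddfB ler_norm.
have [|b hb] := @real_cauchy_limit (fun n => complex.Im (u n)) K.
  move=> m n; apply: le_trans (h m n); apply: le_trans (normIm_le _).
  by rewrite raddfB ler_norm.
exists (a +i* b)%C => n; apply: le_trans (cabs_le _) _.
rewrite !raddfB /=; have := ha n; have := hb n; rewrite -mulrA.
move: (K / n.+1%:R) => k; lra.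
Qed.

End CauchyEstimates.

(** * Holomorphy through uniform polynomial approximation *)

Section UniformLimits.
Variable R : realType.
Local Notation C := R[i].
Implicit Types (B : C -> Prop) (f g : C -> C).

Definition disk (s0 : C) (r : R) : C -> Prop := fun s => cabs (s - s0) <= r.

(** Uniform limits of polynomials on [B]; on a disc these are the functions
continuous there and holomorphic inside. *)
Definition uholo B f : Prop := forall e : R, 0 < e ->
  exists p : {poly C}, forall s, B s -> cabs (f s - p.[s]) <= e.

Definition cbounded B : Prop := exists r : R, forall s, B s -> cabs s <= r.

Lemma disk_bounded s0 r : cbounded (disk s0 r).
Proof.
exists (cabs s0 + r) => s h; have -> : s = s0 + (s - s0) by ring.
by apply: le_trans (cabsD _ _) _; rewrite lerD2l.
Qed.

Lemma uholo_poly B (p : {poly C}) : uholo B (horner p).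
Proof. by move=> e e0; exists p => s _; rewrite subrr cabs0 ltW. Qed.

Lemma uholo_cst B (k : C) : uholo B (fun=> k).
Proof. by move=> e e0; exists k%:P => s _; rewrite hornerC subrr cabs0 ltW. Qed.

Lemma uholo_id B : uholo B (fun s => s).
Proof. by move=> e e0; exists 'X => s _; rewrite hornerX subrr cabs0 ltW. Qed.

Lemma uholo_eq B f g : (forall s, B s -> f s = g s) -> uholo B f -> uholo B g.
Proof.
by move=> fg h e /h[p hp]; exists p => s Bs; rewrite -fg//; apply: hp.
Qed.

Lemma uholo_sub B B' f : (forall s, B' s -> B s) -> uholo B f -> uholo B' f.
Proof. by move=> BB h e /h[p hp]; exists p => s /BB; apply: hp. Qed.

Lemma uholo_lim B f : (forall e : R, 0 < e -> exists2 g, uholo B g &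
  forall s, B s -> cabs (f s - g s) <= e) -> uholo B f.
Proof.
move=> h e e0; have e2 : 0 < e / 2 by rewrite divr_gt0.
have [g gu fg] := h _ e2; have [p hp] := gu _ e2; exists p => s Bs.
have -> : f s - p.[s] = (f s - g s) + (g s - p.[s]) by ring.
by apply: le_trans (cabsD _ _) _; have := fg s Bs; have := hp s Bs; lra.
Qed.

Lemma uholoD B f g : uholo B f -> uholo B g -> uholo B (fun s => f s + g s).
Proof.
move=> hf hg e e0; have e2 : 0 < e / 2 by rewrite divr_gt0.
have [p hp] := hf _ e2; have [q hq] := hg _ e2; exists (p + q) => s Bs.
rewrite hornerD opprD addrACA.
by apply: le_trans (cabsD _ _) _; have := hp s Bs; have := hq s Bs; lra.
Qed.

Lemma poly_bounded B (p : {poly C}) : cbounded B ->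
  exists M : R, forall s, B s -> cabs p.[s] <= M.
Proof.
move=> [r hr]; exists (\sum_(i < size p) cabs p`_i * r ^+ i) => s Bs.
rewrite horner_coef; apply: le_trans (cabs_sum _ _ _) _; apply: ler_sum => i _.
rewrite cabsM cabsX ler_wpM2l ?cabs_ge0// lerXn2r ?nnegrE ?cabs_ge0//; last exact: hr.
by apply: le_trans (hr s Bs); apply: cabs_ge0.
Qed.

Lemma uholo_bounded B f : cbounded B -> uholo B f ->
  exists2 M : R, 0 <= M & forall s, B s -> cabs (f s) <= M.
Proof.
move=> bB hf; have [p hp] := hf 1 ltr01; have [M hM] := poly_bounded p bB.
exists (`|M| + 1) => [|s Bs]; first by rewrite addr_ge0.
have -> : f s = p.[s] + (f s - p.[s]) by ring.
apply: le_trans (cabsD _ _) _; apply: lerD; last exact: hp.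
exact: le_trans (hM s Bs) (ler_norm _).
Qed.

Lemma uholoM B f g : cbounded B ->
  uholo B f -> uholo B g -> uholo B (fun s => f s * g s).
Proof.
move=> bB hf hg e e0.
have [M M0 hM] := uholo_bounded bB hf.
have [N N0 hN] := uholo_bounded bB hg.
have d0 : 0 < e / (M + N + 1 + e) by rewrite divr_gt0//; lra.
set d := e / _ in d0.
have d1 : d <= 1 by rewrite ler_pdivrMr; lra.
have dE : d * (M + N + 1 + e) = e by rewrite divfK// gt_eqF//; lra.
have [p hp] := hf _ d0; have [q hq] := hg _ d0; exists (p * q) => s Bs.
have -> : f s * g s - (p * q).[s] = (f s - p.[s]) * g s +
   (f s - (f s - p.[s])) * (g s - q.[s]) by rewrite hornerM; ring.
apply: le_trans (cabsD _ _) _; rewrite !cabsM.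
have h1 : cabs (f s - p.[s]) * cabs (g s) <= d * N.
  by apply: ler_pM; rewrite ?cabs_ge0//; [apply: hp|apply: hN].
have h2 : cabs (f s - (f s - p.[s])) * cabs (g s - q.[s]) <= (M + d) * d.
  apply: ler_pM; rewrite ?cabs_ge0//; last exact: hq.
  by apply: le_trans (cabsB _ _) _; apply: lerD; [apply: hM|apply: hp].
nra.
Qed.

Lemma uholoZ B f k : cbounded B -> uholo B f -> uholo B (fun s => k * f s).
Proof. by move=> bB; apply: uholoM => //; apply: uholo_cst. Qed.

Lemma uholoB B f g : cbounded B -> uholo B f -> uholo B g ->
  uholo B (fun s => f s - g s).
Proof.
move=> bB hf hg; apply: uholo_eq (uholoD hf (uholoZ (-1) bB hg)) => s _.
by rewrite mulN1r.
Qed.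

Lemma uholo_sum (I : Type) (r : seq I) B (f : I -> C -> C) :
  (forall i, uholo B (f i)) -> uholo B (fun s => \sum_(i <- r) f i s).
Proof.
move=> h; elim: r => [|i r IH].
  by apply: uholo_eq (uholo_cst B 0) => s _; rewrite big_nil.
by apply: uholo_eq (uholoD (h i) IH) => s _; rewrite big_cons.
Qed.

(** Weierstrass' test: a finite set carrying all but [e] of the majorant gives a
uniform approximation by a finite sum. *)
Lemma uholo_tsum (I : choiceType) B (f : I -> C -> C) (b : I -> R) M :
  (forall i, uholo B (f i)) -> (forall i s, B s -> cabs (f i s) <= b i) ->
  (forall i, 0 <= b i) -> sum_le b M -> uholo B (fun s => tsum (fun i => f i s)).
Proof.
move=> hf fb b0 hM; apply: uholo_lim => e e0.
have [A hA] := sum_le_tail b0 hM e0.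
exists (fun s => \sum_(i <- A) f i s); first exact: uholo_sum.
move=> s Bs.
have sf : abs_summable (fun i => f i s).
  by exists M; apply: sum_le_le hM => i; apply: fb.
have hs : has_sum (fun i => if i \in A then f i s else 0) (\sum_(i <- A) f i s).
  move=> d d0; exists A => D AD.
  rewrite -big_mkcond -big_filter (_ : \sum_(i <- seq.filter _ D) _ = \sum_(i <- A) f i s).
    by rewrite subrr cabs0 ltW.
  apply: perm_big; apply: uniq_perm; rewrite ?filter_uniq ?fset_uniq//.
  move=> i; rewrite mem_filter /=; case iA : (i \in A) => //=.
  by rewrite (fsubsetP AD).
apply: has_sum_bound (has_sumB (summable_has_sum sf) hs) => D.
apply: le_trans (cabs_sum _ _ _) _.
apply: le_trans (hA (D `\` A)%fset _); last first.
  by apply/fdisjointP => x xA; rewrite !inE xA.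
rewrite (bigID (mem A)) /= big1 ?add0r; last first.
  by move=> i iA; rewrite iA subrr cabs0.
rewrite -big_filter (perm_big (D `\` A)%fset) /=; last first.
  apply: uniq_perm; rewrite ?filter_uniq ?fset_uniq//.
  by move=> i; rewrite mem_filter in_fsetD.
rewrite big_seq [leRHS]big_seq; apply: ler_sum => i; rewrite in_fsetD => /andP[/negbTE -> _].
by rewrite subr0; apply: fb.
Qed.

(** Raising [exp (u / m) = 1 + u / m + O(m ^ -2)] to the power [m] leaves an error
[O(1 / m)]; this is what puts the exponentials into [uholo]. *)
Lemma cexp_compound (u : C) (r : R) (m : nat) : (0 < m)%N -> cabs u <= r ->
  2 * r <= m%:R ->
  cabs (cexp u - (1 + m%:R^-1 * u) ^+ m) <= 10 * r ^+ 2 * expR r / m%:R.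
Proof.
move=> m0 ur rm; have m0' : (0 : R) < m%:R by rewrite ltr0n.
have u0 := cabs_ge0 u.
pose v : C := m%:R^-1 * u.
have vE : cabs v = cabs u / m%:R by rewrite cabsM cabsV cabs_nat mulrC.
have vr : cabs v <= r / m%:R by rewrite vE ler_wpM2r// invr_ge0 ltW.
have v2 : cabs v <= 2^-1.
  apply: le_trans vr _; rewrite ler_pdivrMr//; lra.
have cE n : cexp (n%:R * v) = cexp v ^+ n.
  elim: n => [|n IH]; first by rewrite mul0r cexp0.
  by rewrite -addn1 natrD mulrDl mul1r cexpD IH addn1 exprSr.
have -> : cexp u = cexp v ^+ m.
  by rewrite -cE /v mulrA mulfV ?mul1r// pnatr_eq0 -lt0n.
rewrite -/v subrXX cabsM.
have er : expR (r / m%:R) ^+ m = expR r by rewrite -expRM_natr divfK// gt_eqF.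
have e1 : 1 <= expR (r / m%:R).
  by rewrite -[leLHS]expR0 ler_expR divr_ge0//; lra.
have b1 : cabs (cexp v) <= expR (r / m%:R).
  rewrite cabs_cexp ler_expR; apply: le_trans (ler_norm _) _.
  exact: le_trans (normRe_le _) vr.
have b2 : cabs (1 + v) <= expR (r / m%:R).
  apply: le_trans (cabsD _ _) _; rewrite cabs1; have := expR_ge1Dx (r / m%:R); lra.
have b3 : cabs (cexp v - (1 + v)) <= 10 * (r / m%:R) ^+ 2.
  rewrite opprD addrA; apply: le_trans (cexp_quad v2) _.
  by rewrite ler_pM2l// lerXn2r ?nnegrE ?cabs_ge0//; apply: le_trans (cabs_ge0 _) vr.
have b4 : cabs (\sum_(i < m) cexp v ^+ (m.-1 - i) * (1 + v) ^+ i) <= m%:R * expR r.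
  apply: le_trans (cabs_sum _ _ _) _.
  apply: (@le_trans _ _ (\sum_(i < m) expR r)); last by rewrite sumr_const card_ord mulr_natl.
  apply: ler_sum => i _; rewrite cabsM !cabsX.
  have im : (m.-1 - i + i)%N = m.-1 by rewrite subnK// -ltnS prednK.
  apply: (@le_trans _ _ (expR (r / m%:R) ^+ m.-1)).
    rewrite -{2}im exprD; apply: ler_pM; rewrite ?exprn_ge0 ?cabs_ge0// lerXn2r ?nnegrE ?cabs_ge0 ?expR_ge0//.
  rewrite -er -[X in _ <= _ ^+ X](prednK m0) exprS.
  by apply: ler_peMl => //; apply: exprn_ge0; apply: expR_ge0.
apply: le_trans (ler_pM (cabs_ge0 _) (cabs_ge0 _) b3 b4) _.
rewrite le_eqVlt; apply/orP; left; apply/eqP; field; lra.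
Qed.

Lemma uholo_cexp B (a : C) : cbounded B -> uholo B (fun s => cexp (a * s)).
Proof.
move=> [r hr] e e0.
pose r' := cabs a * `|r|.
have h s : B s -> cabs (a * s) <= r'.
  by move=> /hr h; rewrite cabsM ler_wpM2l ?cabs_ge0//; apply: le_trans h (ler_norm _).
have r0 : 0 <= r' by rewrite mulr_ge0 ?cabs_ge0.
pose K := 10 * r' ^+ 2 * expR r'.
have K0 : 0 <= K by rewrite /K mulr_ge0 ?expR_ge0// mulr_ge0// exprn_ge0.
pose m := (Num.truncn (2 * r' + K / e)).+1.
have hm : 2 * r' + K / e < m%:R by apply: truncnS_gt.
have m0 : (0 : R) < m%:R by rewrite ltr0n.
have Ke : 0 <= K / e by rewrite divr_ge0// ltW.
exists ((1 + (m%:R^-1 * a) *: 'X) ^+ m) => s Bs.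
rewrite horner_exp !hornerE -mulrA.
apply: le_trans (cexp_compound (ltn0Sn _) (h _ Bs) _) _.
  by apply: le_trans (ltW hm); rewrite lerDl.
rewrite -/K ler_pdivrMr// mulrC -ler_pdivrMr//.
by apply: le_trans (ltW hm); rewrite lerDr mulr_ge0.
Qed.

(** Removable singularities: by [poly_quotient_bound] the polynomial quotients
converge uniformly on the whole disc, the zero included. *)
Lemma uholo_quotient (s0 : C) (r : R) f : 0 < r -> uholo (disk s0 r) f ->
  exists2 g, uholo (disk s0 r) g & forall s, f s - f s0 = (s - s0) * g s.
Proof.
move=> r0 hf.
have eps0 n : (0 : R) < n.+1%:R^-1 by rewrite invr_gt0.
pose p n := projT1 (cid (hf _ (eps0 n))).
have hp n s : disk s0 r s -> cabs (f s - (p n).[s]) <= n.+1%:R^-1.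
  by rewrite /p; case: cid => q /= hq; apply: hq.
pose q n : {poly C} := p n \Po ('X + s0%:P).
have qE n t : (q n).[t] = (p n).[s0 + t] by rewrite /q horner_comp !hornerE addrC.
pose h n := drop_poly 1 (q n).
have qh n : q n = ((q n)`_0)%:P + 'X * h n.
  rewrite -{1}[q n](poly_take_drop 1) /h mulrC expr1; congr (_ + _).
  by apply/polyP => i; rewrite coef_take_poly coefC; case: i.
have q0 n u : (q n).[u] = (q n)`_0 + u * (h n).[u].
  by rewrite {1}qh hornerD hornerM hornerX hornerC.
have dsk t : cabs t <= r -> disk s0 r (s0 + t) by rewrite /disk addrAC subrr add0r.
have hd m n t : cabs t <= r ->
    cabs ((h m).[t] - (h n).[t]) <= 4 / r * m.+1%:R^-1 + 4 / r * n.+1%:R^-1.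
  move=> tr; rewrite -hornerN -hornerD.
  have -> : 4 / r * m.+1%:R^-1 + 4 / r * n.+1%:R^-1 =
    4 * (m.+1%:R^-1 + n.+1%:R^-1) / r
    by rewrite mulrDr mulrDl; congr (_ + _); rewrite mulrAC.
  apply: (@poly_quotient_bound R (h m - h n) ((q m)`_0 - (q n)`_0) _ _ r0 _ t tr).
  move=> u ur.
  rewrite polyCB mulrBr addrACA -opprD -!qh hornerD hornerN !qE.
  have -> : (p m).[s0 + u] - (p n).[s0 + u] =
    (f (s0 + u) - (p n).[s0 + u]) - (f (s0 + u) - (p m).[s0 + u]) by ring.
  by rewrite [leRHS]addrC; apply: le_trans (cabsB _ _) _; apply: lerD; apply: hp; apply: dsk.
have [|l hl] := @cauchy_limit R (fun n => (h n).[0]) (4 / r).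
  by move=> m n; apply: hd; rewrite cabs0 ltW.
pose g s := if s == s0 then l else (f s - f s0) / (s - s0).
exists g => [|s]; last first.
  rewrite /g; case: eqP => [->|/eqP ns]; first by rewrite !subrr mul0r.
  by rewrite mulrC divfK// subr_eq0.
have hg n s : disk s0 r s -> cabs (g s - (h n).[s - s0]) <= 8 / r * n.+1%:R^-1.
  move=> Ds; rewrite /g; case: eqP => [->|/eqP ns].
    rewrite subrr cabsBC cabsBC; have := hl n; rewrite cabsBC.
    by have -> : 2 * (4 / r) = 8 / r by field; lra.
  have ts : s - s0 != 0 by rewrite subr_eq0.
  have ts' : 0 < cabs (s - s0) by rewrite cabs_gt0.
  apply/ler_addgt0Pl => d d0.
  (* compare through an auxiliary index so large that its own error is below [d] *)
  pose A := 2 / cabs (s - s0) + 4 / r.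
  have A0 : 0 < A by rewrite addr_gt0 ?divr_gt0.
  pose m := Num.truncn (A / d).
  have md : A * m.+1%:R^-1 <= d.
    by rewrite ler_pdivrMr// mulrC -ler_pdivrMr// ltW// truncnS_gt.
  have h1 : cabs ((f s - f s0) / (s - s0) - (h m).[s - s0]) <= 2 / cabs (s - s0) * m.+1%:R^-1.
    have -> : (h m).[s - s0] = ((p m).[s] - (p m).[s0]) / (s - s0).
      have := qE m (s - s0); rewrite (addrC s0) subrK => <-.
      have := qE m 0; rewrite addr0 => <-.
      by rewrite !q0 mul0r addr0 addrAC subrr add0r mulrC mulKf.
    rewrite -mulrBl cabsM cabsV mulrAC ler_wpM2r ?invr_ge0 ?cabs_ge0//.
    have -> : f s - f s0 - ((p m).[s] - (p m).[s0]) = (f s - (p m).[s]) - (f s0 - (p m).[s0]) by ring.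
    apply: le_trans (cabsB _ _) _; rewrite mulr_natl mulr2n; apply: lerD; apply: hp => //.
    by rewrite /disk subrr cabs0 ltW.
  have h2 := hd m n _ Ds.
  have -> : (f s - f s0) / (s - s0) - (h n).[s - s0] =
    ((f s - f s0) / (s - s0) - (h m).[s - s0]) + ((h m).[s - s0] - (h n).[s - s0]) by ring.
  apply: le_trans (cabsD _ _) _; apply: le_trans (lerD h1 h2) _.
  move: md; rewrite /A.
  have n1 := eps0 n; have r1 : 0 < r^-1 by rewrite invr_gt0.
  move: (m.+1%:R^-1) (n.+1%:R^-1) (r^-1) ((cabs (s - s0))^-1) n1 r1 => x y z w n1 r1; nra.
apply: uholo_lim => e e0.
pose n := Num.truncn (8 / r / e).
have hn : 8 / r * n.+1%:R^-1 <= e.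
  by rewrite ler_pdivrMr// [e * _]mulrC -ler_pdivrMr// ltW// truncnS_gt.
exists (horner (h n \Po ('X - s0%:P))); first exact: uholo_poly.
by move=> s Ds; rewrite horner_comp !hornerE; apply: le_trans (hg n s Ds) hn.
Qed.

Lemma poly_lipschitz (p : {poly C}) (s0 : C) : exists2 L : R, 0 <= L &
  forall t, cabs t <= 1 -> cabs (p.[s0 + t] - p.[s0]) <= L * cabs t.
Proof.
pose q := p \Po ('X + s0%:P).
have qE t : q.[t] = p.[s0 + t] by rewrite /q horner_comp !hornerE addrC.
have [M hM] := @poly_bounded (disk 0 1) (drop_poly 1 q) (disk_bounded _ _).
exists `|M| => // t t1.
have qh : q = (q`_0)%:P + 'X * drop_poly 1 q.
  rewrite -{1}[q](poly_take_drop 1) mulrC expr1; congr (_ + _).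
  by apply/polyP => i; rewrite coef_take_poly coefC; case: i.
have q0 u : q.[u] = q`_0 + u * (drop_poly 1 q).[u].
  by rewrite {1}qh hornerD hornerM hornerX hornerC.
have -> : p.[s0 + t] - p.[s0] = t * (drop_poly 1 q).[t].
  by rewrite -qE -[X in p.[X]]addr0 -qE !q0 mul0r addr0 addrAC subrr add0r.
rewrite cabsM mulrC ler_wpM2r ?cabs_ge0//.
by apply: le_trans (hM t _) (ler_norm _); rewrite /disk subr0.
Qed.

Lemma uholo_continuous_center (s0 : C) (r : R) f : 0 < r ->
  uholo (disk s0 r) f -> forall e : R, 0 < e -> exists2 d : R, 0 < d &
  forall t, cabs t <= d -> cabs (f (s0 + t) - f s0) <= e.
Proof.
move=> r0 hf e e0.
have [|p hp] := hf (e / 4); first by rewrite divr_gt0.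
have [L L0 hL] := poly_lipschitz p s0.
pose d := Num.min r (Num.min 1 (e / (2 * (L + 1)))).
have d0 : 0 < d by rewrite !lt_min r0 ltr01 divr_gt0//; lra.
exists d => // t; rewrite !le_min => /and3P[tr t1 tL].
have -> : f (s0 + t) - f s0 = (f (s0 + t) - p.[s0 + t]) + (p.[s0 + t] - p.[s0]) - (f s0 - p.[s0]) by ring.
have h1 : cabs (f (s0 + t) - p.[s0 + t]) <= e / 4.
  by apply: hp; rewrite /disk addrAC subrr add0r.
have h2 : cabs (f s0 - p.[s0]) <= e / 4 by apply: hp; rewrite /disk subrr cabs0 ltW.
have h3 : cabs (p.[s0 + t] - p.[s0]) <= e / 2.
  apply: le_trans (hL t t1) _; move: tL; rewrite ler_pdivlMr; last lra.
  have := cabs_ge0 t; nra.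
apply: le_trans (cabsB _ _) _; have := cabsD (f (s0 + t) - p.[s0 + t]) (p.[s0 + t] - p.[s0]).
lra.
Qed.

Lemma uholo_derivable (s0 : C) (r : R) f : 0 < r -> uholo (disk s0 r) f ->
  derivable (f : R[i]^o -> R[i]^o) s0 1.
Proof.
move=> r0 hf; have [g gu fg] := uholo_quotient r0 hf.
apply: (cvgP (g s0 : R[i]^o)); apply/cvgrPdist_le => e e0.
have eE : e = (complex.Re e)%:C%C.
  by move: (e0); rewrite ltcE => /andP[/eqP h _]; case: e h {e0} => a b /= ->.
have e0' : 0 < complex.Re e by move: e0; rewrite {1}eE ltcR.
have [d d0 hd] := uholo_continuous_center r0 gu e0'.
near=> h.
have h0 : h != 0 by near: h; exact: nbhs_dnbhs_neq.
have hE : f (h *: 1 + s0) - f s0 = h * g (s0 + h).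
  have -> : h *: 1 + s0 = s0 + h by rewrite addrC -[h *: 1]/(h * 1) mulr1.
  by rewrite fg addrAC subrr add0r.
rewrite /= hE -[h^-1 *: _]/(h^-1 * _) mulKf// distrC cabsE eE lecR; apply: hd.
suff : `|h| <= d%:C%C by rewrite cabsE lecR.
by near: h; apply: dnbhs0_le; rewrite ltcR.
Unshelve. all: by end_near.
Qed.

End UniformLimits.

(** * The power factor and the weight *)

Section PowerFactor.
Variable R : realType.
Local Notation C := R[i].
Implicit Types (u v s : C) (x y : R).

(** [Pf v s] is [conj v * |v| ^ (- 2 s)], the common shape of all terms. *)
Definition Pf v s : C := v^* * cexp (- (2 * s) * (ln (cabs v))%:C%C).

Lemma Pf0 s : Pf 0 s = 0.
Proof. by rewrite /Pf rmorph0 mul0r. Qed.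

Lemma PfM u v s : Pf (u * v) s = Pf u s * Pf v s.
Proof.
have [->|u0] := eqVneq u 0; first by rewrite mul0r Pf0 mul0r.
have [->|v0] := eqVneq v 0; first by rewrite mulr0 Pf0 mulr0.
rewrite /Pf rmorphM cabsM lnM ?posrE ?cabs_gt0// rmorphD mulrDr cexpD.
ring.
Qed.

Lemma cabs_Pf v s : v != 0 -> cabs (Pf v s) = cabs v `^ (1 - 2 * complex.Re s).
Proof.
move=> v0; have c0 : 0 < cabs v by rewrite cabs_gt0.
rewrite /Pf cabsM cabs_conj cabs_cexp /powR gt_eqF// -{1}[cabs v]lnK ?posrE//.
by rewrite -expRD; congr expR; case: s => a b /=; ring.
Qed.

Lemma Pf_at1 v : Pf v 1 = v^-1.
Proof.
have [->|v0] := eqVneq v 0; first by rewrite Pf0 invr0.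
have c0 : 0 < cabs v by rewrite cabs_gt0.
have E : cexp (- (2 * 1) * (ln (cabs v))%:C%C) = (cabs v)%:C%C ^- 2.
  have -> : - (2 * 1) * (ln (cabs v))%:C%C = (- (ln (cabs v) + ln (cabs v)))%:C%C :> C.
    by rewrite rmorphN rmorphD; ring.
  by rewrite cexp_real expRN expRD lnK ?posrE// -expr2 fmorphV rmorphXn.
by rewrite /Pf E mulrC (invC_norm v) cabsE.
Qed.

Lemma uholo_Pf (B : C -> Prop) v : cbounded B -> uholo B (Pf v).
Proof.
move=> bB; apply: uholoZ => //.
apply: uholo_eq (uholo_cexp (- 2 * (ln (cabs v))%:C%C) bB) => s _.
by congr cexp; ring.
Qed.

Lemma Xi_term1 z1 z2 s g :
  Xi_term 1 z1 z2 s g = Pf (mu g z1 z2 * mu g z1 z2^*) s.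
Proof.
rewrite /Xi_term PfM !expr1 /cpowR; set a := mu _ _ _; set b := mu _ _ _.
by rewrite invfM -!cexpN /Pf !mulNr mulrACA.
Qed.

Lemma cexp_sub1_le u : cabs (cexp u - 1) <= 3 * cabs u * expR (cabs u).
Proof.
case: u => x y; set u := (x +i* y)%C.
have hx := normRe_le u; have hy := normIm_le u; rewrite /= in hx hy.
have u0 := cabs_ge0 u.
have ex : expR x <= expR (cabs u) by rewrite ler_expR; apply: le_trans (ler_norm _) hx.
have e1 : 1 <= expR (cabs u) by rewrite -[leLHS]expR0 ler_expR.
have e0 := expR_gt0 x.
have c1 : `|cos y - 1| <= cabs u.
  rewrite distrC ger0_norm ?subr_ge0 ?cos_le1// one_sub_cos.
  have := norm_sin_le (y / 2); have := sin_max (y / 2).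
  rewrite normrM (@ger0_norm _ 2^-1) ?invr_ge0// -[sin _ ^+ 2]real_normK ?num_real//.
  have := normr_ge0 (sin (y / 2)); nra.
have s1 : `|sin y| <= cabs u by apply: le_trans (norm_sin_le y) hy.
have x1 : `|expR x - 1| <= cabs u * expR (cabs u).
  have [x0|x0] := leP 0 x.
    rewrite ger0_norm; last by have := expR_ge1Dx x; lra.
    rewrite ger0_norm// in hx.
    have xe : x * expR x <= cabs u * expR (cabs u) by rewrite ler_pM// ltW.
    have : expR x * (1 + - x) <= expR x * expR (- x).
      by rewrite ler_pM2l// expR_ge1Dx.
    by rewrite expRxMexpNx_1; lra.
  rewrite ler0_norm; last by rewrite subr_le0 expR_le1 ltW.
  rewrite ltr0_norm// in hx; have := expR_ge1Dx x.
  have : cabs u <= cabs u * expR (cabs u) by rewrite ler_peMr.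
  lra.
apply: le_trans (cabs_le _) _ => /=.
have -> : expR x * cos y - 0 * sin y - 1 = (expR x - 1) + expR x * (cos y - 1) by ring.
have -> : expR x * sin y + 0 * cos y - 0 = expR x * sin y by ring.
have b1 : `|expR x * (cos y - 1)| <= expR (cabs u) * cabs u.
  by rewrite normrM gtr0_norm// ler_pM// ltW.
have b2 : `|expR x * sin y| <= expR (cabs u) * cabs u.
  by rewrite normrM gtr0_norm// ler_pM// ltW.
have := ler_normD (expR x - 1) (expR x * (cos y - 1)); nra.
Qed.

Lemma norm_ln_le (k x : R) : 0 < k -> k <= 1 -> k <= x -> `|ln x| <= k^-1 * `|x - 1|.
Proof.
move=> k0 k1 kx; have x0 : 0 < x by lra.
have k1' : 1 <= k^-1 by rewrite invf_ge1.
have kx' : x^-1 <= k^-1 by rewrite lef_pV2 ?posrE.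
have xx : x * x^-1 = 1 by rewrite mulfV// gt_eqF.
have h1 : ln x <= x - 1.
  have := @le_ln1Dx R (x - 1); have -> : 1 + (x - 1) = x by ring.
  by apply; lra.
have x0' : 0 < x^-1 by rewrite invr_gt0.
have h2 : - ln x <= x^-1 - 1.
  have := @le_ln1Dx R (x^-1 - 1); have -> : 1 + (x^-1 - 1) = x^-1 by ring.
  by rewrite lnV ?posrE//; apply; lra.
rewrite ler_norml; have [x1|x1] := leP 1 x.
  rewrite ger0_norm ?subr_ge0//; nra.
rewrite ltr0_norm ?subr_lt0//; nra.
Qed.

(** The map [v -> Pf v s] is Lipschitz at 1, uniformly on compact annuli and for
bounded [s]; since [Pf] is multiplicative this one estimate controls every
perturbation of a term. *)
Lemma Pf_lipschitz (k b : R) : 0 < k -> k <= 1 -> 0 <= b ->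
  exists2 K : R, 0 <= K & forall v s, k <= cabs v <= k^-1 -> cabs s <= b ->
    cabs (Pf v s - 1) <= K * cabs (v - 1).
Proof.
move=> k0 k1 b0; pose E0 := expR (2 * b * (k^-1 * k^-1)).
exists (E0 * (1 + 6 * b * k^-1)).
  by rewrite mulr_ge0 ?expR_ge0// addr_ge0// !mulr_ge0// invr_ge0 ltW.
move=> v s /andP[kv vk] sb.
have k1' : 1 <= k^-1 by rewrite invf_ge1.
have k0' : 0 <= k^-1 by lra.
have v0 : v != 0 by rewrite -cabs_gt0; apply: lt_le_trans kv.
have x1 : `|cabs v - 1| <= cabs (v - 1).
  rewrite ler_norml; have := ge_cabsB v 1; have := ge_cabsB 1 v.
  rewrite cabs1 (cabsBC 1); lra.
have x2 : `|cabs v - 1| <= k^-1 by rewrite ler_norml; lra.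
have L := norm_ln_le k0 k1 kv.
set w := - (2 * s) * (ln (cabs v))%:C%C.
have wE : cabs w = 2 * cabs s * `|ln (cabs v)|.
  by rewrite /w cabsM cabsN cabsM cabs_nat cabs_real.
have w1 : cabs w <= 2 * b * (k^-1 * `|cabs v - 1|).
  by rewrite wE ler_pM ?mulr_ge0 ?cabs_ge0// ler_pM2l.
have w2 : cabs w <= 2 * b * (k^-1 * k^-1).
  by apply: le_trans w1 _; rewrite ler_wpM2l ?mulr_ge0// ler_wpM2l.
have e1 : cabs (cexp w) <= E0.
  rewrite cabs_cexp ler_expR; apply: le_trans (ler_norm _) _.
  exact: le_trans (normRe_le _) w2.
have e2 : cabs (cexp w - 1) <= 3 * (2 * b * (k^-1 * cabs (v - 1))) * E0.
  apply: le_trans (cexp_sub1_le w) _; apply: ler_pM; rewrite ?mulr_ge0 ?expR_ge0 ?cabs_ge0//.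
    rewrite ler_pM2l//; apply: le_trans w1 _.
    by rewrite ler_wpM2l ?mulr_ge0// ler_wpM2l.
  by rewrite ler_expR.
have -> : Pf v s - 1 = (v^* - 1) * cexp w + (cexp w - 1) by rewrite /Pf -/w; ring.
have -> : v^* - 1 = (v - 1)^* by rewrite rmorphB rmorph1.
apply: le_trans (cabsD _ _) _; rewrite cabsM cabs_conj.
have : cabs (v - 1) * cabs (cexp w) <= cabs (v - 1) * E0 by rewrite ler_wpM2l ?cabs_ge0.
lra.
Qed.

End PowerFactor.

Section Weight.
Variable R : realType.
Implicit Types x y : R.

(** A summable weight dominating the terms when [7/8 <= Re s]. *)
Definition W x : R := (Num.sqrt (1 + `|x|)) ^- 3.

Lemma W_arg_gt0 x : 0 < 1 + `|x|.
Proof. by rewrite ltr_wpDr. Qed.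

Lemma W_gt0 x : 0 < W x.
Proof. by rewrite /W invr_gt0 exprn_gt0// sqrtr_gt0 W_arg_gt0. Qed.

Lemma W_le x y : `|x| <= `|y| -> W y <= W x.
Proof.
move=> xy; rewrite /W lef_pV2 ?posrE ?exprn_gt0 ?sqrtr_gt0 ?W_arg_gt0//.
by rewrite lerXn2r ?nnegrE ?sqrtr_ge0// ler_sqrt ?lerD2l// ltW ?W_arg_gt0.
Qed.

Lemma W_le1 x : W x <= 1.
Proof.
apply: le_trans (@W_le 0 x _) _; first by rewrite normr0.
by rewrite /W normr0 addr0 sqrtr1 expr1n invr1.
Qed.

Lemma W_slow x y : 1 + `|x| <= 4 * (1 + `|y|) -> W y <= 8 * W x.
Proof.
move=> xy; rewrite /W.
have sx := W_arg_gt0 x; have sy := W_arg_gt0 y.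
have : Num.sqrt (1 + `|x|) <= 2 * Num.sqrt (1 + `|y|).
  rewrite -(ler_pXn2r (ltn0Sn 1)) ?nnegrE ?mulr_ge0 ?sqrtr_ge0// exprMn.
  by rewrite (sqr_sqrtr (ltW sx)) (sqr_sqrtr (ltW sy)); lra.
rewrite -sqrtr_gt0 in sx; rewrite -sqrtr_gt0 in sy.
set a := Num.sqrt _ in sx *; set b := Num.sqrt _ in sy * => ab.
rewrite ler_pdivlMr ?exprn_gt0// mulrC ler_pdivrMr ?exprn_gt0//.
have -> : 8 * b ^+ 3 = (2 * b) ^+ 3 by ring.
by apply: lerXn2r; rewrite ?nnegrE ?mulr_ge0//; apply: ltW.
Qed.

Lemma W_powR x : W x = (1 + `|x|) `^ (- (3 / 2)).
Proof.
rewrite /W -powR12_sqrt ?ltW ?W_arg_gt0// -powR_invn ?powR_ge0// -powRrM.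
by congr (_ `^ _); field.
Qed.

(** Telescoping: [2 c / sqrt (1 + x)] decreases by at least the next weight when
[x] moves by [1 / c]. *)
Lemma W_telescope (c : nat) (n : nat) : (0 < c)%N ->
  W (n.+1%:R / c%:R) <= 2 * c%:R / Num.sqrt (1 + n%:R / c%:R) -
                        2 * c%:R / Num.sqrt (1 + n.+1%:R / c%:R).
Proof.
move=> c0; have c0' : (0 : R) < c%:R by rewrite ltr0n.
rewrite /W ger0_norm ?divr_ge0//.
have p0 : (0 : R) < 1 + n%:R / c%:R by rewrite ltr_wpDr// divr_ge0.
have q0 : (0 : R) < 1 + n.+1%:R / c%:R by rewrite ltr_wpDr// divr_ge0.
have pq : (1 + n.+1%:R / c%:R) - (1 + n%:R / c%:R) = c%:R^-1 :> R.
  by rewrite -natr1 mulrDl; field; rewrite gt_eqF.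
have p2 := sqr_sqrtr (ltW p0); have q2 := sqr_sqrtr (ltW q0).
rewrite -sqrtr_gt0 in p0; rewrite -sqrtr_gt0 in q0; rewrite -p2 -q2 in pq.
move: p0 q0 pq; set p := Num.sqrt _; set q := Num.sqrt _ => p0 q0 pq.
have ic : 0 < c%:R^-1 :> R by rewrite invr_gt0.
have cc : c%:R * c%:R^-1 = 1 :> R by rewrite mulfV// gt_eqF.
have lepq : p <= q by nra.
have -> : 2 * c%:R / p - 2 * c%:R / q = 2 * c%:R * (q - p) / (p * q).
  by field; rewrite !gt_eqF.
have -> : 2 * c%:R * (q - p) = 2 / (q + p).
  have -> : 2 / (q + p) = 2 * (c%:R * (q ^+ 2 - p ^+ 2)) / (q + p) by rewrite pq cc mulr1.
  by field; lra.
rewrite -[2 / _ / _]mulrA -invfM -[leLHS]mul1r -[q ^- 3]/((q ^+ 3)^-1).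
rewrite ler_pdivlMr; last by rewrite !mulr_gt0// addr_gt0.
rewrite mul1r mulrC ler_pdivrMr ?exprn_gt0//.
have : (q + p) * (p * q) <= (q + q) * (q * q).
  by apply: ler_pM; [lra|nra|lra|nra].
by rewrite !exprS expr0; lra.
Qed.

Lemma W_sum_nat (c : nat) : (0 < c)%N -> forall n,
  \sum_(0 <= k < n) W (k.+1%:R / c%:R) <= 2 * c%:R.
Proof.
move=> c0 n.
have c0' : (0 : R) < c%:R by rewrite ltr0n.
suff : \sum_(0 <= k < n) W (k.+1%:R / c%:R) <=
    2 * c%:R - 2 * c%:R / Num.sqrt (1 + n%:R / c%:R).
  have : 0 <= 2 * c%:R / Num.sqrt (1 + n%:R / c%:R) :> R.
    by rewrite !mulr_ge0 ?invr_ge0 ?sqrtr_ge0// ltW.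
  lra.
elim: n => [|n IH].
  by rewrite big_nil mul0r addr0 sqrtr1 invr1 mulr1 subrr.
rewrite big_nat_recr//=; have := W_telescope n c0; lra.
Qed.

Lemma W_sum_int (c : nat) : (0 < c)%N ->
  sum_le (fun d : int => W (d%:~R / c%:R)) (5 * c%:R).
Proof.
move=> c0; have c1 : (1 : R) <= c%:R by rewrite ler1n.
have E : 5 * c%:R = (1 * c%:R + 2 * c%:R) + 2 * c%:R :> R by ring.
rewrite E; apply: sum_le_int => [i||].
- exact/ltW/W_gt0.
- apply: sum_le_nat => [i|[|n]]; first exact/ltW/W_gt0.
    by rewrite big_nil -mulrDl mulr_ge0// ltW//; lra.
  rewrite big_nat_recl//=; apply: lerD; last exact: W_sum_nat.
  by rewrite mul1r; apply: le_trans (W_le1 _) c1.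
- apply: sum_le_nat => [i|n]; first exact/ltW/W_gt0.
  rewrite (eq_bigr (fun k => W (k.+1%:R / c%:R))); first exact: W_sum_nat.
  move=> k _; rewrite /W; congr (Num.sqrt (1 + _) ^- 3).
  by rewrite rmorphN mulNr normrN.
Qed.

End Weight.

(** * Profiles and their Riemann sums *)

Section Profiles.
Variable R : realType.
Local Notation C := R[i].
Implicit Types (x y : R) (w s : C).

(** A function on the line of size [W], and Lipschitz on unit scale with the
same weight. *)
Definition profile (K : R) (f : R -> C) : Prop :=
  (forall x, cabs (f x) <= K * W x) /\
  (forall x y, `|x - y| <= 1 -> cabs (f x - f y) <= K * `|x - y| * W y).

Lemma ord_sum_le m : sum_le ((fun=> 1) : 'I_m -> R) m%:R.
Proof.
move=> B; rewrite (_ : \sum_(i <- B) 1 = (size B)%:R); last first.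
  by rewrite -sum1_size natr_sum.
rewrite ler_nat -[leqRHS]size_enum_ord.
by apply: uniq_leq_size (fset_uniq B) _ => i _; rewrite mem_enum.
Qed.

Lemma ord_tsum m : tsum ((fun=> 1) : 'I_m -> C) = m%:R.
Proof.
apply: has_sum_tsum => e e0; exists [fset i in enum 'I_m]%fset => B AB.
rewrite (_ : \sum_(i <- B) 1 = m%:R) ?subrr ?cabs0 ?ltW//.
rewrite (perm_big (enum 'I_m)) /=; first by rewrite big_enum sumr_const card_ord.
apply: uniq_perm; rewrite ?fset_uniq ?enum_uniq// => i.
by rewrite mem_enum; apply: (fsubsetP AB); rewrite !inE /= mem_enum.
Qed.

Section Riemann.
Variables (K : R) (f : R -> C).
Hypothesis fK : profile K f.

Lemma profile_ge0 : 0 <= K.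
Proof.
have [h _] := fK; have := le_trans (cabs_ge0 _) (h 0).
by rewrite pmulr_lge0// W_gt0.
Qed.

Lemma profile_sum (c : nat) : (0 < c)%N ->
  sum_le (fun d : int => cabs (f (d%:~R / c%:R))) (5 * K * c%:R).
Proof.
move=> c0; have [h _] := fK.
have := sum_leZ profile_ge0 (W_sum_int R c0); rewrite mulrCA mulrA.
by apply: sum_le_le => d; apply: h.
Qed.

Lemma profile_summable (c : nat) : (0 < c)%N ->
  abs_summable (fun d : int => f (d%:~R / c%:R)).
Proof. by move=> c0; exists (5 * K * c%:R); apply: profile_sum. Qed.

Lemma profile_variation (c : nat) : (0 < c)%N ->
  sum_le (fun d : int => cabs (f ((d + 1)%:~R / c%:R) - f (d%:~R / c%:R))) (5 * K).
Proof.
move=> c0; have [_ h] := fK.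
have c1 : (1 : R) <= c%:R by rewrite ler1n.
have c0' : (0 : R) < c%:R by rewrite ltr0n.
have := sum_leZ (divr_ge0 profile_ge0 (ltW c0')) (W_sum_int R c0).
have -> : K / c%:R * (5 * c%:R) = 5 * K by field; rewrite gt_eqF.
apply: sum_le_le => d.
have E : (d + 1)%:~R / c%:R - d%:~R / c%:R = c%:R^-1 :> R.
  by rewrite intrD mulrDl addrAC subrr add0r mul1r.
have -> : K / c%:R = K * `|(d + 1)%:~R / c%:R - d%:~R / c%:R|.
  by rewrite E ger0_norm// invr_ge0 ltW.
apply: h; rewrite E ger0_norm ?invr_ge0 ?invf_le1//; exact: ltW.
Qed.

Definition riemann (c : nat) : C :=
  c%:R^-1 * tsum (fun d : int => f (d%:~R / c%:R)).

Lemma cabs_riemann (c : nat) : (0 < c)%N -> cabs (riemann c) <= 5 * K.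
Proof.
move=> c0; rewrite /riemann cabsM cabsV cabs_nat.
have c0' : (0 : R) < c%:R by rewrite ltr0n.
rewrite mulrC ler_pdivrMr//; exact/tsum_le/profile_sum.
Qed.

(** Refining the mesh from [1 / c] to [1 / (c m)] moves each sample point by less
than [1 / c]. *)
Lemma riemann_refine (c m : nat) : (0 < c)%N -> (0 < m)%N ->
  cabs (riemann c - riemann (c * m)) <= 5 * K / c%:R.
Proof.
move=> c0 m0; have [h1 h2] := fK.
have c1 : (1 : R) <= c%:R by rewrite ler1n.
have c0' : (0 : R) < c%:R by rewrite ltr0n.
have m0' : (0 : R) < m%:R by rewrite ltr0n.
have cm0 : (0 < c * m)%N by rewrite muln_gt0 c0.
pose h (p : int * 'I_m) : int := p.1 * m%:Z + (p.2 : nat)%:Z.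
have hinj : injective h.
  move=> [d i] [d' i']; rewrite /h /= => E.
  have lti := ltn_ord i; have lti' := ltn_ord i'.
  have dd : d = d' by nia.
  rewrite dd in E *; congr (_, _); apply: val_inj => /=; lia.
have hsurj n : exists p, n = h p.
  have mm : (`|(n %% m)%Z|%N < m)%N by lia.
  exists ((n %/ m)%Z, Ordinal mm); rewrite /h /=; lia.
pose u (p : int * 'I_m) : C := f ((p.1)%:~R / c%:R) * 1.
pose v (p : int * 'I_m) : C := f ((h p)%:~R / (c * m)%:R).
have sm := @ord_sum_le m; have t1 := @ord_tsum m.
have s1 : abs_summable ((fun=> 1) : 'I_m -> C).
  by exists m%:R; apply: sum_le_le sm => i; rewrite cabs1.
have sf := profile_summable c0.
have su : abs_summable u := abs_summable_prod sf s1.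
have sfcm := profile_summable cm0.
have sv : abs_summable v.
  have [M hM] := sfcm; exists M.
  apply: (sum_le_inj (h := h) _ _ (fun=> cabs_ge0 _) hM) => [p q _ _|p] //.
  exact: hinj.
have tu : tsum u = m%:R * tsum (fun d : int => f (d%:~R / c%:R)).
  by have := tsum_prod sf s1; rewrite t1 mulrC.
have tv : tsum v = tsum (fun d : int => f (d%:~R / (c * m)%:R)).
  by rewrite (tsum_reindex hinj _ sfcm)// => n _; apply: hsurj.
have -> : riemann c - riemann (c * m) = (c * m)%:R^-1 * (tsum u - tsum v).
  rewrite tu tv /riemann mulrBr; congr (_ - _).
  by rewrite natrM mulrA; congr (_ * _); field; rewrite !pnatr_eq0; lia.
rewrite -tsumB// cabsM cabsV cabs_nat mulrC ler_pdivrMr ?ltr0n//.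
have -> : 5 * K / c%:R * (c * m)%:R = (K / c%:R) * (5 * c%:R * m%:R).
  by rewrite natrM; field; rewrite gt_eqF.
apply: tsum_le.
have := sum_leZ (divr_ge0 profile_ge0 (ltW c0'))
  (sum_le_prod (fun d : int => ltW (W_gt0 _)) (fun=> ler01) (W_sum_int R c0) sm).
apply: sum_le_le => [[d i]]; rewrite /u /v /= !mulr1.
have E : d%:~R / c%:R - (h (d, i))%:~R / (c * m)%:R = - (i%:R / (c * m)%:R) :> R.
  rewrite /h /= intrD intrM natrM; field; by rewrite !gt_eqF.
have E2 : `|(h (d, i))%:~R / (c * m)%:R - d%:~R / c%:R| <= c%:R^-1 :> R.
  rewrite distrC E normrN ger0_norm ?divr_ge0// natrM ler_pdivrMr ?mulr_gt0//.
  by rewrite mulKf ?gt_eqF// ler_nat ltnW.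
rewrite cabsBC; apply: le_trans (h2 _ _ _) _.
  by apply: le_trans E2 _; rewrite invf_le1.
rewrite ler_pM2r ?W_gt0// ler_wpM2l ?profile_ge0//.
Qed.

Lemma riemann_limit : exists l, forall c, (0 < c)%N ->
  cabs (riemann c - l) <= 10 * K / c%:R.
Proof.
have [|l hl] := @cauchy_limit R (fun n => riemann n.+1) (5 * K).
  move=> m n.
  have -> : riemann m.+1 - riemann n.+1 = (riemann m.+1 - riemann (m.+1 * n.+1)) -
    (riemann n.+1 - riemann (n.+1 * m.+1)) by rewrite mulnC; ring.
  by apply: le_trans (cabsB _ _) _; apply: lerD; apply: riemann_refine.
exists l => -[//|c] _; apply: le_trans (hl c) _.
by rewrite mulrA -natrM.
Qed.

End Riemann.
End Profiles.

(** * Divisors and additive characters *)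

Section DivisorFunction.

Definition tau (n : nat) : nat := size (divisors n).

Lemma card_lt_inj (T : finType) (S : {pred T}) (f : T -> nat) n :
  {in S &, injective f} -> (forall z : T, z \in S -> (f z < n)%N) -> (#|S| <= n)%N.
Proof.
move=> fi fn; rewrite cardE -(size_map f) -[leqRHS](size_iota 0).
apply: uniq_leq_size.
  by rewrite map_inj_in_uniq ?enum_uniq// => z w; rewrite !mem_enum; apply: fi.
by move=> m /seq.mapP[z]; rewrite mem_enum => /fn h ->; rewrite mem_iota.
Qed.

Lemma tau_gt0 n : (0 < n)%N -> (0 < tau n)%N.
Proof.
by move=> n0; rewrite /tau lt0n size_eq0; apply/eqP => E; have := divisors_id n0; rewrite E.
Qed.

Lemma leq_totient_primeM p d : prime p -> (0 < d)%N ->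
  (totient d <= totient (p * d))%N.
Proof.
move=> pp d0; have [m pm ->] := pfactor_coprime pp d0.
set k := logn p d.
have cop j : coprime m (p ^ j) by rewrite coprime_sym coprimeXl.
rewrite mulnCA -expnS !totient_coprime// leq_mul2l; apply/orP; right.
case: k => [|k]; first by rewrite totient_gt0 expn_gt0 prime_gt0.
by rewrite !totient_pfactor//= leq_mul2l leq_exp2l ?prime_gt1// leqnSn orbT.
Qed.

Lemma leq_totientM m d : (0 < m)%N -> (0 < d)%N -> (totient d <= totient (m * d))%N.
Proof.
elim/ltn_ind: m d => m IH d m0 d0.
have [m1|m1] := leqP m 1.
  have -> : m = 1%N by apply/eqP; rewrite eqn_leq m1 m0.
  by rewrite mul1n.
have pp := pdiv_prime m1; set p := pdiv m in pp.
have pm : (p %| m)%N by apply: pdiv_dvd.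
have q0 : (0 < m %/ p)%N by rewrite divn_gt0 ?prime_gt0// dvdn_leq.
apply: leq_trans (IH (m %/ p)%N _ d q0 d0) _; first by rewrite ltn_Pdiv ?prime_gt1.
have -> : (m * d = p * (m %/ p * d))%N by rewrite mulnA mulnC [(p * _)%N]mulnC divnK// mulnC.
by apply: leq_totient_primeM; rewrite ?muln_gt0 ?q0.
Qed.

Lemma leq_totient_tau n : (0 < n)%N -> (n <= totient n * tau n)%N.
Proof.
move=> n0; rewrite -{1}(cyclic.sum_totient_dvd n).
rewrite (eq_bigl (fun d : 'I_n.+1 => (d : nat) \in divisors n)); last first.
  by move=> d; rewrite -dvdn_divisors.
apply: (@leq_trans (\sum_(d < n.+1 | (d : nat) \in divisors n) totient n)%N).
  apply: leq_sum => d; rewrite -dvdn_divisors// => /dvdnP[m E].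
  have : (0 < m)%N && (0 < d)%N by rewrite -muln_gt0 -E.
  by move=> /andP[m0 d0]; rewrite {2}E leq_totientM.
rewrite sum_nat_const mulnC leq_mul2l; apply/orP; right.
apply: (@card_lt_inj _ _ (fun d : 'I_n.+1 => index (d : nat) (divisors n))).
  move=> d e hd he E; apply: val_inj => /=.
  by rewrite -(nth_index 0%N hd) -(nth_index 0%N he) E.
by move=> d hd; rewrite index_mem.
Qed.

End DivisorFunction.

Section FiniteKloosterman.
Variable R : realType.
Local Notation C := R[i].
Variable p : nat.
Local Notation c := (p.+2).
Local Notation A := ('I_p.+2).
Implicit Types (x y h k a d u l : A).

Definition addchar x : C := unit_root R c ^+ (x : nat).

Lemma addchar_mod n : unit_root R c ^+ (n %% c) = unit_root R c ^+ n.
Proof.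
rewrite {2}(divn_eq n c) exprD mulnC exprM.
by rewrite unit_root_n// expr1n mul1r.
Qed.

Lemma addcharD x y : addchar (x + y) = addchar x * addchar y.
Proof. by rewrite /addchar /= addchar_mod exprD. Qed.

Lemma addcharM x y : addchar (x * y) = addchar y ^+ x.
Proof. by rewrite /addchar /= addchar_mod mulnC exprM. Qed.

Lemma addchar0 : addchar 0 = 1.
Proof. by []. Qed.

Lemma cabs_addchar x : cabs (addchar x) = 1.
Proof. by rewrite /addchar cabsX cabs_unit_root expr1n. Qed.

Lemma addchar_neq0 x : addchar x != 0.
Proof. by rewrite -cabs_eq0 cabs_addchar oner_eq0. Qed.

Lemma addcharN x : addchar (- x) = (addchar x)^-1.
Proof.
by apply: (mulIf (addchar_neq0 x)); rewrite -addcharD addNr addchar0 mulVf ?addchar_neq0.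
Qed.

Lemma conj_addchar x : (addchar x)^* = addchar (- x).
Proof. by rewrite addcharN invC_norm cabsE cabs_addchar expr1n invr1 mul1r. Qed.

Lemma addchar_orthogonal x : \sum_h addchar (h * x) = if x == 0 then c%:R else 0.
Proof.
case: eqP => [->|/eqP x0].
  rewrite (eq_bigr (fun=> 1)); last by move=> h _; rewrite mulr0.
  by rewrite sumr_const card_ord.
under eq_bigr do rewrite addcharM.
rewrite geometric_sum0//.
  by rewrite /addchar -exprM mulnC exprM unit_root_n// expr1n.
apply: unit_root_neq1; rewrite ltn_ord andbT lt0n.
by apply: contra x0 => /eqP E; apply/eqP/val_inj.
Qed.

(** Expanding the square and summing over each frequency leaves the coincidences
of the two arguments. *)
Lemma addchar_parseval (P : finType) (Q : pred P) (U V : P -> A) :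
  \sum_h \sum_k cabs (\sum_(q | Q q) addchar (h * U q + k * V q)) ^+ 2 =
  (c ^ 2)%:R * (\sum_(q | Q q) \sum_(r | Q r) ((U q == U r) && (V q == V r)))%:R :> R.
Proof.
apply: (@complexI R); rewrite rmorphM /= !rmorph_nat rmorph_sum /=.
under eq_bigr => h _ do rewrite rmorph_sum /=.
have E h k : ((cabs (\sum_(q | Q q) addchar (h * U q + k * V q)) ^+ 2)%:C%C : C) =
   \sum_(q | Q q) \sum_(r | Q r) addchar (h * (U q - U r)) * addchar (k * (V q - V r)).
  rewrite rmorphXn /= -cabsE normCK rmorph_sum mulr_suml; apply: eq_bigr => q _.
  rewrite mulr_sumr; apply: eq_bigr => r _.
  rewrite /= conj_addchar -!addcharD; congr addchar; ring.
under eq_bigr => h _ do under eq_bigr => k _ do rewrite E.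
under eq_bigr => h _ do rewrite exchange_big /=.
rewrite exchange_big /= natr_sum mulr_sumr; apply: eq_bigr => q _.
under eq_bigr => h _ do rewrite exchange_big /=.
rewrite exchange_big /= natr_sum mulr_sumr; apply: eq_bigr => r _.
under eq_bigr => h _ do rewrite -mulr_sumr addchar_orthogonal.
rewrite -mulr_suml addchar_orthogonal !subr_eq0.
by case: (U q == U r); case: (V q == V r); rewrite /= ?mulr0 ?mul0r ?mulr1 ?natrX// expr2.
Qed.

(** * Counting in the ring of integers modulo [c] *)



Lemma card_halves y : (#|[pred x : A | (x + x)%R == y]| <= 2)%N.
Proof.
apply: (@card_lt_inj _ _ (fun x : A => (c <= x + x)%N : nat)); last first.
  by move=> x _; case: (c <= x + x)%N.
move=> x x'; rewrite !inE => /eqP <- /eqP E0.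
have /= E := congr1 (fun z : A => z : nat) E0.
have := ltn_ord x; have := ltn_ord x' => l1 l2 E2.
apply: val_inj => /=; move: E E2.
case: (leqP c (x + x)) => h; case: (leqP c (x' + x')) => h' //=.
  have mE (z : A) : (c <= z + z)%N -> ((z + z) %% c = z + z - c)%N.
    move=> hz; rewrite -{1}(subnK hz) modnDr modn_small//.
    have := ltn_ord z; lia.
  by rewrite !mE//; lia.
by rewrite !modn_small//; lia.
Qed.

Lemma card_annihilator t : (#|[pred u : A | (t * u)%R == 0%R]| <= gcdn t c)%N.
Proof.
have g0 : (0 < gcdn t c)%N by rewrite gcdn_gt0 orbT.
pose m := (c %/ gcdn t c)%N.
have cE : (m * gcdn t c = c)%N by rewrite divnK// dvdn_gcdr.
have m0 : (0 < m)%N by rewrite -(ltn_pmul2r g0) mul0n cE.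
have ann (u : A) : (t * u)%R = 0%R -> (m %| u)%N.
  move=> E; have /= /eqP := congr1 (fun z : A => z : nat) E.
  rewrite -/(dvdn _ _) => h.
  have : (m * gcdn t c %| (t %/ gcdn t c * u) * gcdn t c)%N.
    by rewrite cE mulnAC divnK ?dvdn_gcdl.
  rewrite dvdn_pmul2r// Gauss_dvdr// /m coprime_sym.
  by rewrite /coprime -(eqn_pmul2r g0) mul1n muln_gcdl !divnK ?dvdn_gcdl ?dvdn_gcdr.
apply: (@card_lt_inj _ _ (fun u : A => (u %/ m)%N)).
  move=> u u'; rewrite !inE => /eqP /ann h /eqP /ann h' E.
  by apply: val_inj; rewrite /= -(divnK h) E divnK.
by move=> u _; rewrite ltn_divLR// mulnC cE ltn_ord.
Qed.

Lemma gcdn_mul_le a d : (gcdn (a * d : A)%R c <= gcdn a c * gcdn d c)%N.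
Proof.
rewrite /= gcdn_modl; apply: dvdn_leq; first by rewrite muln_gt0 !gcdn_gt0 !orbT.
rewrite muln_gcdl !muln_gcdr !dvdn_gcd dvdn_gcdl /=.
by rewrite dvdn_mull ?dvdn_gcdr//= !dvdn_mulr ?dvdn_gcdr.
Qed.

Lemma sum_gcdn_le : (\sum_(a : A) gcdn a c <= c * tau c)%N.
Proof.
have c0 : (0 < c)%N by [].
apply: (@leq_trans (\sum_(a : A) \sum_(d <- divisors c) d * (d %| a)))%N.
  apply: leq_sum => a _; rewrite (bigD1_seq (gcdn a c)) ?divisors_uniq//=.
    by rewrite dvdn_gcdl muln1 leq_addr.
  by rewrite -dvdn_divisors// dvdn_gcdr.
rewrite exchange_big /= /tau -sum1_size big_distrr /= big_seq [leqRHS]big_seq.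
apply: leq_sum => d; rewrite -dvdn_divisors// => dc; rewrite muln1 -big_distrr /=.
have d0 : (0 < d)%N by apply: dvdn_gt0 dc.
suff h : (\sum_(i : A) (d %| i) <= c %/ d)%N.
  by apply: leq_trans (leq_mul (leqnn d) h) _; rewrite mulnC divnK.
rewrite (eq_bigr (fun i : A => if (d %| i)%N then 1%N else 0%N)); last first.
  by move=> i _; case: (d %| i)%N.
rewrite -big_mkcond sum1_card.
apply: (@card_lt_inj _ _ (fun u : A => (u %/ d)%N)).
  move=> u u' h h' E; rewrite -!topredE /= in h h'.
  by apply: val_inj; rewrite /= -(divnK h) E divnK.
by move=> u _; rewrite ltn_divLR// divnK// ltn_ord.
Qed.

(** * Kloosterman sums: the fourth moment and the orbit of a pair of frequencies *)

Definition kloosterman h k : C :=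
  \sum_(x : A | x \is a GRing.unit) addchar (h * x + k * x^-1).

Lemma kloosterman_sym h k : kloosterman h k = kloosterman k h.
Proof.
rewrite /kloosterman (reindex_inj (can_inj (@invrK A))) /=.
apply: eq_big => [x|x _]; first by rewrite unitrV.
by rewrite invrK addrC.
Qed.

Lemma kloosterman_orbit h k l : l \is a GRing.unit ->
  kloosterman (h * l) (k * l^-1) = kloosterman h k.
Proof.
move=> lu; rewrite [RHS](reindex_inj (mulrI lu)) /=.
apply: eq_big => [x|x xu]; first by rewrite unitrMr.
by rewrite invrM// -!mulrA (mulrC l^-1).
Qed.

(** Solutions of [x1 + x2 = x3 + x4], [1/x1 + 1/x2 = 1/x3 + 1/x4] satisfy
[(x3 - x1) (x3 - x2) (x1 + x2) = 0], and these three factors determine [2 x3]. *)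
Lemma card_kloosterman_quadruples :
  (\sum_(q : A * A | (q.1 \is a GRing.unit) && (q.2 \is a GRing.unit))
    \sum_(r : A * A | (r.1 \is a GRing.unit) && (r.2 \is a GRing.unit))
     (((q.1 + q.2)%R == (r.1 + r.2)%R) &&
      ((q.1^-1 + q.2^-1)%R == (r.1^-1 + r.2^-1)%R))
   <= 2 * (c * tau c) ^ 2)%N.
Proof.
pose T (t : A * A * A) := (t.1.1 * t.1.2 * t.2)%R == 0%R.
pose S (z : A * A * A * A) := T z.1 && ((z.2 + z.2)%R == (z.1.1.1 + z.1.1.2 + z.1.2)%R).
apply: (@leq_trans #|S|).
  rewrite pair_big_dep /= -big_mkcondr sum1_card.
  pose f (z : (A * A) * (A * A)) : A * A * A * A :=
    ((z.2.1 - z.1.1, z.2.1 - z.1.2, z.1.1 + z.1.2), z.2.1)%R.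
  rewrite -(card_in_image (f := f)); last first.
    move=> [[x1 x2] [x3 x4]] [[y1 y2] [y3 y4]].
    rewrite -!topredE /= /f /= => /andP[_ /andP[/eqP E1 _]] /andP[_ /andP[/eqP E2 _]].
    move=> E; have h4 : x3 = y3 := congr1 snd E.
    have h1 : (x3 - x1 = y3 - y1)%R := congr1 (fun z => z.1.1.1) E.
    have h2 : (x3 - x2 = y3 - y2)%R := congr1 (fun z => z.1.1.2) E.
    rewrite h4 in h1 h2 *.
    have {}h1 := oppr_inj (addrI _ h1); have {}h2 := oppr_inj (addrI _ h2).
    rewrite h1 h2 h4 in E1 *; congr (_, (_, _)).
    by apply: (@addrI _ y3); rewrite -E2 -E1.
  apply: subset_leq_card; apply/fintype.subsetP => z /fintype.imageP[[[x1 x2] [x3 x4]]].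
  rewrite -!topredE /= => /andP[/andP[/andP[u1 u2] /andP[u3 u4]] /andP[/eqP E1 /eqP E2]] ->.
  rewrite /S /T /f /=; apply/andP; split; apply/eqP; last by ring.
  have h1 : (x1 + x2 = x1 * x2 * (x1^-1 + x2^-1))%R.
    by rewrite mulrDr (mulrK u2) mulrAC (mulrV u1) mul1r addrC.
  have h2 : (x3 + x4 = x3 * x4 * (x3^-1 + x4^-1))%R.
    by rewrite mulrDr (mulrK u4) mulrAC (mulrV u3) mul1r addrC.
  (* both products of the pairs agree after multiplication by the common sum *)
  have h3 : ((x1 + x2) * (x3 * x4) = (x1 + x2) * (x1 * x2))%R.
    transitivity ((x1 * x2 * (x1^-1 + x2^-1)) * (x3 * x4))%R; first by rewrite -h1.
    by rewrite E1 h2 E2; ring.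
  have -> : ((x3 - x1) * (x3 - x2) * (x1 + x2) =
     (x1 + x2) * (x1 * x2) - (x1 + x2) * (x3 * (x1 + x2 - x3)))%R by ring.
  by rewrite E1 addrAC subrr add0r -E1 h3 subrr.
apply: (@leq_trans (\sum_(t | T t) 2)%N).
  rewrite -sum1_card /S -(pair_big_dep (fun t => T t)
    (fun t (x : A) => (x + x)%R == (t.1.1 + t.1.2 + t.2)%R) (fun _ _ => 1%N)) /=.
  by apply: leq_sum => t _; rewrite sum1_card; apply: card_halves.
rewrite sum_nat_const mulnC leq_mul2l /=.
apply: (@leq_trans (\sum_(q : A * A) gcdn (q.1 * q.2)%R c)).
  rewrite -sum1_card /T -(pair_big_dep xpredT
    (fun q (u : A) => (q.1 * q.2 * u)%R == 0%R) (fun _ _ => 1%N)) /=.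
  by apply: leq_sum => q _; rewrite sum1_card; apply: card_annihilator.
apply: (@leq_trans (\sum_(q : A * A) gcdn q.1 c * gcdn q.2 c)).
  by apply: leq_sum => q _; apply: gcdn_mul_le.
rewrite -(pair_big xpredT xpredT (fun a d : A => gcdn a c * gcdn d c)%N) /=.
under eq_bigr do rewrite -big_distrr /=.
by rewrite -big_distrl /= expnS expn1; apply: leq_mul; apply: sum_gcdn_le.
Qed.

(** The square of a Kloosterman sum is a sum over pairs of units, with arguments
[x + y] and [1 / x + 1 / y], so Parseval turns the fourth moment into a count. *)
Lemma kloosterman_moment4 :
  \sum_h \sum_k cabs (kloosterman h k) ^+ 4 <=
  2 * c%:R ^+ 4 * (tau c)%:R ^+ 2 :> R.
Proof.
have E h k : cabs (kloosterman h k) ^+ 4 =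
   cabs (\sum_(q : A * A | (q.1 \is a GRing.unit) && (q.2 \is a GRing.unit))
      addchar (h * (q.1 + q.2) + k * (q.1^-1 + q.2^-1))) ^+ 2.
  rewrite (_ : 4 = 2 * 2)%N// exprM -cabsX; congr (cabs _ ^+ 2).
  rewrite expr2 /kloosterman mulr_suml.
  rewrite -(pair_big (fun x : A => x \is a GRing.unit) (fun y : A => y \is a GRing.unit)
    (fun x y => addchar (h * (x + y) + k * (x^-1 + y^-1)))) /=.
  apply: eq_bigr => x _; rewrite mulr_sumr; apply: eq_bigr => y _.
  by rewrite -addcharD; congr addchar; ring.
under eq_bigr => h _ do under eq_bigr => k _ do rewrite E.
rewrite addchar_parseval.
have -> : 2 * c%:R ^+ 4 * (tau c)%:R ^+ 2 = (c ^ 2)%:R * (2 * (c * tau c) ^ 2)%:R :> R.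
  by rewrite !(natrX, natrM); ring.
by rewrite ler_pM2l ?ltr0n ?expn_gt0// ler_nat card_kloosterman_quadruples.
Qed.

Definition nunits : nat := #|[pred x : A | x \is a GRing.unit]|.

Lemma nunitsE : nunits = totient c.
Proof.
rewrite totient_count_coprime /nunits big_mkord -sum1_card big_mkcond /=.
apply: eq_bigr => x _; rewrite -topredE /=.
by have := @unitZpE c x isT; rewrite natr_Zp => ->; case: coprime.
Qed.

(** Every pair of frequencies in the orbit of [(h, k)] gives the same sum, and each
is attained from at most [gcdn h c] units. *)
Lemma kloosterman_orbit_bound h k :
  nunits%:R * cabs (kloosterman h k) ^+ 4 <=
  (gcdn h c)%:R * (2 * c%:R ^+ 4 * (tau c)%:R ^+ 2) :> R.
Proof.
pose F h k := cabs (kloosterman h k) ^+ 4.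
have F0 h' k' : 0 <= F h' k' by rewrite exprn_ge0 ?cabs_ge0.
apply: (@le_trans _ _ (\sum_(l : A | l \is a GRing.unit) F (h * l) (k * l^-1))).
  rewrite (eq_bigr (fun=> F h k)); last by move=> l lu; rewrite /F kloosterman_orbit.
  by rewrite sumr_const mulr_natl.
apply: (@le_trans _ _ (\sum_h' \sum_k' (gcdn h c)%:R * F h' k')); last first.
  under eq_bigr do rewrite -mulr_sumr; rewrite -mulr_sumr ler_wpM2l//.
  exact: kloosterman_moment4.
rewrite (partition_big (fun l : A => h * l) xpredT) //=; apply: ler_sum => h' _.
rewrite -mulr_sumr.
apply: (@le_trans _ _ (\sum_(l : A | (l \is a GRing.unit) && (h * l == h')) \sum_k' F h' k')).
  apply: ler_sum => l /andP[_ /eqP ->].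
  by rewrite (bigD1 (k * l^-1)) //= lerDl sumr_ge0.
pose S := [pred l : A | (l \is a GRing.unit) && (h * l == h')].
rewrite (sumr_const S) -[leLHS]mulr_natl ler_wpM2r ?sumr_ge0// ler_nat.
have [l0 l0S|noS] := pickP S; last first.
  by rewrite (eq_card noS) card0.
apply: leq_trans (card_annihilator h).
rewrite -(card_in_image (f := fun l : A => l - l0)); last first.
  by move=> l l' _ _ /addIr.
apply: subset_leq_card; apply/fintype.subsetP => z /fintype.imageP[l lS ->].
move: l0S lS; rewrite -!topredE /= => /andP[_ /eqP E0] /andP[_ /eqP E1].
by rewrite mulrBr E0 E1 subrr.
Qed.

End FiniteKloosterman.

(** * Sums over pairs of inverse residues *)

Section CongruenceSums.
Variable R : realType.
Local Notation C := R[i].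
Variable p : nat.
Local Notation c := (p.+2).
Local Notation A := ('I_p.+2).
Implicit Types (h k : A) (G K : int -> C).

Definition fourier G h : C := tsum (fun d : int => G d * addchar R (- (h * d%:~R))).

Lemma fourier_summable G h : abs_summable G ->
  abs_summable (fun d : int => G d * addchar R (- (h * d%:~R))).
Proof. by apply: abs_summable_le => d; rewrite cabsM cabs_addchar mulr1. Qed.

Lemma fourier0 G : fourier G 0 = tsum G.
Proof.
by apply: eq_tsum => d; rewrite mul0r oppr0 addchar0 mulr1.
Qed.

(** Summation by parts: a nonzero frequency is controlled by the total variation. *)
Lemma fourier_bound G h (V : R) : abs_summable G -> h != 0 ->
  sum_le (fun d : int => cabs (G (d + 1) - G d)) V ->
  cabs (fourier G h) <= c%:R * V * ((minn h (c - h))%:R)^-1.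
Proof.
move=> sG h0 hV; have c0 : (0 : R) < c%:R by rewrite ltr0n.
have hpos : (0 < h)%N.
  by rewrite lt0n; apply: contra h0 => /eqP E; apply/eqP/val_inj.
have m0 : (0 : R) < (minn h (c - h))%:R.
  by rewrite ltr0n; have := ltn_ord h; lia.
pose T d := G d * addchar R (- (h * d%:~R)).
have sT : abs_summable T by apply: fourier_summable.
have sh : injective (fun d : int => d + 1) by apply: addIr.
have shift : fourier G h = tsum (fun d => T (d + 1)).
  by rewrite /fourier (tsum_reindex sh _ sT)// => d _; exists (d - 1); rewrite subrK.
have sT1 : abs_summable (fun d : int => T (d + 1)).
  have [M hM] := sT; exists M.
  by apply: (sum_le_inj (h := fun d : int => d + 1) _ _ (fun=> cabs_ge0 _) hM) => // d e _ _; apply: sh.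
have E : (addchar R h - 1) * fourier G h =
   tsum (fun d : int => (G (d + 1) - G d) * addchar R (- (h * d%:~R))).
  rewrite mulrBl mul1r {1}shift -tsumZ// -tsumB//; last exact: abs_summableZ.
  apply: eq_tsum => d; rewrite /T mulrBl mulrCA -addcharD; congr (_ * addchar R _ - _).
  by rewrite intrD mulrDr mulr1 opprD addrCA subrr addr0.
have : cabs ((addchar R h - 1) * fourier G h) <= V.
  by rewrite E; apply: tsum_le; apply: sum_le_le hV => d; rewrite cabsM cabs_addchar mulr1.
rewrite cabsM => hV2.
have := @unit_root_sub1_lower R c h (ltnW (ltn_ord h)) isT.
rewrite -/(addchar R h) => h1.
rewrite ler_pdivlMr// mulrC -ler_pdivrMl// mulrA.
apply: le_trans hV2; rewrite ler_wpM2r ?cabs_ge0//.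
by rewrite mulrC.
Qed.

(** Orthogonality in both frequencies isolates the unit [x] with [x = d] and
[x^-1 = a]. *)
Lemma kloosterman_indicator (a d : A) :
  \sum_h \sum_k kloosterman R h k * (addchar R (- (h * d)) * addchar R (- (k * a))) =
  if a * d == 1 then (c ^ 2)%:R else 0.
Proof.
rewrite (eq_bigr (fun h => \sum_(x : A | x \is a GRing.unit)
    \sum_k addchar R (h * (x - d)) * addchar R (k * (x^-1 - a)))); last first.
  move=> h _; rewrite exchange_big /=; apply: eq_bigr => k _.
  rewrite mulr_suml; apply: eq_bigr => x _.
  by rewrite -!addcharD; congr addchar; ring.
rewrite exchange_big /=.
rewrite (eq_bigr (fun x : A => if (x == d) && (x^-1 == a) then (c ^ 2)%:R else 0)); last first.
  move=> x xu; under eq_bigr do rewrite -mulr_sumr addchar_orthogonal.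
  rewrite -mulr_suml addchar_orthogonal !subr_eq0.
  by case: (x == d); case: (x^-1 == a); rewrite /= ?mulr0 ?mul0r// natrX expr2.
case: eqP => [ad|nad].
  have du : d \is a GRing.unit by apply/unitrP; exists a; rewrite ad mulrC ad.
  rewrite (bigD1 d)//= eqxx /= big1 ?addr0; last first.
    by move=> x /andP[_ /negbTE ->].
  by rewrite -[a]mulr1 -(divrr du) mulrA ad mul1r eqxx.
apply: big1 => x xu; case: eqP => //= xd; case: eqP => // xa.
by case: nad; rewrite -xd -xa mulVr.
Qed.

Lemma congruence_sum G K : abs_summable G -> abs_summable K ->
  tsum (fun q : int * int =>
    if (q.2%:~R * q.1%:~R : A) == 1 then G q.1 * K q.2 else 0) =
  (c ^ 2)%:R^-1 * \sum_h \sum_k kloosterman R h k * (fourier G h * fourier K k).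
Proof.
move=> sG sK.
have H : has_sum (fun q : int * int => \sum_(h : A) \sum_(k : A) kloosterman R h k *
     (G q.1 * addchar R (- (h * q.1%:~R)) * (K q.2 * addchar R (- (k * q.2%:~R)))))
   (\sum_h \sum_k kloosterman R h k * (fourier G h * fourier K k)).
  apply: (@has_sum_finsum R _ A (index_enum A)
    (fun h q => \sum_k kloosterman R h k *
     (G q.1 * addchar R (- (h * q.1%:~R)) * (K q.2 * addchar R (- (k * q.2%:~R)))))
    (fun h => \sum_k kloosterman R h k * (fourier G h * fourier K k))) => h.
  apply: (@has_sum_finsum R _ A (index_enum A)
    (fun k q => kloosterman R h k *
     (G q.1 * addchar R (- (h * q.1%:~R)) * (K q.2 * addchar R (- (k * q.2%:~R)))))
    (fun k => kloosterman R h k * (fourier G h * fourier K k))) => k.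
  apply: has_sumZ.
  have s1 := fourier_summable h sG; have s2 := fourier_summable k sK.
  have := summable_has_sum (abs_summable_prod s1 s2).
  by rewrite (tsum_prod s1 s2).
apply: has_sum_tsum; have := has_sumZ ((c ^ 2)%:R^-1) H; congr has_sum.
apply/funext => -[d a] /=.
have -> : \sum_(h : A) \sum_(k : A) kloosterman R h k *
    (G d * addchar R (- (h * d%:~R)) * (K a * addchar R (- (k * a%:~R)))) =
  G d * K a * \sum_(h : A) \sum_(k : A) kloosterman R h k *
    (addchar R (- (h * d%:~R)) * addchar R (- (k * a%:~R))).
  rewrite mulr_sumr; apply: eq_bigr => h _; rewrite mulr_sumr; apply: eq_bigr => k _.
  ring.
rewrite kloosterman_indicator; case: ifP => _; last by rewrite !mulr0.
by rewrite mulrC mulfK// pnatr_eq0.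
Qed.

(** The cost of pairing the bound [gcdn h c] for Kloosterman sums with the decay of
the Fourier coefficients in the distance of [h] to 0 modulo [c]. *)
Definition gcd_sum : R := \sum_(h : A | h != 0) (gcdn h c)%:R / (minn h (c - h))%:R.

(** Only the pair of zero frequencies survives as a main term. *)
Lemma congruence_sum_bound G K (B k : R) : abs_summable G -> abs_summable K ->
  sum_le (fun d : int => cabs (G (d + 1) - G d)) B ->
  sum_le (fun d : int => cabs (K (d + 1) - K d)) B ->
  cabs (tsum G) <= c%:R * B -> cabs (tsum K) <= c%:R * B ->
  (forall h h', h != 0 -> cabs (kloosterman R h h') <= k * (gcdn h c)%:R) ->
  cabs (tsum (fun q : int * int =>
      if (q.2%:~R * q.1%:~R : A) == 1 then G q.1 * K q.2 else 0) -
    (totient c)%:R / (c ^ 2)%:R * (tsum G * tsum K)) <=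
  B ^+ 2 * k * (gcd_sum ^+ 2 + 2 * gcd_sum).
Proof.
move=> sG sK vG vK tG tK hk.
have B0 : 0 <= B := sum_le_ge0 vG.
have c0 : (0 : R) < c%:R by rewrite ltr0n.
have cB : 0 <= c%:R * B by rewrite mulr_ge0// ltW.
have k0 : 0 <= k.
  have := hk 1 1 (oner_neq0 _); rewrite gcd1n mulr1; apply: le_trans; exact: cabs_ge0.
pose w h : R := ((minn h (c - h))%:R)^-1.
have w0 h : 0 <= w h by rewrite invr_ge0.
have fG h : h != 0 -> cabs (fourier G h) <= c%:R * B * w h.
  by move=> h0; apply: fourier_bound.
have fK h : h != 0 -> cabs (fourier K h) <= c%:R * B * w h.
  by move=> h0; apply: fourier_bound.
pose D := gcd_sum.
have Dw : \sum_(h : A | h != 0) w h <= D.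
  apply: ler_sum => h _; rewrite -[leLHS]mul1r ler_wpM2r//.
  by rewrite ler1n gcdn_gt0 orbT.
have K00 : kloosterman R (0 : A) 0 = (totient c)%:R.
  rewrite -nunitsE /nunits -sum1_card natr_sum; apply: eq_bigr => x _.
  by rewrite !mul0r addr0 addchar0.
rewrite congruence_sum// (bigD1 (0 : A))//= (bigD1 (0 : A))//= K00 !fourier0.
set S1 := \sum_(k | _) _; set S2 := \sum_(h | _) _.
have -> : (c ^ 2)%:R^-1 * ((totient c)%:R * (tsum G * tsum K) + S1 + S2) -
    (totient c)%:R / (c ^ 2)%:R * (tsum G * tsum K) = (c ^ 2)%:R^-1 * (S1 + S2) by ring.
have b1 : cabs S1 <= (c%:R * B) ^+ 2 * k * D.
  apply: le_trans (cabs_sum _ _ _) _; rewrite /D /gcd_sum mulr_sumr.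
  apply: ler_sum => h h0; rewrite kloosterman_sym !cabsM.
  apply: (@le_trans _ _ (k * (gcdn h c)%:R * (c%:R * B * (c%:R * B * w h)))).
    apply: ler_pM; rewrite ?mulr_ge0 ?cabs_ge0//; first exact: hk.
    by apply: ler_pM; rewrite ?cabs_ge0//; apply: fK.
  by rewrite le_eqVlt; apply/orP; left; apply/eqP; rewrite /w; ring.
have b2 : cabs S2 <= (c%:R * B) ^+ 2 * k * (D * (1 + D)).
  apply: le_trans (cabs_sum _ _ _) _.
  apply: (@le_trans _ _ (\sum_(h : A | h != 0) (c%:R * B) ^+ 2 * k * ((gcdn h c)%:R * w h) * (1 + D))).
    apply: ler_sum => h h0; rewrite (bigD1 (0 : A)) //= fourier0.
    apply: le_trans (cabsD _ _) _.
    rewrite mulrDr mulr1; apply: lerD.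
      rewrite !cabsM; apply: (@le_trans _ _ (k * (gcdn h c)%:R * (c%:R * B * w h * (c%:R * B)))).
        apply: ler_pM; rewrite ?mulr_ge0 ?cabs_ge0//; first exact: hk.
        by apply: ler_pM; rewrite ?cabs_ge0//; apply: fG.
      by rewrite le_eqVlt; apply/orP; left; apply/eqP; ring.
    apply: le_trans (cabs_sum _ _ _) _.
    apply: (@le_trans _ _ (\sum_(i : A | i != 0) (c%:R * B) ^+ 2 * k * ((gcdn h c)%:R * w h) * w i)).
      apply: ler_sum => i i0; rewrite !cabsM.
      apply: (@le_trans _ _ (k * (gcdn h c)%:R * (c%:R * B * w h * (c%:R * B * w i)))).
        apply: ler_pM; rewrite ?mulr_ge0 ?cabs_ge0//; first exact: hk.
        by apply: ler_pM; rewrite ?cabs_ge0//; [apply: fG|apply: fK].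
      by rewrite le_eqVlt; apply/orP; left; apply/eqP; ring.
    by rewrite -mulr_sumr ler_wpM2l// !mulr_ge0.
  by rewrite -mulr_suml -mulr_sumr mulrA.
rewrite cabsM cabsV cabs_nat mulrC ler_pdivrMr; last by rewrite ltr0n expn_gt0.
apply: le_trans (cabsD _ _) _; apply: le_trans (lerD b1 b2) _.
by rewrite le_eqVlt natrX; apply/orP; left; apply/eqP; rewrite /D; ring.
Qed.

End CongruenceSums.

(** * The divisor bound and the power saving *)

Section DivisorBound.

Lemma tau_pfactor_le p a m : prime p -> coprime p m -> (0 < m)%N ->
  (tau (p ^ a * m) <= a.+1 * tau m)%N.
Proof.
move=> pp pm m0.
have n0 : (0 < p ^ a * m)%N by rewrite muln_gt0 expn_gt0 prime_gt0.
have -> : (a.+1 * tau m)%N =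
    size [seq (p ^ i * d)%N | i <- iota 0 a.+1, d <- divisors m].
  by rewrite size_allpairs size_iota.
apply: uniq_leq_size; first exact: divisors_uniq.
move=> e; rewrite -dvdn_divisors// => eD.
have e0 : (0 < e)%N by apply: dvdn_gt0 eD.
have [d pd eE] := pfactor_coprime pp e0.
apply/allpairsP; exists (logn p e, d); split; last by rewrite /= mulnC.
- change (logn p e \in iota 0 a.+1).
  rewrite mem_iota leq0n add0n ltnS -(@dvdn_Pexp2l p) ?prime_gt1//.
  rewrite -(Gauss_dvdl _ (_ : coprime _ m)) ?coprimeXl//.
  by apply: dvdn_trans eD; rewrite {2}eE dvdn_mull.
- change (d \in divisors m); rewrite -dvdn_divisors// -(@Gauss_dvdr _ (p ^ a)); last by rewrite coprime_sym coprimeXl.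
  by apply: dvdn_trans eD; rewrite [X in (_ %| X)%N]eE dvdn_mulr.
Qed.

Lemma succ_pow_le k a : (0 < k)%N -> (a.+1 ^ k <= k ^ k * 2 ^ a)%N.
Proof.
move=> k0; apply: (@leq_trans ((k * 2 ^ (a %/ k)) ^ k)).
  rewrite leq_exp2r//; apply: (@leq_trans (k * (a %/ k).+1)).
    by rewrite mulnC ltn_ceil.
  by rewrite leq_mul2l ltn_expl ?orbT.
by rewrite expnMn leq_mul2l -expnM leq_exp2l ?orbT// leq_divM orbT.
Qed.

(** [tau n] is smaller than any positive power of [n]: a prime [p >= 2 ^ k]
contributes at most its own power to [tau n ^ k], and the finitely many smaller
primes contribute a bounded factor each. *)
Lemma tau_pow_bound k : (0 < k)%N ->
  exists2 M, (0 < M)%N & forall n, (0 < n)%N -> (tau n ^ k <= M * n)%N.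
Proof.
move=> k0; pose large q n := forall p, prime p -> (p %| n)%N -> (q <= p)%N.
have big n : (0 < n)%N -> large (2 ^ k)%N n -> (tau n ^ k <= n)%N.
  elim/ltn_ind: n => n IH n0 hn.
  have [n1|n1] := leqP n 1.
    have -> : n = 1%N by apply/eqP; rewrite eqn_leq n1.
    by rewrite /tau /= exp1n.
  have pp := pdiv_prime n1; have pn := pdiv_dvd n; set p := pdiv n in pp pn.
  have [m pm nE] := pfactor_coprime pp n0.
  have a0 : (0 < logn p n)%N by rewrite logn_gt0 mem_primes pp n0.
  have m0 : (0 < m)%N by move: n0; rewrite {1}nE muln_gt0 => /andP[].
  set a := logn p n in nE a0.
  have mn : (m < n)%N by rewrite nE ltn_Pmulr// -(exp1n a) ltn_exp2r ?prime_gt1.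
  have hm : (tau m ^ k <= m)%N.
    apply: IH => // q pq qm; apply: hn => //; rewrite nE dvdn_mulr//.
  rewrite nE mulnC; apply: (@leq_trans ((a.+1 * tau m) ^ k)).
    by rewrite leq_exp2r//; apply: tau_pfactor_le.
  rewrite expnMn; apply: leq_mul => //.
  apply: (@leq_trans ((2 ^ a) ^ k)); first by rewrite leq_exp2r// ltn_expl.
  by rewrite -expnM mulnC expnM leq_exp2r//; apply: hn.
have small j : (j <= 2 ^ k)%N -> exists2 M, (0 < M)%N &
    forall n, (0 < n)%N -> large (2 ^ k - j)%N n -> (tau n ^ k <= M * n)%N.
  elim: j => [|j IH] jk.
    by exists 1%N => // n n0; rewrite subn0 mul1n; apply: big.
  have [M M0 hM] := IH (ltnW jk).
  exists (k ^ k * M)%N; first by rewrite muln_gt0 expn_gt0 k0.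
  move=> n n0 hn; set q := (2 ^ k - j.+1)%N in hn.
  have qE : (2 ^ k - j)%N = q.+1 by rewrite /q; lia.
  rewrite qE in hM.
  have [pq|nq] := boolP (prime q); last first.
    apply: (@leq_trans (M * n)); last by rewrite -mulnA leq_pmull// expn_gt0 k0.
    apply: hM => // r pr rn; rewrite ltn_neqAle hn// andbT.
    by apply: contra nq => /eqP ->.
  have [m pm nE] := pfactor_coprime pq n0.
  set a := logn q n in nE.
  have m0 : (0 < m)%N by move: n0; rewrite {1}nE muln_gt0 => /andP[].
  have hm : (tau m ^ k <= M * m)%N.
    apply: hM => // r pr rm; rewrite ltn_neqAle hn// ?andbT; last by rewrite nE dvdn_mulr.
    by apply/eqP => E; move: pm; rewrite prime_coprime// E rm.
  rewrite {1}nE [(m * _)%N]mulnC; apply: (@leq_trans ((a.+1 * tau m) ^ k)).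
    by rewrite leq_exp2r//; apply: tau_pfactor_le.
  rewrite expnMn; apply: leq_trans (leq_mul (succ_pow_le a k0) hm) _.
  rewrite [X in (_ <= _ * X)%N]nE mulnACA [(2 ^ a * m)%N]mulnC leq_mul2l leq_mul2l; apply/orP; right.
  by apply/orP; right; case: (a) => // a'; rewrite leq_exp2r ?prime_gt1.
have [M M0 hM] := small (2 ^ k)%N (leqnn _); exists M => // n n0.
by apply: hM => // p _ _; rewrite subnn.
Qed.

Lemma gcdn_subl m n : (m <= n)%N -> gcdn (n - m) n = gcdn m n.
Proof.
by move=> mn; rewrite -{2 3}(subnK mn) gcdnDl gcdnDr gcdnC.
Qed.

End DivisorBound.

Section KloostermanSaving.
Variable R : realType.
Local Notation C := R[i].

Definition harmonic_sum n : R := \sum_(0 <= j < n) (j.+1%:R)^-1.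

Lemma harmonic_sum_le n : harmonic_sum n.+1 <= 1 + ln (n.+1%:R).
Proof.
elim: n => [|n IH]; first by rewrite /harmonic_sum big_nat1 invr1 ln1 addr0.
rewrite /harmonic_sum big_nat_recr//= -/(harmonic_sum n.+1).
have h : ln (n.+1%:R) - ln (n.+2%:R) <= - (n.+2%:R)^-1 :> R.
  rewrite -ln_div ?posrE ?ltr0n//.
  have -> : n.+1%:R / n.+2%:R = 1 + - (n.+2%:R)^-1 :> R.
    rewrite -[n.+1%:R in LHS](addrK 1) natr1 mulrBl mulfV ?pnatr_eq0//.
    by rewrite mul1r.
  apply: le_ln1Dx; rewrite ltrN2 invf_lt1 ?ltr0n// ltr1n//.
move: IH h; move: (n.+2%:R^-1) (ln n.+1%:R) (ln n.+2%:R) (harmonic_sum n.+1) => a b d e; lra.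
Qed.

Lemma harmonic_sum_pow n : (0 < n)%N -> harmonic_sum n <= 33 * n%:R `^ (1 / 32).
Proof.
case: n => // n _; apply: le_trans (harmonic_sum_le n) _.
have x1 : (1 : R) <= n.+1%:R by rewrite ler1n.
have h1 : 1 <= n.+1%:R `^ (1 / 32) :> R.
  by rewrite -[X in X <= _](powRr0 n.+1%:R) ler_powR//; lra.
have x0 : 0 < n.+1%:R `^ (1 / 32) :> R by apply: lt_le_trans h1.
have h2 := ln_sublinear x0; rewrite ln_powR in h2.
lra.
Qed.

Lemma harmonic_sum_ge1 n : (0 < n)%N -> 1 <= harmonic_sum n.
Proof.
case: n => // n _; rewrite /harmonic_sum big_nat_recl//= invr1 lerDl sumr_ge0//.
Qed.

Lemma powR_le (x y r : R) : 0 <= r -> 0 <= x -> x <= y -> x `^ r <= y `^ r.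
Proof.
by move=> r0 x0 xy; apply: (ge0_ler_powR r0); rewrite ?nnegrE//; apply: le_trans xy.
Qed.

Lemma sum_lt_inj (T : finType) (S : pred T) (f : T -> nat) (g : nat -> R) n :
  (forall j, 0 <= g j) -> {in S &, injective f} ->
  (forall x, S x -> (f x < n)%N) ->
  \sum_(x | S x) g (f x) <= \sum_(0 <= j < n) g j.
Proof.
move=> g0 fi fn.
pose r := map f (enum S).
have -> : \sum_(x | S x) g (f x) = \sum_(j <- r) g j by rewrite big_map big_enum.
have ur : uniq r.
  rewrite map_inj_in_uniq ?enum_uniq// => x y.
  by rewrite !mem_enum; apply: fi.
rewrite /index_iota subn0 [leRHS](bigID (mem r)) /= -[leLHS]addr0; apply: lerD; last first.
  by apply: sumr_ge0.
rewrite -[X in _ <= X]big_filter le_eqVlt; apply/orP; left; apply/eqP/perm_big.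
apply: uniq_perm; rewrite ?filter_uniq ?iota_uniq// => j.
rewrite mem_filter /= mem_iota add0n /=; case jr : (j \in r) => //=.
by move: jr => /seq.mapP[x]; rewrite mem_enum => /fn h ->.
Qed.

Section Modulus.
Variable p : nat.
Local Notation c := (p.+2).
Local Notation A := ('I_p.+2).

Lemma gcd_sum_half :
  \sum_(h : A | h != 0) (gcdn h c)%:R / (h : nat)%:R <= (tau c)%:R * harmonic_sum c.
Proof.
have pos (h : A) : h != 0 -> (0 < h)%N.
  by move=> h0; rewrite lt0n; apply: contra h0 => /eqP E; apply/eqP/val_inj.
apply: (@le_trans _ _ (\sum_(h : A | h != 0) \sum_(d <- divisors c | (d %| h)%N) d%:R / (h : nat)%:R)).
  apply: ler_sum => h h0.
  rewrite [leRHS]big_mkcond (bigD1_seq (gcdn h c)) ?divisors_uniq//=; last first.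
    by rewrite -dvdn_divisors// dvdn_gcdr.
  rewrite dvdn_gcdl lerDl sumr_ge0// => d _.
  by case: ifP => // _; rewrite divr_ge0.
rewrite (exchange_big_dep xpredT) //= /tau.
have -> : (size (divisors c))%:R * harmonic_sum c = \sum_(d <- divisors c) harmonic_sum c.
  by rewrite big_const_seq count_predT iter_addr addr0 mulr_natl.
rewrite big_seq [leRHS]big_seq; apply: ler_sum => d; rewrite -dvdn_divisors// => dc.
have d0 : (0 < d)%N by apply: dvdn_gt0 dc.
rewrite (eq_bigr (fun h : A => ((h %/ d).-1.+1%:R)^-1)); last first.
  move=> h /andP[/pos h0 dh].
  have hd0 : (0 < h %/ d)%N by rewrite divn_gt0// dvdn_leq.
  rewrite prednK// -[in LHS](divnK dh) natrM; field.
  by rewrite !pnatr_eq0 -!lt0n ?d0 ?hd0.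
apply: (@sum_lt_inj _ (fun h : A => (h != 0) && (d %| h)%N) (fun h : A => (h %/ d).-1)
   (fun j => (j.+1%:R)^-1)).
- by move=> j; rewrite invr_ge0.
- move=> h h' /andP[/pos h0 dh] /andP[/pos h0' dh'] E.
  have hd0 : (0 < h %/ d)%N by rewrite divn_gt0// dvdn_leq.
  have hd0' : (0 < h' %/ d)%N by rewrite divn_gt0// dvdn_leq.
  have {}E : (h %/ d = h' %/ d)%N by move: E hd0 hd0'; lia.
  by apply: val_inj; rewrite /= -(divnK dh) E divnK.
- move=> h /andP[/pos h0 dh]; apply: leq_ltn_trans (leq_pred _) _.
  exact: leq_ltn_trans (leq_div _ _) (ltn_ord h).
Qed.

Lemma gcd_sum_le : gcd_sum R p <= 2 * ((tau c)%:R * harmonic_sum c).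
Proof.
have pos (h : A) : h != 0 -> (0 < h)%N.
  by move=> h0; rewrite lt0n; apply: contra h0 => /eqP E; apply/eqP/val_inj.
apply: (@le_trans _ _ (\sum_(h : A | h != 0) ((gcdn h c)%:R / (h : nat)%:R +
    (gcdn (- h : A)%R c)%:R / ((- h : A)%R : nat)%:R))).
  apply: ler_sum => h h0; have hp := pos _ h0.
  have hc := ltn_ord h.
  have Nh : ((- h : A)%R : nat) = (c - h)%N by rewrite /= modn_small//; lia.
  rewrite Nh (gcdn_subl (ltnW hc)).
  rewrite -mulrDr ler_wpM2l//; case: (leqP h (c - h)) => hh.
    by rewrite lerDl invr_ge0.
  by rewrite lerDr invr_ge0.
rewrite big_split /= mulr_natl mulr2n; apply: lerD; first exact: gcd_sum_half.
apply: le_trans gcd_sum_half; rewrite le_eqVlt; apply/orP; left; apply/eqP.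
rewrite [RHS](reindex_inj oppr_inj) /=.
by apply: eq_bigl => h; rewrite oppr_eq0.
Qed.

(** The fourth root of [kloosterman_orbit_bound]: the orbit has almost [c] elements. *)
Lemma kloosterman_bound (h k : A) :
  cabs (kloosterman R h k) <= 2 * c%:R `^ (3 / 4) * (tau c)%:R * (gcdn h c)%:R.
Proof.
set x := cabs _; set t : R := (tau c)%:R; set g : R := (gcdn h c)%:R.
have c0 : (0 : R) < c%:R by rewrite ltr0n.
have t1 : 1 <= t by rewrite ler1n tau_gt0.
have g1 : 1 <= g by rewrite ler1n gcdn_gt0 orbT.
have x0 : 0 <= x := cabs_ge0 _.
have q0 : 0 <= c%:R `^ (3 / 4) :> R := powR_ge0 _ _.
rewrite -(ler_pXn2r (ltn0Sn 3)) ?nnegrE//; last first.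
  by rewrite !mulr_ge0//; lra.
have c4 : (c%:R `^ (3 / 4)) ^+ 4 = c%:R ^+ 3 :> R.
  by rewrite -!powR_mulrn ?powR_ge0// -powRrM; congr (_ `^ _); field.
rewrite !exprMn c4.
have := kloosterman_orbit_bound R h k; rewrite nunitsE -/x -/t -/g => H1.
have H2 : c%:R <= (totient c)%:R * t by rewrite -natrM ler_nat leq_totient_tau.
have x40 : 0 <= x ^+ 4 by rewrite exprn_ge0.
(* multiply the orbit bound by [tau c] and cancel one factor [c] *)
have H3 : c%:R * x ^+ 4 <= c%:R * (g * (2 * c%:R ^+ 3 * t ^+ 3)).
  apply: (@le_trans _ _ ((totient c)%:R * t * x ^+ 4)); first by rewrite ler_wpM2r.
  have -> : (totient c)%:R * t * x ^+ 4 = t * ((totient c)%:R * x ^+ 4) by ring.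
  apply: le_trans (ler_wpM2l _ H1) _; first lra.
  by rewrite le_eqVlt; apply/orP; left; apply/eqP; ring.
rewrite ler_pM2l// in H3; apply: le_trans H3 _.
have -> : g * (2 * c%:R ^+ 3 * t ^+ 3) = 2 * c%:R ^+ 3 * (t ^+ 3 * g) by ring.
have -> : 2 ^+ 4 * c%:R ^+ 3 * t ^+ 4 * g ^+ 4 = 16 * c%:R ^+ 3 * (t ^+ 4 * g ^+ 4) by ring.
have h1 : t ^+ 3 * g <= t ^+ 4 * g ^+ 4.
  apply: ler_pM; [apply: exprn_ge0; lra|lra|exact: ler_weXn2l|].
  by rewrite -[leLHS]expr1 ler_weXn2l.
have h2 : 0 <= t ^+ 3 * g by rewrite mulr_ge0 ?exprn_ge0//; lra.
have h3 : (0 : R) <= c%:R ^+ 3 by rewrite exprn_ge0.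
nra.
Qed.

End Modulus.

(** On top of [c ^ (3 / 4)] the divisor function and the harmonic sum cost less than
[c ^ (1 / 8)]. The right-hand side only involves total variations, so the bound is
uniform in families of profiles. *)
Lemma kloosterman_saving : exists2 M : R, 0 <= M & forall p (G K : int -> C) (B : R),
  abs_summable G -> abs_summable K ->
  sum_le (fun d : int => cabs (G (d + 1) - G d)) B ->
  sum_le (fun d : int => cabs (K (d + 1) - K d)) B ->
  cabs (tsum G) <= p.+2%:R * B -> cabs (tsum K) <= p.+2%:R * B ->
  cabs (tsum (fun q : int * int =>
      if (q.2%:~R * q.1%:~R : 'I_p.+2) == 1 then G q.1 * K q.2 else 0) -
    (totient p.+2)%:R / (p.+2 ^ 2)%:R * (tsum G * tsum K)) <=
  B ^+ 2 * (M * p.+2%:R `^ (7 / 8)).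
Proof.
have [M0 M00 hM0] := tau_pow_bound (isT : 0 < 48)%N.
exists (16 * M0%:R `^ (1 / 16) * 33 ^+ 2).
  by rewrite !mulr_ge0 ?powR_ge0.
move=> p G K B sG sK vG vK tG tK; set c := p.+2.
have c0 : (0 : R) < c%:R by rewrite ltr0n.
set t : R := (tau c)%:R; set H := harmonic_sum c.
have t1 : 1 <= t by rewrite ler1n tau_gt0.
have H1 : 1 <= H by apply: harmonic_sum_ge1.
have q0 : 0 <= c%:R `^ (3 / 4) :> R := powR_ge0 _ _.
apply: le_trans (congruence_sum_bound (k := 2 * c%:R `^ (3 / 4) * t) sG sK vG vK tG tK _) _.
  by move=> h h' _; apply: kloosterman_bound.
rewrite -mulrA ler_wpM2l ?exprn_ge0 ?(sum_le_ge0 vG)//.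
have D0 : 0 <= gcd_sum R p by apply: sumr_ge0 => h _; rewrite divr_ge0.
have D1 : gcd_sum R p <= 2 * (t * H) := gcd_sum_le p.
have D2 : gcd_sum R p ^+ 2 + 2 * gcd_sum R p <= 8 * (t ^+ 2 * H ^+ 2).
  have tH : 1 <= t * H by rewrite mulr_ege1.
  rewrite -exprMn; nra.
have T : t ^+ 3 <= M0%:R `^ (1 / 16) * c%:R `^ (1 / 16).
  rewrite -powRM// -(_ : (t ^+ 48) `^ (1 / 16) = t ^+ 3).
    apply: powR_le; [lra|by rewrite exprn_ge0//; lra|].
    by rewrite -natrX -natrM ler_nat hM0.
  have t0 : 0 <= t by lra.
  by rewrite -!powR_mulrn// -powRrM; congr (_ `^ _); field.
have H2 : H ^+ 2 <= 33 ^+ 2 * c%:R `^ (1 / 16).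
  have -> : c%:R `^ (1 / 16) = (c%:R `^ (1 / 32)) ^+ 2 :> R.
    by rewrite -powR_mulrn ?powR_ge0// -powRrM; congr (_ `^ _); field.
  rewrite -exprMn lerXn2r ?nnegrE ?mulr_ge0 ?powR_ge0//; first lra.
  exact: harmonic_sum_pow.
have -> : 16 * M0%:R `^ (1 / 16) * 33 ^+ 2 * c%:R `^ (7 / 8) =
   16 * c%:R `^ (3 / 4) * ((M0%:R `^ (1 / 16) * c%:R `^ (1 / 16)) * (33 ^+ 2 * c%:R `^ (1 / 16))) :> R.
  have -> : (7 / 8 : R) = 3 / 4 + 1 / 16 + 1 / 16 by field.
  rewrite !powRD ?(gt_eqF c0) ?implybT//; ring.
apply: (@le_trans _ _ (16 * c%:R `^ (3 / 4) * (t ^+ 3 * H ^+ 2))); last first.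
  rewrite ler_wpM2l ?mulr_ge0//.
  by apply: ler_pM => //; rewrite exprn_ge0//; lra.
have -> : 16 * c%:R `^ (3 / 4) * (t ^+ 3 * H ^+ 2) =
  2 * c%:R `^ (3 / 4) * t * (8 * (t ^+ 2 * H ^+ 2)) by ring.
by rewrite ler_wpM2l// !mulr_ge0//; lra.
Qed.

End KloostermanSaving.

(** * The Dirichlet series of the totient function *)

Section Zeta.
Variable R : realType.
Local Notation C := R[i].
Implicit Types (w s u : C).

(** The decrements of [n ^ (- h) / h] dominate the terms. *)
Lemma pseries_sum_le (h : R) : 0 < h ->
  sum_le (fun n : nat => n.+1%:R `^ (- (1 + h))) (1 + h^-1).
Proof.
move=> h0; apply: sum_le_nat => [i|n]; first exact: powR_ge0.
have step (m : nat) : h * m.+2%:R `^ (- (1 + h)) <= m.+1%:R `^ (- h) - m.+2%:R `^ (- h) :> R.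
  have x0 : (0 : R) < m.+2%:R by rewrite ltr0n.
  have y0 : (0 : R) < m.+1%:R by rewrite ltr0n.
  have i0 : 0 < m.+2%:R^-1 :> R by rewrite invr_gt0.
  have E : m.+1%:R = m.+2%:R * (1 + - m.+2%:R^-1) :> R.
    by rewrite mulrDr mulr1 mulrN mulfV ?gt_eqF// -[m.+2%:R]natr1 addrK.
  have d0 : 0 < 1 + - m.+2%:R^-1 :> R by rewrite -(pmulr_rgt0 _ x0) -E.
  have -> : m.+1%:R `^ (- h) = m.+2%:R `^ (- h) * (1 + - m.+2%:R^-1) `^ (- h) :> R.
    by rewrite E powRM// ltW.
  have -> : m.+2%:R `^ (- (1 + h)) = m.+2%:R `^ (- h) * m.+2%:R^-1 :> R.
    rewrite opprD addrC powRD ?(gt_eqF x0) ?implybT//.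
    by rewrite -[X in _ * X = _]/(m.+2%:R `^ (-1)) powR_inv1// ltW.
  have q : 1 + h * m.+2%:R^-1 <= (1 + - m.+2%:R^-1) `^ (- h).
    rewrite /powR gt_eqF//; apply: le_trans (expR_ge1Dx _).
    have : ln (1 + - m.+2%:R^-1) <= - m.+2%:R^-1 :> R.
      by apply: le_ln1Dx; rewrite ltrN2 invf_lt1// ltr1n.
    by move=> hl; rewrite lerD2l mulNr -mulrN ler_pM2l// lerNr.
  rewrite mulrCA -[X in _ <= _ - X]mulr1 -mulrBr ler_pM2l ?powR_gt0//.
  by rewrite lerBrDl.
suff : \sum_(0 <= k < n.+1) k.+1%:R `^ (- (1 + h)) <= 1 + h^-1 - h^-1 * n.+1%:R `^ (- h).
  have n0 : 0 <= h^-1 * n.+1%:R `^ (- h) :> R by rewrite mulr_ge0 ?powR_ge0// invr_ge0 ltW.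
  rewrite big_nat_recr//=; have := powR_ge0 (n.+1%:R : R) (- (1 + h)).
  lra.
elim: n => [|n IH]; first by rewrite big_nat1 !powR1 mulr1; lra.
rewrite big_nat_recr//=; have := step n; rewrite -ler_pdivlMl// mulrBr.
by move: IH; lra.
Qed.

(** The shift by one makes [pw n w] equal to [n.+1 ^ (- w)], which is entire in [w]
for every natural number [n]. *)
Definition pw (n : nat) w : C := cexp (- (w * (ln n.+1%:R)%:C%C)).

Lemma cabs_pw n w : cabs (pw n w) = n.+1%:R `^ (- complex.Re w).
Proof.
rewrite /pw cabs_cexp /powR pnatr_eq0 /=; congr expR.
by case: w => a b /=; ring.
Qed.

Lemma pw_mul n m w : pw n w * pw m w = pw (n.+1 * m.+1).-1 w.
Proof.
rewrite /pw -cexpD prednK ?muln_gt0// natrM lnM ?posrE ?ltr0n// rmorphD.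
by congr cexp; ring.
Qed.

Lemma pw_sub1 n w : pw n (w - 1) = n.+1%:R * pw n w.
Proof.
have -> : n.+1%:R = cexp (ln n.+1%:R)%:C%C :> C.
  by rewrite cexp_real lnK ?posrE ?ltr0n// rmorph_nat.
by rewrite /pw -cexpD; congr cexp; ring.
Qed.

Lemma uholo_pw (B : C -> Prop) n a b : cbounded B -> uholo B (fun s => pw n (a * s + b)).
Proof.
move=> bB; have h := uholo_cexp (- (a * (ln n.+1%:R)%:C%C)) bB.
apply: uholo_eq (uholoZ (pw n b) bB h) => s _.
by rewrite /pw -cexpD; congr cexp; ring.
Qed.

Lemma powR_natS_le n (a b : R) : a <= b -> n.+1%:R `^ a <= n.+1%:R `^ b.
Proof. by move=> ab; apply: ler_powR => //; rewrite ler1n. Qed.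

Lemma pw_summable w : 1 < complex.Re w -> abs_summable (fun n => pw n w).
Proof.
move=> w1; exists (1 + (complex.Re w - 1)^-1).
have h0 : 0 < complex.Re w - 1 by rewrite subr_gt0.
apply: sum_le_le (pseries_sum_le h0) => n; rewrite cabs_pw.
by apply: powR_natS_le; lra.
Qed.

Lemma totient_leq n : (totient n <= n)%N.
Proof.
rewrite totient_count_coprime; apply: (@leq_trans (\sum_(0 <= d < n) 1)).
  by apply: leq_sum => d _; case: coprime.
by rewrite sum_nat_const_nat subn0 muln1.
Qed.

Lemma totient_pw_summable w : 2 < complex.Re w ->
  abs_summable (fun n => (totient n.+1)%:R * pw n w).
Proof.
move=> w1; exists (1 + (complex.Re w - 2)^-1).
have h0 : 0 < complex.Re w - 2 by rewrite subr_gt0.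
apply: sum_le_le (pseries_sum_le h0) => n; rewrite cabsM cabs_pw cabs_nat.
apply: (@le_trans _ _ (n.+1%:R * n.+1%:R `^ (- complex.Re w))).
  by rewrite ler_wpM2r ?powR_ge0// ler_nat totient_leq.
have x0 : (0 : R) < n.+1%:R by rewrite ltr0n.
rewrite -{1}(powRr1 (ltW x0)) -powRD ?(gt_eqF x0) ?implybT//.
by apply: powR_natS_le; lra.
Qed.

Lemma has_sum_finite (I : choiceType) (A : {fset I}) (f : I -> C) :
  (forall i, i \notin A -> f i = 0) -> has_sum f (\sum_(i <- A) f i).
Proof.
move=> h e e0; exists A => B AB.
rewrite (_ : \sum_(i <- B) f i = \sum_(i <- A) f i) ?subrr ?cabs0 ?ltW//.
rewrite (bigID (mem A)) /= [X in _ + X]big1; last by move=> i; apply: h.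
rewrite addr0 -big_filter; apply: perm_big.
apply: uniq_perm; rewrite ?filter_uniq ?fset_uniq// => i.
rewrite mem_filter /=; case iA : (i \in A) => //=.
by rewrite (fsubsetP AB).
Qed.

(** Products of the terms are grouped by the product of their indices, and the sum
of the totients of the divisors of [n] is [n]. *)
Lemma zeta_totient w : 2 < complex.Re w ->
  tsum (fun n => (totient n.+1)%:R * pw n w) * tsum (fun n => pw n w) =
  tsum (fun n => pw n (w - 1)).
Proof.
move=> w2; have w1 : 1 < complex.Re w by lra.
have s1 := totient_pw_summable w2; have s2 := pw_summable w1.
rewrite -tsum_prod// (tsum_fiber (fun q => (q.1.+1 * q.2.+1).-1) (abs_summable_prod s1 s2)).
apply: eq_tsum => N.
pose A := [fset (d.-1, (N.+1 %/ d).-1) | d in divisors N.+1]%fset.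
have inA n m : ((n, m) \in A) = ((n.+1 * m.+1).-1 == N).
  apply/imfsetP/eqP => [[d dN [-> ->]]|E].
    have {}dN : (d %| N.+1)%N by rewrite dvdn_divisors.
    have d0 : (0 < d)%N by apply: dvdn_gt0 dN.
    have q0 : (0 < N.+1 %/ d)%N by rewrite divn_gt0// dvdn_leq.
    by rewrite (prednK d0) (prednK q0) mulnC divnK.
  have E' : (n.+1 * m.+1 = N.+1)%N by rewrite -E prednK.
  exists n.+1; first by rewrite /= -dvdn_divisors// -E' dvdn_mulr.
  by rewrite -E' mulKn.
rewrite (has_sum_tsum (@has_sum_finite _ A _ _)); last first.
  by move=> [n m]; rewrite inA => /negbTE /= ->.
rewrite big_seq (eq_bigr (fun q => (totient q.1.+1)%:R * pw N w)); last first.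
  move=> [n m]; rewrite inA => /eqP E.
  change ((if (n.+1 * m.+1).-1 == N then (totient n.+1)%:R * pw n w * pw m w else 0) =
    (totient n.+1)%:R * pw N w).
  by rewrite E eqxx -mulrA pw_mul E.
rewrite -big_seq -mulr_suml pw_sub1; congr (_ * _).
rewrite /A big_imfset /=; last first.
  move=> d e; rewrite -!dvdn_divisors// => /(dvdn_gt0 (ltn0Sn _)) d0 /(dvdn_gt0 (ltn0Sn _)) e0.
  by case=> E _; rewrite -(prednK d0) E prednK.
rewrite -natr_sum -[in RHS](cyclic.sum_totient_dvd N.+1); congr (_%:R).
rewrite -(big_mkord (fun d => (d %| N.+1)%N) (fun d => totient d)) -[RHS]big_filter.
rewrite undup_id ?divisors_uniq//.
rewrite (eq_big_seq (fun d => totient d)); last first.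
  by move=> d; rewrite -dvdn_divisors// => /(dvdn_gt0 (ltn0Sn _)) /prednK ->.
apply: perm_big; apply: uniq_perm.
- exact: divisors_uniq.
- by apply: filter_uniq; apply: iota_uniq.
move=> d; rewrite mem_filter mem_index_iota -dvdn_divisors// ltnS leq0n /=.
by case dN : (d %| N.+1)%N => //=; rewrite dvdn_leq.
Qed.

(** The error of [u * x ^ (u - 1)] as an approximation of the increment of [x ^ u]
at the integer [x = n.+1]. *)
Definition zeta_term (n : nat) u : C := pw n.+1 (- u) - pw n (- u) - u * pw n (1 - u).

Lemma pw_succ n u : pw n.+1 (- u) = pw n (- u) * cexp (u * (ln (1 + n.+1%:R^-1))%:C%C).
Proof.
rewrite /pw -cexpD.
have -> : n.+2%:R = n.+1%:R * (1 + n.+1%:R^-1) :> R.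
  by rewrite mulrDr mulr1 mulfV ?pnatr_eq0// natr1.
have h : 0 < 1 + n.+1%:R^-1 :> R by rewrite addr_gt0// invr_gt0 ltr0n.
by rewrite lnM ?posrE ?ltr0n// rmorphD; congr cexp; ring.
Qed.

Lemma zeta_term_le n u : cabs u <= 2^-1 -> cabs (zeta_term n u) <= 10 * W (n%:R : R).
Proof.
move=> u2; rewrite /zeta_term.
have x0 : (0 : R) < n.+1%:R by rewrite ltr0n.
set x : R := n.+1%:R^-1.
have x1 : 0 < x by rewrite invr_gt0.
have x2 : x <= 1 by rewrite invf_le1// ler1n.
pose l := ln (1 + x).
have l1 : l <= x by apply: le_ln1Dx; lra.
have l0 : x - x ^+ 2 <= l.
  have h : ln (1 + - (x / (1 + x))) <= - (x / (1 + x)).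
    by apply: le_ln1Dx; rewrite ltrN2 ltr_pdivrMr; lra.
  have E : 1 + - (x / (1 + x)) = (1 + x)^-1 by field; lra.
  rewrite E lnV ?posrE in h; last lra.
  have : x - x ^+ 2 <= x / (1 + x).
    by rewrite ler_pdivlMr; [have := sqr_ge0 x; nra|lra].
  rewrite -/l in h; lra.
have l0' : 0 <= l by apply: le_trans l0; nra.
rewrite pw_succ -/x -/l.
have -> : pw n (1 - u) = pw n (- u) * x%:C%C.
  have -> : 1 - u = - u + 1 by ring.
  have := pw_sub1 n (- u + 1); rewrite addrK => ->.
  rewrite mulrAC fmorphV rmorph_nat mulfV ?mul1r// pnatr_eq0//.
have -> : pw n (- u) * cexp (u * l%:C%C) - pw n (- u) - u * (pw n (- u) * x%:C%C) =
   pw n (- u) * ((cexp (u * l%:C%C) - 1 - u * l%:C%C) + u * (l - x)%:C%C).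
  by rewrite rmorphB; ring.
rewrite cabsM cabs_pw raddfN opprK.
have ru : complex.Re u <= 2^-1.
  by apply: le_trans u2; apply: le_trans (normRe_le u); apply: ler_norm.
have b1 : n.+1%:R `^ complex.Re u <= n.+1%:R `^ 2^-1 :> R by apply: powR_natS_le.
have b2 : cabs ((cexp (u * l%:C%C) - 1 - u * l%:C%C) + u * (l - x)%:C%C) <= 10 * x ^+ 2.
  apply: le_trans (cabsD _ _) _.
  have cu : cabs (u * l%:C%C) <= x / 2.
    rewrite cabsM cabs_real (ger0_norm l0') mulrC; apply: ler_pM => //.
    exact: cabs_ge0.
  have h1 : cabs (cexp (u * l%:C%C) - 1 - u * l%:C%C) <= 10 * (x / 2) ^+ 2.
    apply: le_trans (cexp_quad _) _; first lra.
    by rewrite ler_pM2l// lerXn2r ?nnegrE ?cabs_ge0//; lra.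
  have h2 : cabs (u * (l - x)%:C%C) <= 2^-1 * x ^+ 2.
    rewrite cabsM cabs_real; apply: ler_pM => //; first exact: cabs_ge0.
    by rewrite ler_norml; apply/andP; split; lra.
  nra.
apply: le_trans (ler_pM (powR_ge0 _ _) (cabs_ge0 _) b1 b2) _.
have -> : W (n%:R : R) = n.+1%:R `^ 2^-1 * x ^+ 2.
  rewrite W_powR ger0_norm// addrC natr1 /x exprVn -powR_invn ?(ltW x0)//.
  by rewrite -powRD ?(gt_eqF x0) ?implybT//; congr (_ `^ _); field.
by rewrite le_eqVlt; apply/orP; left; apply/eqP; ring.
Qed.

Lemma W_nat_sum : sum_le (fun n : nat => W (n%:R : R)) 3.
Proof.
apply: sum_le_nat => [i|[|n]]; first exact/ltW/W_gt0.
  by rewrite big_nil.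
rewrite big_nat_recl//=; have := @W_sum_nat R 1 isT n; rewrite mulr1.
have -> : \sum_(0 <= k < n) W (k.+1%:R / 1%:R : R) = \sum_(0 <= k < n) W (k.+1%:R : R).
  by apply: eq_bigr => k _; rewrite divr1.
have := @W_le1 R 0; lra.
Qed.

(** The pole of zeta at 1: the increments of [n ^ u] add up to [- 1], and each of
them is [u * n ^ (u - 1)] up to a summable error. *)
Lemma zeta_continuation u : complex.Re u < 0 -> cabs u <= 2^-1 ->
  - u * tsum (fun n => pw n (1 - u)) = 1 + tsum (fun n => zeta_term n u).
Proof.
move=> u0 u2.
have sz : abs_summable (fun n => zeta_term n u).
  exists (10 * 3); apply: sum_le_le (sum_leZ (ler0n _ 10) W_nat_sum) => n.
  exact: zeta_term_le.
have sp : abs_summable (fun n => pw n (1 - u)).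
  by apply: pw_summable; rewrite raddfB /=; lra.
have st : abs_summable (fun n => pw n.+1 (- u) - pw n (- u)).
  have := abs_summableD sz (abs_summableZ u sp).
  by congr abs_summable; apply/funext => n; rewrite /zeta_term subrK.
suff T : tsum (fun n => pw n.+1 (- u) - pw n (- u)) = -1.
  rewrite /zeta_term tsumB//; last exact: abs_summableZ.
  by rewrite T tsumZ//; ring.
apply/eqP; rewrite -subr_eq0; apply/eqP/cabs_small_eq0 => e e0.
have e2 : 0 < e / 2 by rewrite divr_gt0.
have [||N hN] := @has_sum_exhaust R _ _ _ (fun n => [fset k in iota 0 n]%fset) _ _ (summable_has_sum st) _ e2.
- by move=> m n mn; apply/fsubsetP => i; rewrite !inE /= !mem_iota !add0n /= => im; apply: leq_trans mn.
- move=> i; exists i.+1; have h : i \in iota 0 i.+1 by rewrite mem_iota add0n ltnS leqnn.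
  by rewrite !inE in h *.
have Sn n : \sum_(i <- [fset k in iota 0 n]%fset) (pw i.+1 (- u) - pw i (- u)) = pw n (- u) - 1.
  rewrite (perm_big (iota 0 n)) /=; last first.
    by apply: uniq_perm; rewrite ?fset_uniq ?iota_uniq// => i; rewrite !inE.
  have -> : iota 0 n = index_iota 0 n by rewrite /index_iota subn0.
  rewrite telescope_sumr//; congr (_ - _).
  by rewrite /pw ln1 mulr0 oppr0 cexp0.
(* [|n ^ u|] tends to 0 because [Re u < 0] *)
have [M hM] : exists M : nat, forall n, (M <= n)%N -> cabs (pw n (- u)) <= e / 2.
  pose r := - complex.Re u; have r0 : 0 < r by rewrite oppr_gt0.
  exists (Num.truncn ((e / 2) `^ (- r^-1))) => n Mn.
  have x0 : (0 : R) < n.+1%:R by rewrite ltr0n.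
  rewrite cabs_pw; have -> : - complex.Re (- u) = - r by rewrite /r; case: (u).
  rewrite powRN.
  have y0 : 0 < (e / 2) `^ (- r^-1) by rewrite powR_gt0.
  have : (e / 2) `^ (- r^-1) <= n.+1%:R.
    by apply: le_trans (ltW (truncnS_gt _)) _; rewrite ler_nat.
  move=> /(powR_le (ltW r0) (ltW y0)); rewrite -powRrM mulNr mulVf ?gt_eqF//.
  rewrite powRN (powRr1 (ltW e2)) => h.
  by rewrite -[leRHS]invrK lef_pV2 ?posrE ?invr_gt0 ?powR_gt0.
have h1 := hN (maxn N M) (leq_maxl _ _); have h2 := hM (maxn N M) (leq_maxr _ _).
rewrite Sn in h1.
set T := tsum _ in h1 *.
have -> : T - -1 = pw (maxn N M) (- u) - (pw (maxn N M) (- u) - 1 - T) by ring.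
by apply: le_trans (cabsB _ _) _; lra.
Qed.

(** By [zeta_totient] the series is [zeta(w - 1) / zeta(w)] at [w = 4 s - 2]. Here [z]
is the denominator, not 0 at [w = 2] since its terms are positive there, and [D]
carries the numerator with its pole removed by [zeta_continuation]. *)
Lemma totient_series_continuation : exists D z : C -> C,
  [/\ uholo (disk 1 (1 / 8 : R)) D, uholo (disk 1 (1 / 8 : R)) z, z 1 != 0 &
   forall s, disk 1 (1 / 8 : R) s -> 1 < complex.Re s ->
     (s - 1) * z s * tsum (fun n => (totient n.+1)%:R * pw n (4 * s - 2)) = D s].
Proof.
pose B := disk (1 : C) (1 / 8 : R).
have bB : cbounded B by apply: disk_bounded.
exists (fun s => 4^-1 * (1 + tsum (fun n => zeta_term n (- 4 * s + 4)))).
exists (fun s => tsum (fun n => pw n (4 * s - 2))).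
have reB s : B s -> 7 / 8 <= complex.Re s.
  move=> Bs; have := le_trans (normRe_le _) Bs; rewrite raddfB /= ler_norml; lra.
split.
- apply: uholoZ => //; apply: uholoD; first exact: uholo_cst.
  apply: (@uholo_tsum _ _ _ _ (fun n => 10 * W (n%:R : R)) (10 * 3)).
  + move=> n; rewrite /zeta_term.
    apply: uholoB => //; first apply: uholoB => //.
    * by apply: uholo_eq (uholo_pw n.+1 4 (-4) bB) => s _; congr pw; ring.
    * by apply: uholo_eq (uholo_pw n 4 (-4) bB) => s _; congr pw; ring.
    * apply: uholoM => //.
        apply: uholoD; last exact: uholo_cst.
        by apply: uholoZ => //; apply: uholo_id.
      by apply: uholo_eq (uholo_pw n 4 (-3) bB) => s _; congr pw; ring.
  + move=> n s Bs; apply: zeta_term_le.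
    have -> : - 4 * s + 4 = - 4 * (s - 1) by ring.
    by rewrite cabsM cabsN cabs_nat; move: Bs; rewrite /B /disk; lra.
  + by move=> n; rewrite mulr_ge0// ltW// W_gt0.
  + exact: sum_leZ W_nat_sum.
- apply: (@uholo_tsum _ _ _ _ (fun n => n.+1%:R `^ (- (1 + 1 / 2))) (1 + (1 / 2)^-1)).
  + by move=> n; apply: uholo_pw.
  + move=> n s /reB Bs; rewrite cabs_pw; apply: powR_natS_le.
    by case: s Bs => a b /=; lra.
  + by move=> n; apply: powR_ge0.
  + by apply: pseries_sum_le; rewrite divr_gt0.
- have E2 : 4 * 1 - 2 = (2%:R : R)%:C%C :> C by rewrite rmorph_nat; ring.
  rewrite E2.
  have s2 : abs_summable (fun n => pw n ((2%:R : R)%:C%C : C)).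
    by apply: pw_summable => /=; lra.
  have re n : complex.Re (pw n ((2%:R : R)%:C%C : C)) >= 0.
    rewrite /pw -rmorphM -rmorphN cexp_real /=; exact: expR_ge0.
  have re0 : complex.Re (pw 0 ((2%:R : R)%:C%C : C)) = 1.
    by rewrite /pw ln1 mulr0 oppr0 cexp0.
  have [A hA] := summable_has_sum s2 (divr_gt0 ltr01 (ltr0n R 2)).
  have := hA (0%N |` A)%fset (fsubsetUr _ _).
  set T := tsum _; apply: contraTneq => ->; rewrite subr0 -ltNge.
  apply: lt_le_trans (normRe_le _); apply: lt_le_trans (ler_norm _).
  set Z := (_ |` _)%fset.
  have -> : complex.Re (\sum_(i <- Z) pw i (2%:R)%:C%C) =
      \sum_(i <- Z) complex.Re (pw i ((2%:R : R)%:C%C : C)) by rewrite raddf_sum.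
  rewrite (big_fsetD1 0%N) ?fset1U1// re0.
  have : 0 <= \sum_(i <- (Z `\ 0%N)%fset) complex.Re (pw i ((2%:R : R)%:C%C : C)).
    by apply: sumr_ge0.
  set Y := \sum_(i <- _) _; rewrite -[X in _ < X]/(1 + Y); lra.
- move=> s Bs s1.
  have w2 : 2 < complex.Re (4 * s - 2) by case: s s1 {Bs} => a b /=; lra.
  rewrite -mulrA [tsum _ * tsum _]mulrC zeta_totient//.
  have := @zeta_continuation (- 4 * s + 4).
  have -> : 1 - (- 4 * s + 4) = 4 * s - 2 - 1 by ring.
  move=> <-.
  + by field.
  + by case: s s1 {Bs w2} => a b /=; lra.
  + have -> : - 4 * s + 4 = - 4 * (s - 1) by ring.
    by rewrite cabsM cabsN cabs_nat; move: Bs; rewrite /B /disk; lra.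
Qed.

End Zeta.

(** * Uniform bounds in a half-plane *)

Section UniformBounds.
Variable R : realType.
Local Notation C := R[i].
Implicit Types (x y k b : R) (w s v : C).

(** The values of [s] for which products of two factors growing like [|x|] have
[Pf] bounded by a multiple of the weight. *)
Definition region b s : Prop := 7 / 8 <= complex.Re s /\ cabs s <= b.

Lemma powR_neg_le (x y r : R) : r <= 0 -> 0 < x -> x <= y -> y `^ r <= x `^ r.
Proof.
move=> r0 x0 xy; have y0 : 0 < y by apply: lt_le_trans xy.
rewrite -[r]opprK !(powRN _ (- r)) lef_pV2 ?posrE ?powR_gt0//.
by apply: powR_le; rewrite ?oppr_ge0// ltW.
Qed.

Lemma cabs_Pf_le k b x v s : 0 < k -> k <= 1 -> region b s ->
  k * (1 + `|x|) <= cabs v ->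
  cabs (Pf v s) <= k `^ (- (2 * b)) * (1 + `|x|) `^ (- (3 / 4)).
Proof.
move=> k0 k1 [s1 s2] kv; have x0 := W_arg_gt0 x.
have x1 : 1 <= 1 + `|x| by rewrite lerDl.
have v0 : v != 0 by rewrite -cabs_gt0; apply: lt_le_trans kv; rewrite mulr_gt0.
have sb : complex.Re s <= b.
  by apply: le_trans s2; apply: le_trans (normRe_le _); apply: ler_norm.
rewrite cabs_Pf//; apply: le_trans (powR_neg_le _ _ kv) _; [lra|by rewrite mulr_gt0|].
rewrite powRM ?(ltW k0) ?(ltW x0)//; apply: ler_pM; rewrite ?powR_ge0//.
  by apply: ger_powR; [rewrite k0|lra].
by apply: ler_powR => //; lra.
Qed.

Lemma Pf_size k b x v1 v2 s : 0 < k -> k <= 1 -> region b s ->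
  k * (1 + `|x|) <= cabs v1 -> k * (1 + `|x|) <= cabs v2 ->
  cabs (Pf (v1 * v2) s) <= k `^ (- (4 * b)) * W x.
Proof.
move=> k0 k1 rs h1 h2; rewrite PfM cabsM.
apply: le_trans (ler_pM (cabs_ge0 _) (cabs_ge0 _) (cabs_Pf_le k0 k1 rs h1) (cabs_Pf_le k0 k1 rs h2)) _.
have x0 := W_arg_gt0 x.
rewrite le_eqVlt; apply/orP; left; apply/eqP.
rewrite mulrACA -!powRD ?(gt_eqF k0) ?(gt_eqF x0) ?implybT// W_powR.
by congr (_ `^ _ * _ `^ _); field.
Qed.

Lemma nonreal_lower w : complex.Im w != 0 -> exists k, [/\ 0 < k, k <= 1 &
  forall x, k * (1 + `|x|) <= cabs (x%:C%C + w)].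
Proof.
move=> w0; pose y := `|complex.Im w|; have y0 : 0 < y by rewrite normr_gt0.
have D0 : 0 < 1 + cabs w + y by have := cabs_ge0 w; lra.
exists (y / (1 + cabs w + y)); split.
- by rewrite divr_gt0.
- by rewrite ler_pdivrMr//; have := cabs_ge0 w; lra.
move=> x; rewrite mulrAC ler_pdivrMr//.
have h1 : y <= cabs (x%:C%C + w).
  apply: le_trans (normIm_le _); rewrite raddfD /= add0r //.
have h2 : `|x| <= cabs (x%:C%C + w) + cabs w.
  have E : x%:C%C = (x%:C%C + w) - w by ring.
  by rewrite -cabs_real {1}E; apply: cabsB.
set q := cabs (_ + _) in h1 h2 *; have := cabs_ge0 w.
nra.
Qed.

(** The quotient of two shifted points at distance at most 1 stays in a fixed
annulus, so [Pf_lipschitz] applies to it. *)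
Lemma Pf_profile w1 w2 b : complex.Im w1 != 0 -> complex.Im w2 != 0 -> 0 <= b ->
  exists K, forall s, region b s ->
    profile K (fun x => Pf ((x%:C%C + w1) * (x%:C%C + w2)) s).
Proof.
move=> i1 i2 b0.
have [k1 [k10 k11 h1]] := nonreal_lower i1.
have [k2 [k20 k21 h2]] := nonreal_lower i2.
pose k := Num.min k1 k2.
have k0 : 0 < k by rewrite lt_min k10.
have kl1 : k <= 1 by rewrite ge_min k11.
have g1 x : k * (1 + `|x|) <= cabs (x%:C%C + w1).
  by apply: le_trans (h1 x); rewrite ler_wpM2r ?(ltW (W_arg_gt0 x))// ge_min lexx.
have g2 x : k * (1 + `|x|) <= cabs (x%:C%C + w2).
  by apply: le_trans (h2 x); rewrite ler_wpM2r ?(ltW (W_arg_gt0 x))// ge_min lexx orbT.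
have ge_k w : (forall x, k * (1 + `|x|) <= cabs (x%:C%C + w)) -> forall x, k <= cabs (x%:C%C + w).
  by move=> h x; apply: le_trans (h x); rewrite ler_peMr ?(ltW k0)// lerDl.
pose d := 1 + k^-1.
have ik : 0 < k^-1 by rewrite invr_gt0.
have d1 : 1 <= d by rewrite /d lerDl ltW.
have q0 : 0 < (d * d)^-1 by rewrite invr_gt0 mulr_gt0; lra.
have q1 : (d * d)^-1 <= 1 by rewrite invf_le1 ?mulr_ege1//; nra.
have [L L0 hL] := Pf_lipschitz q0 q1 b0.
pose K0 := k `^ (- (4 * b)).
have K00 : 0 <= K0 := powR_ge0 _ _.
pose K1 := L * (k^-1 * (d + 1)).
have K10 : 0 <= K1.
  by apply: mulr_ge0 => //; apply: mulr_ge0; lra.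
exists (K0 * (1 + K1)) => s rs; have [_ sb] := rs.
have size x : cabs (Pf ((x%:C%C + w1) * (x%:C%C + w2)) s) <= K0 * W x.
  exact: (Pf_size k0 kl1 rs (g1 x) (g2 x)).
split=> [x|x y xy].
  apply: le_trans (size x) _; rewrite ler_wpM2r ?(ltW (W_gt0 x))//.
  by rewrite ler_peMr// lerDl.
have ratio w : (forall x, k * (1 + `|x|) <= cabs (x%:C%C + w)) -> forall x y, `|x - y| <= 1 ->
    exists q : C, [/\ x%:C%C + w = (y%:C%C + w) * q, cabs q <= d, d^-1 <= cabs q &
     cabs (q - 1) <= k^-1 * `|x - y|].
  move=> h {}x {}y {}xy; exists ((x%:C%C + w) / (y%:C%C + w)).
  have kx := ge_k w h x; have ky := ge_k w h y.
  have px : 0 < cabs (x%:C%C + w) by lra.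
  have py : 0 < cabs (y%:C%C + w) by lra.
  have nx : x%:C%C + w != 0 by rewrite -cabs_gt0.
  have ny : y%:C%C + w != 0 by rewrite -cabs_gt0.

  have up (x' y' : R) : `|x' - y'| <= 1 -> k <= cabs (y'%:C%C + w) ->
      cabs ((x'%:C%C + w) / (y'%:C%C + w)) <= d.
    move=> xy' ky'; have py' : 0 < cabs (y'%:C%C + w) by lra.
    rewrite cabsM cabsV ler_pdivrMr// mulrDl mul1r.
    have -> : x'%:C%C + w = (y'%:C%C + w) + (x' - y')%:C%C by rewrite rmorphB; ring.
    apply: le_trans (cabsD _ _) _; rewrite lerD2l cabs_real; apply: le_trans xy' _.
    by rewrite -(mulVf (lt0r_neq0 k0)) ler_pM2l.
  split.
  - by rewrite mulrC divfK.
  - exact: up.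
  - have := up y x; rewrite distrC => /(_ xy kx) h'.
    rewrite -[leRHS]invrK lef_pV2 ?posrE; [|lra|by rewrite invr_gt0 cabs_gt0 mulf_neq0// invr_eq0].
    by rewrite -cabsV invf_div.
  - have -> : (x%:C%C + w) / (y%:C%C + w) - 1 = (x - y)%:C%C / (y%:C%C + w).
      by rewrite rmorphB; field.
    rewrite cabsM cabsV cabs_real mulrC ler_wpM2r ?normr_ge0// lef_pV2 ?posrE//.
have [p [E1 p1 p2 p3]] := ratio w1 g1 x y xy.
have [q [E2 r1 r2 r3]] := ratio w2 g2 x y xy.
have -> : Pf ((x%:C%C + w1) * (x%:C%C + w2)) s - Pf ((y%:C%C + w1) * (y%:C%C + w2)) s =
    Pf ((y%:C%C + w1) * (y%:C%C + w2)) s * (Pf (p * q) s - 1).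
  by rewrite E1 E2 (mulrACA _ p) [X in X - _]PfM mulrBr mulr1.
rewrite cabsM.
have d0' : 0 <= d^-1 by rewrite invr_ge0; lra.
have pq : cabs (Pf (p * q) s - 1) <= K1 * `|x - y|.
  apply: le_trans (hL _ _ _ sb) _.
    rewrite invrK cabsM invfM; apply/andP; split; last by rewrite ler_pM ?cabs_ge0.
    by rewrite ler_pM.
  rewrite /K1 -mulrA ler_wpM2l//.
  have -> : p * q - 1 = (p - 1) * q + (q - 1) by ring.
  apply: le_trans (cabsD _ _) _; rewrite cabsM mulrAC mulrDr mulr1; apply: lerD => //.
  by rewrite ler_pM ?cabs_ge0.
apply: le_trans (ler_pM (cabs_ge0 _) (cabs_ge0 _) (size y) pq) _.
have -> : K0 * W y * (K1 * `|x - y|) = K0 * K1 * `|x - y| * W y by ring.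
rewrite ler_wpM2r ?(ltW (W_gt0 y))// ler_wpM2r// ler_wpM2l// lerDr//.
Qed.

End UniformBounds.

Section Transfer.
Variable R : realType.
Local Notation C := R[i].

Lemma tsum_transfer (I J : choiceType) (h : I -> J) (f : I -> C) (f' : J -> C) :
  abs_summable f ->
  (forall i, f i != 0 -> f i = f' (h i)) ->
  (forall i i', f i != 0 -> f i' != 0 -> h i = h i' -> i = i') ->
  (forall j, f' j != 0 -> exists2 i, f i != 0 & h i = j) ->
  tsum f = tsum f'.
Proof.
move=> sf ff inj sur; rewrite (tsum_fiber h sf); apply: eq_tsum => j.
have [f0|f0] := eqVneq (f' j) 0.
  rewrite f0 (_ : (fun i => _) = fun=> 0)//.
    exact: has_sum_tsum (has_sum0 _).
  apply/funext => i; case: eqP => // hij.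
  by apply/eqP/negPn/negP => fi; have := ff i fi; rewrite hij f0 => E; rewrite E eqxx in fi.
have [i0 fi0 hi0] := sur j f0.
rewrite (has_sum_tsum (@has_sum_finite _ _ [fset i0]%fset _ _)).
  by rewrite big_seq_fset1 hi0 eqxx ff// hi0.
move=> i; rewrite inE => ii0; case: eqP => // hij.
apply/eqP/negPn/negP => fi; case/negP: ii0; apply/eqP.
by apply: inj => //; rewrite hij hi0.
Qed.

Lemma finite_positive_min (T : eqType) (r : seq T) (f : T -> R) :
  exists2 k, 0 < k & forall x, x \in r -> 0 < f x -> k <= f x.
Proof.
elim: r => [|x r [k k0 hk]]; first by exists 1.
have [fx|fx] := ltP 0 (f x).
  exists (Num.min k (f x)); first by rewrite lt_min k0.
  move=> y; rewrite inE => /predU1P[->|yr] fy; first by rewrite ge_min lexx orbT.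
  by rewrite ge_min hk.
exists k => // y; rewrite inE => /predU1P[->|yr] fy; last exact: hk.
by move: fx; rewrite leNgt fy.
Qed.

End Transfer.

(** * Entries of unimodular matrices *)

Section Matrices.
Implicit Types g : SL2Z.

Lemma det_mx2 (M : 'M[int]_2) : \det M = M 0 0 * M 1 1 - M 0 1 * M 1 0.
Proof.
rewrite (expand_det_row _ 0) !big_ord_recl big_ord0 /cofactor !det_mx11 !mxE /= addr0.
have -> : lift 0 0 = 1 :> 'I_2 by apply: val_inj.
have -> : lift 1 0 = 0 :> 'I_2 by apply: val_inj.
by rewrite expr0 expr1 !mul1r mulN1r mulrN.
Qed.

Lemma SL2Z_det g : val g 0 0 * val g 1 1 - val g 0 1 * val g 1 0 = 1.
Proof. by have /eqP := valP g; rewrite det_mx2. Qed.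

Lemma SL2Z_eq g g' : (forall i j, val g i j = val g' i j) -> g = g'.
Proof. by move=> h; apply: val_inj; apply/matrixP. Qed.

Lemma ord2P (i : 'I_2) : (i = 0) \/ (i = 1).
Proof. by case: i => [[|[|//]]] p; [left|right]; apply: val_inj. Qed.

Definition mx2 (a b c d : int) : 'M[int]_2 :=
  \matrix_(i, j) (if i == 0 then (if j == 0 then a else b) else (if j == 0 then c else d)).

Lemma SL2Z_exists (a b c d : int) : a * d - b * c = 1 ->
  exists g, [/\ val g 0 0 = a, val g 0 1 = b, val g 1 0 = c & val g 1 1 = d].
Proof.
move=> h; have hd : \det (mx2 a b c d) == 1 by rewrite det_mx2 !mxE /= h.
by exists (exist _ (mx2 a b c d) hd); split; rewrite /= mxE.
Qed.

End Matrices.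

Section MuAlgebra.
Variable R : realType.
Local Notation C := R[i].
Variables z t : C.
Hypothesis z0 : 0 < complex.Im z.
Hypothesis t0 : 0 < complex.Im t.
Hypothesis zt : forall g : SL2Z, t <> moebius g z.

Lemma mu_neq0 (g : SL2Z) : mu g z t != 0.
Proof.
apply/eqP => h; apply: (zt (g := g)); rewrite /moebius.
have nz : entry R g 1 0 * z + entry R g 1 1 != 0.
  apply/eqP => /eqP; rewrite eq_complex => /andP[/eqP h1 /eqP h2].
  have D := SL2Z_det g; move: h1 h2 z0; rewrite /entry; case: (z) => x y /=.
  rewrite -!(rmorph_int (real_complex R)) /= !mul0r subr0 !addr0 => h1 /eqP.
  rewrite mulf_eq0 => /orP[|/eqP -> //]; last by rewrite ltxx.
  rewrite intr_eq0 => /eqP c0; move: h1; rewrite c0 mul0r add0r => /eqP.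
  by rewrite intr_eq0 => /eqP d0; move: D; rewrite c0 d0 !mulr0.
apply/esym/eqP; rewrite -(inj_eq (mulIf nz)) divfK// -subr_eq0; apply/eqP.
by rewrite -[RHS]oppr0 -h /mu; ring.
Qed.

(** [conj t] lies in the lower half-plane, hence off the orbit of [z]. *)
Lemma mu_conj_neq0 (g : SL2Z) : mu g z t^* != 0.
Proof.
apply/eqP => /eqP; rewrite eq_complex => /andP[/eqP h1 /eqP h2].
have D : (val g 0 0)%:~R * (val g 1 1)%:~R - (val g 0 1)%:~R * (val g 1 0)%:~R = 1 :> R.
  by rewrite -!intrM -intrB SL2Z_det.
move: h1 h2 z0 t0 D; rewrite /mu /entry.
rewrite -!(rmorph_int (real_complex R)) /=.
case: (z) => x y; case: (t) => u v /=.
move: ((val g 0 0)%:~R : R) ((val g 0 1)%:~R : R) ((val g 1 0)%:~R : R) ((val g 1 1)%:~R : R).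
move=> a b c d h1 h2 y0 v0 D.
have E1 : (c * x + d) * u + c * y * v - a * x - b = 0 by rewrite -[RHS]h1; ring.
have E2 : c * y * u - (c * x + d) * v - a * y = 0 by rewrite -[RHS]h2; ring.
(* imaginary part of (a z + b) * conj (c z + d) - conj t * |c z + d| ^ 2 *)
have E3 : y + v * ((c * x + d) ^+ 2 + (c * y) ^+ 2) = 0.
  have -> : y + v * ((c * x + d) ^+ 2 + (c * y) ^+ 2) = y * (1 - (a * d - b * c)) +
    ((c * y) * ((c * x + d) * u + c * y * v - a * x - b) -
     (c * x + d) * (c * y * u - (c * x + d) * v - a * y)) by ring.
  by rewrite E1 E2 D !mulr0 !subrr mulr0 addr0.
have : 0 <= v * ((c * x + d) ^+ 2 + (c * y) ^+ 2).
  by rewrite mulr_ge0 ?addr_ge0 ?sqr_ge0// ltW.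
lra.
Qed.

(** Since [a d - b c = 1], the value [c * mu] is [mu_product + 1]: it factors up to
a bounded error, and the upper right entry has disappeared. *)
Definition mu_product (n : nat) (d a : int) (w : C) : C :=
  (n%:R * z + d%:~R) * (n%:R * w - a%:~R).

Lemma mu_product_succ (g : SL2Z) (w : C) (n : nat) (e : int) : e * e = 1 ->
  val g 1 0 = e * n%:Z ->
  n%:R * e%:~R * mu g z w = mu_product n (e * val g 1 1) (e * val g 0 0) w + 1.
Proof.
move=> e2 hc; have D := SL2Z_det g.
have D' : (val g 0 0)%:~R * (val g 1 1)%:~R - (val g 0 1)%:~R * (val g 1 0)%:~R = 1 :> C.
  by rewrite -!intrM -intrB D.
have e2' : e%:~R * e%:~R = 1 :> C by rewrite -intrM e2.
move: D'; rewrite /mu_product /mu /entry !intrM hc intrM -pmulrn.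
move: (n%:R : C) ((val g 0 0)%:~R : C) ((val g 1 1)%:~R : C) ((val g 0 1)%:~R : C).
move: (e%:~R : C) e2' => f f2 m a d b D'.
rewrite -[X in _ = _ + X]D'; apply/eqP; rewrite -subr_eq0.
set L := (X in X == 0).
have -> : L = (f * f - 1) * (m * m * z * w + a * d) by rewrite /L; ring.
by rewrite f2 subrr mul0r.
Qed.

End MuAlgebra.

(** * The terms with nonzero lower left entry *)

Section TermEstimates.
Variable R : realType.
Local Notation C := R[i].
Variables z t : C.
Hypothesis z0 : 0 < complex.Im z.
Hypothesis t0 : 0 < complex.Im t.
Hypothesis zt : forall g : SL2Z, t <> moebius g z.

Definition admissible (n : nat) (d a : int) : bool := (n%:Z %| a * d - 1)%Z.

(** The general term as a function of [n = |c|] and of [d], [a] taken with the sign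
of [c]; the factor [n ^- 2] undoes the multiplication of both values of [mu] by [c]. *)
Definition admissible_term (n : nat) (d a : int) (s : C) : C :=
  Pf (n%:R ^- 2 * ((mu_product z n d a t + 1) * (mu_product z n d a t^* + 1))) s.

Lemma admissible_SL2Z n d a : (0 < n)%N -> admissible n d a ->
  exists g : SL2Z, [/\ val g 0 0 = a, val g 1 0 = n%:Z & val g 1 1 = d].
Proof.
move=> n0 /dvdzP[b hb].
have [|g [ga gb gc gd]] := @SL2Z_exists a b n%:Z d; first by rewrite -hb; ring.
by exists g.
Qed.

Lemma Xi_term_admissible (g : SL2Z) s : val g 1 0 != 0 ->
  let e := sgz (val g 1 0) in
  Xi_term 1 z t s g = admissible_term (absz (val g 1 0)) (e * val g 1 1) (e * val g 0 0) s.
Proof.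
move=> c0 e; set n := absz _.
have e2 : e * e = 1 by rewrite /e; case: sgzP c0.
have hc : val g 1 0 = e * n%:Z by rewrite /e /n; case: sgzP c0 => // h _; lia.
have n0 : n%:R != 0 :> C by rewrite pnatr_eq0 /n absz_eq0.
rewrite Xi_term1 /admissible_term -!(mu_product_succ z _ e2 hc); congr Pf.
have e2' : e%:~R * e%:~R = 1 :> C by rewrite -intrM e2.
set m1 := mu _ _ _; set m2 := mu _ _ _.
have -> : n%:R ^- 2 * (n%:R * e%:~R * m1 * (n%:R * e%:~R * m2)) =
   (e%:~R * e%:~R) * (m1 * m2) :> C by field.
by rewrite e2' mul1r.
Qed.

Lemma cabs_shift_ge (w : C) (n : nat) (d : int) :
  n%:R * `|complex.Im w| <= cabs (n%:R * w + d%:~R).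
Proof.
apply: le_trans (normIm_le _).
rewrite -(rmorph_nat (real_complex R)) -(rmorph_int (real_complex R)).
case: w => x y /=; rewrite mul0r addr0 addr0 normrM ger0_norm//.
Qed.

Lemma cabs_mu_product_ge (w : C) n d a :
  n%:R ^+ 2 * (complex.Im z * `|complex.Im w|) <= cabs (mu_product z n d a w).
Proof.
rewrite /mu_product cabsM; have -> : n%:R ^+ 2 * (complex.Im z * `|complex.Im w|) =
  (n%:R * complex.Im z) * (n%:R * `|complex.Im w|) :> R by ring.
apply: ler_pM; rewrite ?mulr_ge0// ?(ltW z0)//.
  by apply: le_trans (cabs_shift_ge z n d); rewrite gtr0_norm.
by have := cabs_shift_ge w n (- a); rewrite intrN.
Qed.

(** Outside a finite set of triples [mu_product] has modulus at least 2; on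
that finite set [mu_product + 1], being a multiple of a nonzero [mu], stays away from 0. *)
Lemma mu_product_succ_lower (w : C) : complex.Im w != 0 -> (forall g : SL2Z, mu g z w != 0) ->
  exists k : R, [/\ 0 < k, k <= 1 & forall n d a, (0 < n)%N -> admissible n d a ->
    k * cabs (mu_product z n d a w) <= cabs (mu_product z n d a w + 1)].
Proof.
move=> w0 muw; pose y := `|complex.Im w|; have y0 : 0 < y by rewrite normr_gt0.
have Epos n d a : (0 < n)%N -> 0 < cabs (mu_product z n d a w).
  move=> n0; apply: lt_le_trans (cabs_mu_product_ge w n d a).
  by rewrite mulr_gt0 ?exprn_gt0 ?ltr0n// mulr_gt0.
pose N := (Num.truncn (2 / (complex.Im z * y) + 2 / y + 2 / complex.Im z +
  2 / (complex.Im z * y) * (cabs z + cabs w))).+1.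
have hN : 2 / (complex.Im z * y) + 2 / y + 2 / complex.Im z +
  2 / (complex.Im z * y) * (cabs z + cabs w) < N%:R by apply: truncnS_gt.
pose rng : seq int := [seq i%:Z - N%:Z | i <- iota 0 (2 * N).+1].
have in_rng (i : int) : `|i%:~R| <= N%:R :> R -> i \in rng.
  move=> h; have iN : `|i| <= N%:Z by rewrite -(ler_int R) intr_norm.
  apply/seq.mapP; exists (absz (i + N%:Z)); first by rewrite mem_iota; lia.
  lia.
pose box := [seq (p, a) | p <- [seq (n, d) | n <- iota 0 N.+1, d <- rng], a <- rng].
pose f (x : (nat * int) * int) := cabs (mu_product z x.1.1 x.1.2 x.2 w + 1) / cabs (mu_product z x.1.1 x.1.2 x.2 w).
have [k k0 hk] := finite_positive_min box f.
exists (Num.min k 2^-1); split.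
- by rewrite lt_min k0 invr_gt0 ltr0n.
- by rewrite ge_min invf_le1// ler1n orbT.
move=> n d a n0 adm.
have Ep := Epos n d a n0.
have [q2|q2] := leP 2 (cabs (mu_product z n d a w)).
  apply: (@le_trans _ _ (2^-1 * cabs (mu_product z n d a w))).
    by rewrite ler_wpM2r ?cabs_ge0// ge_min lexx orbT.
  have := ge_cabsB (mu_product z n d a w) (-1); rewrite opprK cabsN cabs1; lra.
have E1 : 0 < cabs (mu_product z n d a w + 1).
  have [g [ga gc gd]] := admissible_SL2Z n0 adm.
  have := @mu_product_succ R z g w n 1; rewrite !mul1r => /(_ erefl gc).
  rewrite ga gd mulr1 => <-; rewrite cabs_gt0 mulf_neq0//.
  by rewrite pnatr_eq0 -lt0n.
have n1 : (1 : R) <= n%:R by rewrite ler1n.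
have h1 : complex.Im z <= cabs (n%:R * z + d%:~R).
  apply: le_trans (cabs_shift_ge z n d); rewrite gtr0_norm// ler_peMl// ltW//.
have h2 : y <= cabs (n%:R * w - a%:~R).
  have := cabs_shift_ge w n (- a); rewrite intrN; apply: le_trans.
  by rewrite -/y; apply: ler_peMl => //; apply: ltW.
have nN : n%:R <= 2 / (complex.Im z * y).
  rewrite ler_pdivlMr ?mulr_gt0//.
  apply: le_trans (ltW q2); apply: le_trans (cabs_mu_product_ge w n d a).
  apply: ler_wpM2r; first by apply: ltW; rewrite mulr_gt0.
  by rewrite expr2; apply: ler_peMl.
have m1 : cabs (n%:R * z + d%:~R) <= 2 / y.
  rewrite ler_pdivlMr//; apply: le_trans (ltW q2); rewrite /mu_product cabsM.
  by rewrite ler_wpM2l ?cabs_ge0.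
have m2 : cabs (n%:R * w - a%:~R) <= 2 / complex.Im z.
  rewrite ler_pdivlMr// mulrC; apply: le_trans (ltW q2); rewrite /mu_product cabsM.
  by rewrite ler_wpM2r ?cabs_ge0.
have bd (u v : C) (i : int) : cabs (n%:R * u + i%:~R) <= cabs v ->
    `|i%:~R| <= cabs v + n%:R * cabs u :> R.
  move=> h; rewrite -cabs_real rmorph_int.
  have -> : i%:~R = (n%:R * u + i%:~R) - n%:R * u :> C by ring.
  by apply: le_trans (cabsB _ _) _; rewrite [cabs (n%:R * u)]cabsM cabs_nat; apply: lerD.
have nz : n%:R * cabs z <= 2 / (complex.Im z * y) * cabs z by rewrite ler_wpM2r ?cabs_ge0.
have nw : n%:R * cabs w <= 2 / (complex.Im z * y) * cabs w by rewrite ler_wpM2r ?cabs_ge0.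
have p1 : 0 < 2 / (complex.Im z * y) by rewrite divr_gt0// mulr_gt0.
have p2 : 0 < 2 / y by rewrite divr_gt0.
have p3 : 0 < 2 / complex.Im z by rewrite divr_gt0.
have p4 : 0 <= 2 / (complex.Im z * y) * cabs z by rewrite mulr_ge0 ?cabs_ge0// ltW.
have p5 : 0 <= 2 / (complex.Im z * y) * cabs w by rewrite mulr_ge0 ?cabs_ge0// ltW.
rewrite mulrDr in hN.
have dN : `|d%:~R| <= N%:R :> R.
  have := bd z (2 / y)%:C%C d; rewrite cabs_real gtr0_norm// => /(_ m1).
  lra.
have aN : `|a%:~R| <= N%:R :> R.
  have := bd w (2 / complex.Im z)%:C%C (- a); rewrite cabs_real gtr0_norm//.
  rewrite !intrN normrN => /(_ m2).
  lra.
have inb : (n, d, a) \in box.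
  apply/allpairsP; exists ((n, d), a); split => //; last exact: in_rng.
  apply/allpairsP; exists (n, d); split => //; last exact: in_rng.
  rewrite mem_iota /= add0n ltnS -(ler_nat R); lra.
have := hk _ inb; rewrite /f /= divr_gt0// => /(_ isT).
rewrite ler_pdivlMr//; apply: le_trans; rewrite ler_wpM2r ?cabs_ge0//.
by rewrite ge_min lexx.
Qed.

Definition d_profile s (x : R) : C := Pf ((x%:C%C + z) * (x%:C%C + z)) s.
Definition a_profile s (x : R) : C := Pf ((x%:C%C + - t) * (x%:C%C + - t^*)) s.

(** The product of the two factors is a product of one function of [d / n], one of
[a / n], and a perturbation of size [1 + O(1 / n ^ 2)]. *)
Lemma admissible_term_factor n d a s : (0 < n)%N ->
  admissible_term n d a s = Pf (n%:R ^+ 2) s * (d_profile s (d%:~R / n%:R) * a_profile s (a%:~R / n%:R)) *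
    Pf ((1 + (mu_product z n d a t)^-1) * (1 + (mu_product z n d a t^*)^-1)) s.
Proof.
move=> n0; have nz : n%:R != 0 :> C by rewrite pnatr_eq0 -lt0n.
have nE w : complex.Im w != 0 -> mu_product z n d a w != 0.
  move=> w0; rewrite -cabs_gt0; apply: lt_le_trans (cabs_mu_product_ge w n d a).
  by rewrite mulr_gt0 ?exprn_gt0 ?ltr0n// mulr_gt0 ?normr_gt0.
have E1 : mu_product z n d a t != 0 by apply: nE; rewrite gt_eqF.
have E2 : mu_product z n d a t^* != 0 by apply: nE; case: (t) t0 => x y /= y0; rewrite oppr_eq0 gt_eqF.
rewrite /admissible_term /d_profile /a_profile -!PfM; congr Pf.
have F1 : 1 + (mu_product z n d a t)^-1 = (mu_product z n d a t + 1) / mu_product z n d a t by field.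
have F2 : 1 + (mu_product z n d a t^*)^-1 = (mu_product z n d a t^* + 1) / mu_product z n d a t^* by field.
have dn (i : int) : (i%:~R / n%:R : R)%:C%C = i%:~R / n%:R :> C.
  by rewrite rmorphM fmorphV rmorph_int rmorph_nat.
rewrite F1 F2 !dn; move: E1 E2; rewrite /mu_product.
move: (n%:R : C) nz => m m0; move: (t^*) => t'.
rewrite !mulf_eq0 !negb_or => /andP[h1 h2] /andP[_ h3].
by field; rewrite m0 h1 h2 h3.
Qed.

Lemma Im_conj_neq0 : complex.Im t^* != 0.
Proof. by case: (t) t0 => x y /= y0; rewrite oppr_eq0 gt_eqF. Qed.

(** The first estimate dominates the series, the second one isolates its main term.
Both follow from [admissible_term_factor], the last factor there being within
[O(1 / n ^ 2)] of 1 by [Pf_lipschitz]. *)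
Lemma admissible_term_bound (b : R) : 0 <= b -> exists2 K : R, 0 <= K & forall s, region b s ->
  [/\ profile K (d_profile s), profile K (a_profile s) &
   forall n d a, (0 < n)%N -> admissible n d a ->
    cabs (admissible_term n d a s) <= K * cabs (Pf (n%:R ^+ 2) s) * (W (d%:~R / n%:R) * W (a%:~R / n%:R)) /\
    cabs (admissible_term n d a s - Pf (n%:R ^+ 2) s * (d_profile s (d%:~R / n%:R) * a_profile s (a%:~R / n%:R))) <=
      K * cabs (Pf (n%:R ^+ 2) s) * (W (d%:~R / n%:R) * W (a%:~R / n%:R)) / n%:R ^+ 2].
Proof.
move=> b0.
have tn : complex.Im t != 0 by rewrite gt_eqF.
have zn : complex.Im z != 0 by rewrite gt_eqF.
have [K1 hK1] := Pf_profile zn zn b0.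
have Nt : complex.Im (- t) != 0 by rewrite raddfN oppr_eq0.
have Nt' : complex.Im (- t^*) != 0 by rewrite raddfN oppr_eq0 Im_conj_neq0.
have [K2 hK2] := Pf_profile Nt Nt' b0.
have [k1 [k10 k11 h1]] := mu_product_succ_lower tn (mu_neq0 z0 zt).
have [k2 [k20 k21 h2]] := mu_product_succ_lower Im_conj_neq0 (mu_conj_neq0 z0 t0).
pose y := complex.Im z * complex.Im t; have y0 : 0 < y by rewrite mulr_gt0.
pose m := 1 + y^-1; have iy : 0 < y^-1 by rewrite invr_gt0.
have m1 : 1 <= m by rewrite lerDl ltW.
pose k := Num.min (k1 * k2) (m * m)^-1.
have k0 : 0 < k by rewrite lt_min mulr_gt0// invr_gt0 mulr_gt0// (lt_le_trans ltr01).
have kl : k <= 1 by rewrite ge_min mulr_ile1// ltW.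
have [L L0 hL] := Pf_lipschitz k0 kl b0.
pose Q := L * (y^-1 * (m + 1)).
have m0 : 0 < m := lt_le_trans ltr01 m1.
have Q0 : 0 <= Q by rewrite !mulr_ge0// ?(ltW iy)// addr_ge0// ltW.
pose K : R := `|K1| + `|K2| + `|K1| * `|K2| * (1 + Q).
exists K.
  by rewrite !addr_ge0 ?mulr_ge0// addr_ge0.
have [a1 a2] : 0 <= `|K1| /\ 0 <= `|K2| by split.
have a3 : 0 <= `|K1| * `|K2| * (1 + Q) by rewrite !mulr_ge0// addr_ge0.
move=> s rs; have [_ sb] := rs.
have up K' f : K' <= K -> profile K' f -> profile K f.
  move=> KK [p1 p2]; split=> [x|x x' xx].
    by apply: le_trans (p1 x) _; rewrite ler_wpM2r// ltW// W_gt0.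
  apply: le_trans (p2 x x' xx) _; rewrite ler_wpM2r// ?(ltW (W_gt0 _))//.
  by rewrite ler_wpM2r.
have pG := hK1 s rs; have pK := hK2 s rs.
split.
- by apply: up pG; rewrite (le_trans (ler_norm K1))// /K -addrA lerDl addr_ge0.
- by apply: up pK; rewrite (le_trans (ler_norm K2))// /K addrAC lerDr addr_ge0.
move=> n d a n0 adm.
set P := cabs (Pf _ s); have P0 : 0 <= P := cabs_ge0 _.
set x := d%:~R / n%:R; set x' := a%:~R / n%:R.
have WW : 0 <= W x * W x' by rewrite mulr_ge0// ltW// W_gt0.
have n1 : (1 : R) <= n%:R by rewrite ler1n.
have n2 : (1 : R) <= n%:R ^+ 2 by rewrite exprn_ege1.
have n2p : (0 : R) < n%:R ^+ 2 := lt_le_trans ltr01 n2.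
set T0 := Pf _ s * (_ * _).
have T0b : cabs T0 <= P * (`|K1| * `|K2| * (W x * W x')).
  rewrite /T0 cabsM [cabs (d_profile _ _ * _)]cabsM -/P.
  apply: ler_wpM2l => //; rewrite [leRHS]mulrACA.
  apply: ler_pM; rewrite ?cabs_ge0//.
    by have [+ _] := pG; move=> /(_ x) h; apply: le_trans h _; rewrite ler_wpM2r ?ler_norm// ltW// W_gt0.
  by have [+ _] := pK; move=> /(_ x') h; apply: le_trans h _; rewrite ler_wpM2r ?ler_norm// ltW// W_gt0.
(* both factors [1 + 1 / mu_product] lie in the annulus, at distance at most [1 / (y n ^ 2)] from 1 *)
have fac w (k' : R) : `|complex.Im w| = complex.Im t -> 0 < k' ->
    k' * cabs (mu_product z n d a w) <= cabs (mu_product z n d a w + 1) ->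
    [/\ cabs (1 + (mu_product z n d a w)^-1 - 1) <= y^-1 / n%:R ^+ 2,
        cabs (1 + (mu_product z n d a w)^-1) <= m & k' <= cabs (1 + (mu_product z n d a w)^-1)].
  move=> wE k'0 hk'; have En := cabs_mu_product_ge w n d a; rewrite wE -/y in En.
  have E0 : 0 < cabs (mu_product z n d a w).
    by apply: lt_le_trans En; rewrite mulr_gt0.
  have En0 : mu_product z n d a w != 0 by rewrite -cabs_gt0.
  have e1 : cabs (mu_product z n d a w)^-1 <= y^-1 / n%:R ^+ 2.
    by rewrite cabsV -invfM lef_pV2 ?posrE//; [rewrite mulrC|rewrite mulr_gt0].
  have e2 : y^-1 / n%:R ^+ 2 <= y^-1 by rewrite ler_pdivrMr ?ler_peMr// ltW.
  split.
  - by rewrite addrAC subrr add0r.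
  - by apply: le_trans (cabsD _ _) _; rewrite cabs1 /m lerD2l; apply: le_trans e2.
  - have -> : 1 + (mu_product z n d a w)^-1 = (mu_product z n d a w + 1) / mu_product z n d a w by field.
    by rewrite cabsM cabsV ler_pdivlMr.
have w1 : `|complex.Im t| = complex.Im t by rewrite gtr0_norm.
have w2 : `|complex.Im t^*| = complex.Im t.
  by case: (t) t0 => u v /= v0; rewrite normrN gtr0_norm.
have [p1 p2 p3] := fac t k1 w1 k10 (h1 n d a n0 adm).
have [q1 q2 q3] := fac t^* k2 w2 k20 (h2 n d a n0 adm).
set p := 1 + _ in p1 p2 p3; set q := 1 + _ in q1 q2 q3.
have D : cabs (Pf (p * q) s - 1) <= Q / n%:R ^+ 2.
  apply: le_trans (hL _ _ _ sb) _.
    rewrite cabsM; apply/andP; split.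
      by rewrite ge_min ler_pM// ltW.
    apply: (@le_trans _ _ (m * m)); first by rewrite ler_pM ?cabs_ge0.
    rewrite -[leLHS]invrK lef_pV2 ?posrE ?invr_gt0//; last by rewrite mulr_gt0.
    by rewrite ge_min lexx orbT.
  rewrite /Q -mulrA ler_wpM2l//.
  have -> : p * q - 1 = (p - 1) * q + (q - 1) by ring.
  apply: le_trans (cabsD _ _) _; rewrite cabsM mulrAC mulrDr mulr1; apply: lerD => //.
  by rewrite ler_pM ?cabs_ge0.
have Tf : admissible_term n d a s = T0 * Pf (p * q) s by rewrite admissible_term_factor.
have D1 : Q / n%:R ^+ 2 <= Q by rewrite ler_pdivrMr ?ler_peMr.
have i0 : 0 < (n%:R ^+ 2)^-1 :> R by rewrite invr_gt0.
split.
- have -> : admissible_term n d a s = T0 * (1 + (Pf (p * q) s - 1)) by rewrite Tf; ring.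
  rewrite cabsM; apply: (@le_trans _ _ (P * (`|K1| * `|K2| * (W x * W x')) * (1 + Q))).
    apply: ler_pM; rewrite ?cabs_ge0//.
    by apply: le_trans (cabsD _ _) _; rewrite cabs1 lerD2l; apply: le_trans D1.
  have -> : P * (`|K1| * `|K2| * (W x * W x')) * (1 + Q) =
    `|K1| * `|K2| * (1 + Q) * P * (W x * W x') by ring.
  by rewrite ler_wpM2r// ler_wpM2r// /K lerDr addr_ge0.
- have -> : admissible_term n d a s - T0 = T0 * (Pf (p * q) s - 1) by rewrite Tf; ring.
  rewrite cabsM; apply: (@le_trans _ _ (P * (`|K1| * `|K2| * (W x * W x')) * (Q / n%:R ^+ 2))).
    by apply: ler_pM; rewrite ?cabs_ge0.
  have -> : P * (`|K1| * `|K2| * (W x * W x')) * (Q / n%:R ^+ 2) =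
    `|K1| * `|K2| * Q * P * (W x * W x') / n%:R ^+ 2 by ring.
  rewrite ler_wpM2r ?(ltW i0)// ler_wpM2r// ler_wpM2r//.
  have : `|K1| * `|K2| * Q <= `|K1| * `|K2| * (1 + Q).
    by rewrite ler_wpM2l ?mulr_ge0// lerDr.
  by move=> h; rewrite (le_trans h)// /K lerDr addr_ge0.
Qed.

End TermEstimates.

(** * Grouping the series by the lower left entry *)

Section SumsOverSL2Z.
Variable R : realType.
Local Notation C := R[i].
Variables z t : C.
Hypothesis z0 : 0 < complex.Im z.
Hypothesis t0 : 0 < complex.Im t.
Hypothesis zt : forall g : SL2Z, t <> moebius g z.

Local Notation T g s := (Xi_term 1 z t s g).
Implicit Types (s : C) (g : SL2Z).

Lemma int_inverse_cases (a d : int) : a * d = 1 -> (a = 1 /\ d = 1) \/ (a = -1 /\ d = -1).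
Proof.
move=> D; have : (absz a * absz d == 1)%N by rewrite -abszM D.
rewrite muln_eq1 => /andP[/eqP ha /eqP hd].
have [Ea|Ea] : a = 1 \/ a = -1 by lia.
  by left; split => //; move: D; rewrite Ea mul1r.
by right; split => //; move: D; rewrite Ea mulN1r => <-; rewrite opprK.
Qed.

Definition level_index (g : SL2Z) : nat := absz (val g 1 0).

Definition level n s : C := tsum (fun g => if level_index g == n then T g s else 0).

Definition pair_sum n s : C :=
  tsum (fun q : int * int => if admissible n q.1 q.2 then admissible_term z t n q.1 q.2 s else 0).

Lemma cabs_Pf_sqr_le1 n (s : C) : (0 < n)%N -> 7 / 8 <= complex.Re s ->
  cabs (Pf (n%:R ^+ 2) s) <= 1.
Proof.
move=> n0 s1; have n1 : (1 : R) <= n%:R by rewrite ler1n.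
have nz : n%:R ^+ 2 != 0 :> C by rewrite expf_neq0// pnatr_eq0 -lt0n.
rewrite cabs_Pf// cabsX cabs_nat.
rewrite -[leRHS](powRr0 (n%:R ^+ 2)); apply: ler_powR; last lra.
by rewrite exprn_ege1.
Qed.

Lemma pair_term_le (b : R) : 0 <= b -> exists2 K : R, 0 <= K & forall s n (q : int * int),
  region b s -> (0 < n)%N ->
  cabs (if admissible n q.1 q.2 then admissible_term z t n q.1 q.2 s else 0) <=
    K * (W (q.1%:~R / n%:R) * W (q.2%:~R / n%:R)).
Proof.
move=> b0; have [K K0 hK] := admissible_term_bound z0 t0 zt b0; exists K => // s n q rs n0.
have [_ _ h] := hK s rs.
have WW : 0 <= W (q.1%:~R / n%:R : R) * W (q.2%:~R / n%:R : R) by rewrite mulr_ge0// ltW// W_gt0.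
case: ifP => [adm|_]; last by rewrite cabs0 mulr_ge0.
have [h1 _] := h n _ _ n0 adm; apply: le_trans h1 _.
rewrite ler_wpM2r// ler_piMr//; case: rs => r1 _; exact: cabs_Pf_sqr_le1.
Qed.

Lemma W_pair_sum n : (0 < n)%N -> sum_le (fun q : int * int =>
  W (q.1%:~R / n%:R : R) * W (q.2%:~R / n%:R : R)) (5 * n%:R * (5 * n%:R)).
Proof.
move=> n0; apply: (@sum_le_prod _ _ _ (fun d : int => W (d%:~R / n%:R))
  (fun d : int => W (d%:~R / n%:R))).
- by move=> i; apply/ltW/W_gt0.
- by move=> i; apply/ltW/W_gt0.
- exact: W_sum_int.
- exact: W_sum_int.
Qed.

Lemma pair_summable (b : R) n s : 0 <= b -> region b s -> (0 < n)%N ->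
  abs_summable (fun q : int * int => if admissible n q.1 q.2 then admissible_term z t n q.1 q.2 s else 0).
Proof.
move=> b0 rs n0; have [K K0 hK] := pair_term_le b0.
exists (K * (5 * n%:R * (5 * n%:R))).
by apply: sum_le_le (sum_leZ K0 (W_pair_sum n0)) => q; apply: hK.
Qed.

Lemma uholo_pair_sum (b : R) (B : C -> Prop) n : 0 <= b -> cbounded B ->
  (forall s, B s -> region b s) -> (0 < n)%N -> uholo B (pair_sum n).
Proof.
move=> b0 bB rB n0; have [K K0 hK] := pair_term_le b0.
apply: (uholo_tsum _ _ _ (sum_leZ K0 (W_pair_sum n0))).
- move=> q; case: (admissible n q.1 q.2); last exact: uholo_cst.
  exact: uholo_Pf.
- by move=> q s /rB rs; apply: hK.
- by move=> q; rewrite !mulr_ge0// ltW// W_gt0.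
Qed.

Lemma admissible_entries (n : nat) (e : int) g : e * e = 1 -> val g 1 0 = e * n%:Z ->
  admissible n (e * val g 1 1) (e * val g 0 0).
Proof.
move=> e2 hc; have D := SL2Z_det g; rewrite hc in D.
apply/dvdzP; exists (e * val g 0 1).
have -> : e * val g 0 0 * (e * val g 1 1) = e * e * (val g 0 0 * val g 1 1) by ring.
move: D; rewrite e2 mul1r.
move: (val g 0 0) (val g 1 1) (val g 0 1) => a d b' D.
by rewrite -[X in _ - X]D; ring.
Qed.

(** The two halves [c = n] and [c = - n] of a level are each in bijection with the
pairs [(d, a)] satisfying [a d = 1] modulo [n]. *)
Lemma signed_level (b : R) (n : nat) (e : int) s : 0 <= b -> region b s -> (0 < n)%N ->
  e * e = 1 ->
  abs_summable (fun g : SL2Z => if val g 1 0 == e * n%:Z then T g s else 0) /\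
  tsum (fun g : SL2Z => if val g 1 0 == e * n%:Z then T g s else 0) = pair_sum n s.
Proof.
move=> b0 rs n0 e2.
have e1 : e = 1 \/ e = -1 by have [[? _]|[? _]] := int_inverse_cases e2; [left|right].
pose h (g : SL2Z) := (e * val g 1 1, e * val g 0 0).
pose f' (q : int * int) := if admissible n q.1 q.2 then admissible_term z t n q.1 q.2 s else 0.
pose f (g : SL2Z) := if val g 1 0 == e * n%:Z then T g s else 0.
have fE g : val g 1 0 = e * n%:Z -> T g s = f' (h g).
  move=> hc; have c0 : val g 1 0 != 0 by rewrite hc; case: e1 => ->; lia.
  have adm := admissible_entries e2 hc.
  rewrite /f' /h /= adm (Xi_term_admissible z0 t0 s c0).
  have -> : sgz (val g 1 0) = e by rewrite hc; case: e1 => ->; lia.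
  by have -> : absz (val g 1 0) = n by rewrite hc; case: e1 => ->; lia.
have inj (g g' : SL2Z) : val g 1 0 = e * n%:Z -> val g' 1 0 = e * n%:Z ->
    h g = h g' -> g = g'.
  move=> hc hc' hE.
  have e0 : e != 0 by case: e1 => ->.
  have hd : e * val g 1 1 = e * val g' 1 1 := congr1 fst hE.
  have ha : e * val g 0 0 = e * val g' 0 0 := congr1 snd hE. have D := SL2Z_det g; have D' := SL2Z_det g'.
  have hd' : val g 1 1 = val g' 1 1 := mulfI e0 hd.
  have ha' : val g 0 0 = val g' 0 0 := mulfI e0 ha.
  have hb : val g 0 1 = val g' 0 1.
    move: D D'; rewrite hc hc' hd' ha'; case: e1 => ->; nia.
  by apply: SL2Z_eq => i j; case: (ord2P i) => ->; case: (ord2P j) => ->; rewrite ?hc ?hc'.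
have fz g : f g != 0 -> val g 1 0 = e * n%:Z 
  by rewrite /f; case: (val g 1 0 =P e * n%:Z) => //; rewrite eqxx.
have sf' : abs_summable f' := pair_summable b0 rs n0.
have sf : abs_summable f.
  have [M hM] := sf'; exists M.
  apply: (sum_le_inj (h := h) _ _ (fun=> cabs_ge0 _) hM) => [g g'|g].
    by rewrite !cabs_eq0 => /fz hc /fz hc'; apply: inj.
  by rewrite /f; case: eqP => [/fE ->//|_]; rewrite cabs0 cabs_ge0.
split => //; apply: (tsum_transfer (h := h) sf).
- by move=> g /fz hc; rewrite -/(f g) /f hc eqxx; apply: fE.
- by move=> g g' /fz hc /fz hc'; apply: inj.
move=> [d a] fq; have adm : admissible n d a by move: fq; rewrite /=; case: ifP => //; rewrite eqxx.
have /dvdzP[b' hb'] := adm.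
have [|g [ga gb gc gd]] := @SL2Z_exists (e * a) (e * b') (e * n%:Z) (e * d).
  have -> : e * a * (e * d) - e * b' * (e * n%:Z) = e * e * (a * d - b' * n%:Z) by ring.
  by rewrite e2 mul1r -hb'; ring.
have hg : h g = (d, a) by rewrite /h ga gd !mulrA e2 !mul1r.
by exists g => //; rewrite /f gc eqxx (fE g gc) hg.
Qed.

Lemma level_pair_sum (b : R) n s : 0 <= b -> region b s -> (0 < n)%N ->
  level n s = 2 * pair_sum n s.
Proof.
move=> b0 rs n0.
have [s1 t1] := @signed_level b n 1 s b0 rs n0 (mulr1 _).
have [|s2 t2] := @signed_level b n (-1) s b0 rs n0; first by rewrite mulrNN mulr1.
rewrite mulr_natl mulr2n -{1}t1 -t2 -tsumD//; apply: eq_tsum => g.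
rewrite /level_index mul1r mulN1r; case: (val g 1 0 =P n%:Z) => [->|h1].
  by rewrite absz_nat eqxx; case: eqP => [E|_]; [lia|rewrite addr0].
case: (val g 1 0 =P - n%:Z) => [->|h2]; first by rewrite add0r abszN absz_nat eqxx.
rewrite addr0; case: (absz (val g 1 0) =P n) => // E.
move: E h1 h2; move: (val g 1 0 : int) => k E h1 h2; exfalso; lia.
Qed.

(** Large integers are far from [- w], and the finitely many others are at a positive
distance from it. *)
Lemma integer_lower (w : C) : (forall m : int, m%:~R + w != 0) ->
  exists k : R, [/\ 0 < k, k <= 1 & forall m : int, k * (1 + `|m%:~R|) <= cabs (m%:~R + w)].
Proof.
move=> hw; pose N := (Num.truncn (2 * cabs w)).+1.
have hN : 2 * cabs w < N%:R by apply: truncnS_gt.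
pose rng : seq int := [seq i%:Z - N%:Z | i <- iota 0 (2 * N).+1].
pose f (m : int) : R := cabs (m%:~R + w) / (1 + `|m%:~R|).
have [k k0 hk] := finite_positive_min rng f.
have den (m : int) : 0 < 1 + `|m%:~R| :> R by rewrite ltr_wpDr.
exists (Num.min k 4^-1); split.
- by rewrite lt_min k0 invr_gt0 ltr0n.
- by rewrite ge_min invf_le1// ler1n orbT.
move=> m; have [mN|mN] := leP `|m| N%:Z.
  have mr : m \in rng.
    apply/seq.mapP; exists (absz (m + N%:Z)); first by rewrite mem_iota; lia.
    lia.
  have := hk m mr; rewrite /f divr_gt0 ?cabs_gt0// => /(_ isT).
  rewrite ler_pdivlMr//; apply: le_trans; rewrite ler_wpM2r ?(ltW (den m))//.
  by rewrite ge_min lexx.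
have mN' : N%:R <= `|m%:~R| :> R.
  by have := ltW mN; rewrite -(ler_int R) intr_norm -pmulrn.
have N1 : (1 : R) <= N%:R by rewrite ler1n.
apply: (@le_trans _ _ (4^-1 * (1 + `|m%:~R|))).
  by rewrite ler_wpM2r ?(ltW (den m))// ge_min lexx orbT.
have := ge_cabsB m%:~R (- w); rewrite opprK cabsN -(rmorph_int (real_complex R)) cabs_real.
lra.
Qed.

(** If [c = 0] the matrix is a translation up to sign, and the values of [mu] are, up
to sign, [t - z] and [conj t - z] shifted by one and the same integer. *)
Lemma level0_term_le (b : R) : 0 <= b -> exists2 K : R, 0 <= K & forall s g,
  region b s -> val g 1 0 = 0 -> cabs (T g s) <= K * W ((val g 0 1)%:~R : R).
Proof.
move=> b0.
have entries g : val g 1 0 = 0 -> exists e : int, [/\ e * e = 1, val g 0 0 = e & val g 1 1 = e].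
  move=> gc; have := SL2Z_det g; rewrite gc mulr0 subr0 => D.
  by exists (val g 0 0); case: (int_inverse_cases D) => -[-> ->].
have muE g w e : e * e = 1 -> val g 1 0 = 0 -> val g 0 0 = e -> val g 1 1 = e ->
    mu g z w = e%:~R * ((- (e * val g 0 1))%:~R + (w - z)).
  move=> e2 gc ga gd; rewrite /mu /entry gc ga gd intrN intrM.
  have e2' : e%:~R * e%:~R = 1 :> C by rewrite -intrM e2.
  by rewrite mulrDr mulrN mulrA e2' mul1r; ring.
have [k1 [k10 k11 h1]] : exists k : R, [/\ 0 < k, k <= 1 &
    forall m : int, k * (1 + `|m%:~R|) <= cabs (m%:~R + (t - z))].
  apply: integer_lower => m.
  have [|g [ga gb gc gd]] := @SL2Z_exists 1 (- m) 0 1; first by ring.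
  have := mu_neq0 z0 zt g; rewrite (muE g t 1)// gb mul1r opprK.
  by rewrite mul1r.
have It : complex.Im (t^* - z) != 0.
  have -> : complex.Im (t^* - z) = - complex.Im t - complex.Im z by case: (t) (z) => [u v] [x y].
  by apply: ltr0_neq0; rewrite -opprD oppr_lt0 addr_gt0.
have [k2 [k20 k21 h2]] := nonreal_lower It.
pose k := Num.min k1 k2.
have k0 : 0 < k by rewrite lt_min k10.
have kl : k <= 1 by rewrite ge_min k11.
exists (k `^ (- (4 * b))); first exact: powR_ge0.
move=> s g rs gc; have [e [e2 ga gd]] := entries g gc.
have e1 : e = 1 \/ e = -1 by have [[? _]|[? _]] := int_inverse_cases e2; [left|right].
have ne : `|(- (e * val g 0 1))%:~R| = `|(val g 0 1)%:~R| :> R.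
  by case: e1 => ->; rewrite ?mul1r ?mulN1r ?opprK ?intrN ?normrN.
have ce : cabs (e%:~R : C) = 1.
  by case: e1 => ->; rewrite ?intrN ?cabsN cabs1.
rewrite Xi_term1; apply: (Pf_size k0 kl rs).
- rewrite (muE g t e)// cabsM ce mul1r -ne.
  by apply: le_trans (h1 _); rewrite ler_wpM2r ?addr_ge0// ge_min lexx.
- rewrite (muE g t^* e)// cabsM ce mul1r -ne.
  rewrite -[in leRHS](rmorph_int (real_complex R)).
  by apply: le_trans (h2 _); rewrite ler_wpM2r ?addr_ge0// ge_min lexx orbT.
Qed.

Lemma level0_majorant : exists M,
  sum_le (fun g : SL2Z => if val g 1 0 == 0 then W ((val g 0 1)%:~R : R) else 0) M.
Proof.
pose h (g : SL2Z) : bool * int := (val g 0 0 == 1, val g 0 1).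
have u : sum_le (fun _ : bool => 1 : R) 2.
  move=> B; rewrite (_ : \sum_(i <- B) 1 = (size B)%:R); last first.
    by rewrite -sum1_size natr_sum.
  rewrite ler_nat -[2%N]card_bool cardE.
  by apply: uniq_leq_size (fset_uniq B) _ => i _; rewrite mem_enum.
have w := W_sum_int R (ltn0Sn 0).
have H := sum_le_prod (fun=> ler01) (fun d : int => ltW (W_gt0 _)) u w.
exists (2 * (5 * 1%:R)).
apply: (sum_le_inj (h := h) _ _ _ H) => [g g'|g|q].
- have [gc|//] := eqVneq (val g 1 0) 0; last by rewrite eqxx.
  have [gc' _ _|//] := eqVneq (val g' 1 0) 0; last by rewrite eqxx.
  move=> [ha hb]; have D := SL2Z_det g; have D' := SL2Z_det g'.
  rewrite gc mulr0 subr0 in D; rewrite gc' mulr0 subr0 in D'.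
  have a1 := int_inverse_cases D; have a1' := int_inverse_cases D'.
  have [ga gd] : val g 0 0 = val g' 0 0 /\ val g 1 1 = val g' 1 1.
    by case: a1 ha => -[-> ->]; case: a1' => -[-> ->].
  by apply: SL2Z_eq => i j; case: (ord2P i) => ->; case: (ord2P j) => ->; rewrite ?gc ?gc'.
- by case: eqP => _; rewrite /= mul1r ?divr1// ltW// W_gt0.
- by rewrite mul1r ltW// W_gt0.
Qed.

Lemma uholo_level0 (b : R) (B : C -> Prop) : 0 <= b -> cbounded B ->
  (forall s, B s -> region b s) -> uholo B (level 0).
Proof.
move=> b0 bB rB; have [K K0 hK] := level0_term_le b0; have [M hM] := level0_majorant.
apply: (uholo_tsum _ _ _ (sum_leZ K0 hM)).
- move=> g; case: (level_index g == 0%N); last exact: uholo_cst.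
  by apply: uholo_eq (uholo_Pf _ bB) => s _; rewrite Xi_term1.
- move=> g s /rB rs; rewrite /level_index absz_eq0.
  by case: eqP => [gc|_]; [apply: hK|rewrite cabs0 mulr0].
- by move=> g; rewrite mulr_ge0//; case: eqP => // _; rewrite ltW// W_gt0.
Qed.

End SumsOverSL2Z.

(** * Absolute convergence in the half-plane *)

Section AbsoluteConvergence.
Variable R : realType.
Local Notation C := R[i].
Variables z t : C.
Hypothesis z0 : 0 < complex.Im z.
Hypothesis t0 : 0 < complex.Im t.
Hypothesis zt : forall g : SL2Z, t <> moebius g z.

Local Notation T g s := (Xi_term 1 z t s g).
Implicit Types (s : C) (g : SL2Z).

Lemma W_even (x : R) : W (- x) = W x.
Proof. by rewrite /W normrN. Qed.

Lemma cabs_Pf_sqr n s : (0 < n)%N ->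
  cabs (Pf (n%:R ^+ 2) s) = n%:R `^ (2 - 4 * complex.Re s).
Proof.
move=> n0; have nz : n%:R ^+ 2 != 0 :> C by rewrite expf_neq0// pnatr_eq0 -lt0n.
rewrite cabs_Pf// cabsX cabs_nat -powR_mulrn// -powRrM.
by congr (_ `^ _); ring.
Qed.

Definition main_majorant (K sig : R) (g : SL2Z) : R :=
  if val g 1 0 == 0 then 0 else
  K * (absz (val g 1 0))%:R `^ (2 - 4 * sig) *
  (W ((val g 1 1)%:~R / (absz (val g 1 0))%:R) * W ((val g 0 0)%:~R / (absz (val g 1 0))%:R)).

Lemma main_term_le (b : R) : 0 <= b -> exists2 K : R, 0 <= K & forall sig s g,
  region b s -> sig <= complex.Re s -> val g 1 0 != 0 ->
  cabs (T g s) <= main_majorant K sig g.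
Proof.
move=> b0; have [K K0 hK] := admissible_term_bound z0 t0 zt b0; exists K => // sig s g rs ss c0.
have [_ _ h] := hK s rs.
rewrite /main_majorant (negbTE c0) (Xi_term_admissible z0 t0 s c0).
set e := sgz _; set n := absz _.
have n0 : (0 < n)%N by rewrite /n absz_gt0.
have e2 : e * e = 1 by rewrite /e; case: sgzP c0.
have hc : val g 1 0 = e * n%:Z by rewrite /e /n; case: sgzP c0 => // hh _; lia.
have [h1 _] := h n _ _ n0 (admissible_entries e2 hc).
apply: le_trans h1 _.
have e1 : e = 1 \/ e = -1 by rewrite /e; case: sgzP c0; [|left|right].
have We (x : int) : W ((e * x)%:~R / n%:R : R) = W (x%:~R / n%:R).
  by case: e1 => ->; rewrite ?mul1r// mulN1r intrN mulNr W_even.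
rewrite !We ler_wpM2r ?mulr_ge0 ?(ltW (W_gt0 _))//.
rewrite ler_wpM2l// cabs_Pf_sqr//.
by apply: ler_powR; [rewrite ler1n|lra].
Qed.

(** For fixed [c] and [d], the entry [a] is confined to one class modulo [c], so it
is determined by its quotient by [c]. *)
Lemma quotient_determines g g' : val g 1 0 = val g' 1 0 -> val g 1 1 = val g' 1 1 ->
  val g 1 0 != 0 ->
  divz (val g 0 0) (absz (val g 1 0)) = divz (val g' 0 0) (absz (val g 1 0)) -> g = g'.
Proof.
move=> hc hd c0 hq; have D := SL2Z_det g; have D' := SL2Z_det g'.
have ha : val g 0 0 = val g' 0 0.
  rewrite -hc -hd in D'; move: D D' hq c0.
  move: (val g 0 0) (val g' 0 0) (val g 0 1) (val g' 0 1) (val g 1 0) (val g 1 1).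
  move=> a a' u u' c d D D' hq c0.
  have cd : (c %| a - a')%Z.
    apply/dvdzP; exists (a * (u - u') - (a - a') * u).
    transitivity ((a - a') * (a * d - u * c)); first by rewrite D mulr1.
    have E1 : d * (a - a') = (u - u') * c.
      have -> : d * (a - a') = (a * d - u * c) - (a' * d - u' * c) + (u - u') * c by ring.
      by rewrite D D' subrr add0r.
    have -> : (a - a') * (a * d - u * c) = a * (d * (a - a')) - (a - a') * u * c by ring.
    by rewrite E1; ring.
  have md : (a = a' %[mod (absz c)%:Z])%Z.
    by apply/eqP; rewrite eqz_mod_dvd dvdzE absz_nat; move: cd; rewrite dvdzE.
  by rewrite (divz_eq a (absz c)%:Z) md hq -divz_eq.
have hb : val g 0 1 = val g' 0 1.
  move: D D' c0; rewrite -ha -hc -hd.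
  move: (val g 0 0) (val g 0 1) (val g' 0 1) (val g 1 0) (val g 1 1) => a u u' c d D D' c0.
  apply: (mulIf c0); have -> : u * c = a * d - (a * d - u * c) by ring.
  by rewrite D -D'; ring.
by apply: SL2Z_eq => i j; case: (ord2P i) => ->; case: (ord2P j) => ->.
Qed.

Lemma W_quotient_le (a : int) (n : nat) : (0 < n)%N ->
  W (a%:~R / n%:R : R) <= 8 * W ((a %/ n%:Z)%Z%:~R).
Proof.
move=> n0; apply: W_slow; have n0' : (0 : R) < n%:R by rewrite ltr0n.
have E : a%:~R = (a %/ n%:Z)%Z%:~R * n%:R + (a %% n%:Z)%Z%:~R :> R.
  by rewrite {1}(divz_eq a n%:Z) intrD intrM.
have r0 : 0 <= (a %% n%:Z)%Z%:~R :> R by rewrite ler0z modz_ge0//; lia.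
have r1 : (a %% n%:Z)%Z%:~R <= n%:R :> R.
  by rewrite pmulrn ler_int ltW// ltz_pmod//; lia.
set q := (a %/ n%:Z)%Z%:~R in E *; set r := (a %% n%:Z)%Z%:~R in E r0 r1.
have -> : a%:~R / n%:R = q + r / n%:R by rewrite E mulrDl mulfK// gt_eqF.
have x0 : 0 <= r / n%:R by rewrite divr_ge0.
have x1 : r / n%:R <= 1 by rewrite ler_pdivrMr// mul1r.
have : `|q| <= `|q + r / n%:R| + `|r / n%:R|.
  by rewrite -{1}(addrK (r / n%:R) q) ler_normB.
rewrite (ger0_norm x0); have := normr_ge0 (q + r / n%:R); lra.
Qed.

(** For given [c] the sum over [d] costs a factor [|c|] and, by [quotient_determines],
the sum over [a] only a constant; this leaves the series of [|c| ^ (3 - 4 sig)]. *)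
Lemma main_majorant_sum (K sig : R) : 0 <= K -> 1 < sig ->
  exists M, sum_le (main_majorant K sig) M.
Proof.
move=> K0 sg.
pose u (c : int) : R := if c == 0 then 0 else K * (absz c)%:R `^ (2 - 4 * sig).
have u0 c : 0 <= u c by rewrite /u; case: eqP => // _; rewrite mulr_ge0 ?powR_ge0.
pose F (c : int) (q : int * int) : R :=
  u c * (W (q.1%:~R / (absz c)%:R) * (8 * W (q.2%:~R / 1%:R))).
have F0 c q : 0 <= F c q by rewrite !mulr_ge0// ltW// W_gt0.
pose v (c : int) : R := u c * (5 * (absz c)%:R * (8 * (5 * 1%:R))).
have hF c : sum_le (F c) (v c).
  have [c0|c0] := eqVneq c 0.
    rewrite /v /u c0 eqxx mul0r => B; rewrite big1// => q _.
    by rewrite /F /u eqxx mul0r.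
  apply: sum_leZ => //.
  apply: (@sum_le_prod _ _ _ (fun d : int => W (d%:~R / (absz c)%:R)) (fun a : int => 8 * W (a%:~R / 1%:R))).
  - by move=> i; apply/ltW/W_gt0.
  - by move=> i; rewrite mulr_ge0// ltW// W_gt0.
  - by apply: W_sum_int; rewrite absz_gt0.
  - by apply: sum_leZ => //; apply: W_sum_int.
have h0 : 0 < 4 * sig - 4 by lra.
have K200 : 0 <= 200 * K := mulr_ge0 (ler0n _ 200) K0.
have P := sum_leZ K200 (pseries_sum_le h0).
have vE (n : nat) (c : int) : absz c = n.+1 -> v c = 200 * K * n.+1%:R `^ (- (1 + (4 * sig - 4))).
  move=> cn; rewrite /v /u; have -> : (c == 0) = false by apply/negbTE; rewrite -absz_eq0 cn.
  have x0 : (0 : R) < n.+1%:R by rewrite ltr0n.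
  have -> : - (1 + (4 * sig - 4)) = (2 - 4 * sig) + 1 by ring.
  rewrite cn [X in _ = _ * X]powRD ?(gt_eqF x0) ?implybT//.
  by rewrite [n.+1%:R `^ 1]powRr1 ?(ltW x0)//; ring.
have v0 c : 0 <= v c by rewrite !mulr_ge0.
have hv : exists N, sum_le v N.
  eexists; apply: sum_le_int v0 _ _.
  - apply: (sum_le_inj (h := predn) _ _ _ P) => [[|i] [|j]|[|n]|n] //=.
    + by rewrite /v /u eqxx mul0r eqxx.
    + by rewrite /v /u eqxx mul0r eqxx.
    + by move=> _ _ ->.
    + by rewrite /v /u eqxx mul0r; apply: mulr_ge0 K200 (powR_ge0 _ _).
    + by rewrite (vE n).
    + exact: mulr_ge0 K200 (powR_ge0 _ _).
  - by apply: sum_le_le P => n; rewrite (vE n)//; lia.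
have [N hN] := hv.
have H := sum_le_pair F0 hF hN.
exists N; pose h g : int * (int * int) :=
  (val g 1 0, (val g 1 1, divz (val g 0 0) (absz (val g 1 0)))).
apply: (sum_le_inj (h := h) _ _ _ H) => [g g'|g|q].
- have [c0|c0] := eqVneq (val g 1 0) 0; first by rewrite /main_majorant c0 eqxx eqxx.
  move=> _ _ hE.
  have hc : val g 1 0 = val g' 1 0 := congr1 fst hE.
  have hd : val g 1 1 = val g' 1 1 := congr1 (fun x => x.2.1) hE.
  have hq := congr1 (fun x => x.2.2) hE.
  by apply: quotient_determines => //; move: hq; rewrite /h /= -hc.
- rewrite /main_majorant /F /u /=; have [c0|c0] := eqVneq (val g 1 0) 0; first by rewrite mul0r.
  rewrite ler_wpM2l ?mulr_ge0 ?powR_ge0// ler_wpM2l ?(ltW (W_gt0 _))// divr1.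
  by apply: W_quotient_le; rewrite absz_gt0.
- exact: F0.
Qed.

Lemma Xi_majorant (b sig : R) : 0 <= b -> 1 < sig ->
  exists (bound : SL2Z -> R) (M : R), [/\ forall g, 0 <= bound g, sum_le bound M &
    forall s g, region b s -> sig <= complex.Re s -> cabs (T g s) <= bound g].
Proof.
move=> b0 sg; have [K1 K10 h1] := level0_term_le z0 t0 zt b0.
have [K2 K20 h2] := main_term_le b0.
have [M1 hM1] := level0_majorant z0 t0; have [M2 hM2] := main_majorant_sum K20 sg.
exists (fun g => K1 * (if val g 1 0 == 0 then W ((val g 0 1)%:~R : R) else 0) + main_majorant K2 sig g).
exists (K1 * M1 + M2).
have m0 g : 0 <= main_majorant K2 sig g.
  by rewrite /main_majorant; case: eqP => // _; rewrite !mulr_ge0 ?powR_ge0// ltW// W_gt0.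
have w0 g : 0 <= (if val g 1 0 == 0 then W ((val g 0 1)%:~R : R) else 0).
  by case: eqP => // _; rewrite ltW// W_gt0.
split.
- by move=> g; rewrite addr_ge0// mulr_ge0.
- exact: sum_leD (sum_leZ K10 hM1) hM2.
move=> s g rs ss; have [c0|c0] := eqVneq (val g 1 0) 0.
  by apply: le_trans (h1 s g rs c0) _; rewrite lerDl.
by apply: le_trans (h2 sig s g rs ss c0) _; rewrite mulr0 add0r.
Qed.

Lemma Xi_abs_summable s : 1 < complex.Re s -> abs_summable (fun g => T g s).
Proof.
move=> s1; have [bound [M [b0 hM h]]] := Xi_majorant (cabs_ge0 s) s1.
exists M; apply: sum_le_le hM => g; apply: h => //.
by split => //; lra.
Qed.

Lemma Xi_abs_cvg_gt1 s : 1 < complex.Re s -> Xi_abs_cvg 1 z t s.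
Proof.
move=> /Xi_abs_summable[M hM]; rewrite /Xi_abs_cvg /summable.
apply: (@le_lt_trans _ _ M%:E); last exact: ltry.
apply: ge_ereal_sup => _ [A [finA _] <-].
rewrite fsbig_finite// sumEFin lee_fin.
apply: le_trans (hM (fset_set A)).
by apply: ler_sum => g _; rewrite ger0_norm ?cabs_ge0.
Qed.

Lemma uholo_Xi (s0 : C) : 1 < complex.Re s0 ->
  exists2 r : R, 0 < r & uholo (disk s0 r) (Xi 1 z t).
Proof.
move=> s1; pose r := (complex.Re s0 - 1) / 2; have r0 : 0 < r by rewrite divr_gt0// subr_gt0.
exists r => //; pose b := cabs s0 + r.
have b0 : 0 <= b by rewrite addr_ge0 ?cabs_ge0// ltW.
have sg : 1 < 1 + r by rewrite ltrDl.
have [bound [M [bd0 hM h]]] := Xi_majorant b0 sg.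
apply: (uholo_tsum _ _ bd0 hM).
- by move=> g; apply: uholo_eq (uholo_Pf _ (disk_bounded s0 r)) => s _; rewrite Xi_term1.
move=> g s Ds.
have res : 1 + r <= complex.Re s.
  have : `|complex.Re (s - s0)| <= r := le_trans (normRe_le _) Ds.
  have -> : complex.Re (s - s0) = complex.Re s - complex.Re s0 by case: (s) (s0) => [? ?] [? ?].
  by rewrite ler_norml /r; lra.
apply: h => //; split; first by lra.
have E : s = s0 + (s - s0) by ring.
by rewrite E; apply: le_trans (cabsD _ _) _; rewrite lerD2l.
Qed.

Lemma tsum_nat_split (f : nat -> C) : abs_summable f ->
  abs_summable (fun m => f m.+1) /\ tsum f = f 0%N + tsum (fun m => f m.+1).
Proof.
move=> sf; have [M hM] := sf.
have sS : abs_summable (fun m => f m.+1).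
  exists M; apply: (sum_le_inj (h := S) _ _ (fun=> cabs_ge0 _) hM) => // i j _ _; exact: succn_inj.
split => //.
pose f1 n := if n == 0%N then f n else 0; pose f2 n := if n != 0%N then f n else 0.
have s1 : abs_summable f1 by apply: (abs_summable_restr (fun n => n == 0%N)).
have s2 : abs_summable f2 by apply: (abs_summable_restr (fun n => n != 0%N)).
have -> : tsum f = tsum f1 + tsum f2.
  rewrite -tsumD//; apply: eq_tsum => n; rewrite /f1 /f2.
  by case: eqP => _; rewrite ?addr0 ?add0r.
congr (_ + _).
  rewrite (has_sum_tsum (@has_sum_finite _ _ [fset 0%N]%fset _ _)) ?big_seq_fset1//.
  by move=> i; rewrite inE /f1 => /negbTE ->.
rewrite (@tsum_reindex _ _ _ S f2 succn_inj)// => -[|n]; first by rewrite /f2 /= eqxx.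
by exists n.
Qed.

Lemma Xi_split s : 1 < complex.Re s ->
  abs_summable (fun m => pair_sum z t m.+1 s) /\
  Xi 1 z t s = level z t 0 s + 2 * tsum (fun m => pair_sum z t m.+1 s).
Proof.
move=> s1; have sT := Xi_abs_summable s1.
have rs : region (cabs s) s by split => //; lra.
have [M hM] := sT.
have sL : abs_summable (fun n => level z t n s).
  by exists M; apply: tsum_fiber_le hM.
have [sS E] := tsum_nat_split sL.
have lE m : level z t m.+1 s = 2 * pair_sum z t m.+1 s.
  exact: (level_pair_sum z0 t0 zt (cabs_ge0 s) rs).
have sP : abs_summable (fun m => pair_sum z t m.+1 s).
  have := abs_summableZ 2^-1 sS; congr abs_summable; apply/funext => m.
  by rewrite lE mulKf// pnatr_eq0.
split => //; rewrite /Xi -/(tsum (fun g => T g s)) (tsum_fiber level_index sT).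
rewrite -/(tsum (fun n => level z t n s)) E -tsumZ//; congr (_ + _).
by apply: eq_tsum => m; rewrite lE.
Qed.

End AbsoluteConvergence.

(** * Mean values of profiles *)

Section Means.
Variable R : realType.
Local Notation C := R[i].
Implicit Types (s : C) (z w : C).

(** The mean value of a profile is the limit of its Riemann sums; along a
holomorphic family of uniform profiles the convergence is uniform. *)
Lemma mean_family (F : C -> R -> C) (B : C -> Prop) (K : R) : 0 <= K ->
  cbounded B -> (forall x, uholo B (fun s => F s x)) ->
  (forall s, B s -> profile K (F s)) ->
  exists2 I : C -> C, uholo B I & forall s, B s -> forall c, (0 < c)%N ->
    cabs (riemann (F s) c - I s) <= 10 * K / c%:R.
Proof.
move=> K0 bB hF pF.
have ex s : exists l, B s -> forall c, (0 < c)%N ->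
    cabs (riemann (F s) c - l) <= 10 * K / c%:R.
  have [Bs|nB] := pselect (B s); last by exists 0.
  by have [l hl] := riemann_limit (pF s Bs); exists l.
pose I s := projT1 (cid (ex s)); have hI s := projT2 (cid (ex s)).
exists I; last exact: hI.
apply: uholo_lim => e e0; have k0 : 0 <= 10 * K by rewrite mulr_ge0.
pose c := (Num.truncn (10 * K / e)).+1.
have c1 : 10 * K / e <= c%:R by apply/ltW; rewrite truncnS_gt.
have c0' : (0 : R) < c%:R by rewrite ltr0n.
exists (fun s => riemann (F s) c); last first.
  move=> s Bs; rewrite cabsBC; apply: le_trans (hI s Bs c isT) _.
  by rewrite ler_pdivrMr// [e * _]mulrC -ler_pdivrMr.
apply: uholoZ => //.
apply: (@uholo_tsum R int B (fun d s => F s (d%:~R / c%:R)) (fun d => K * W (d%:~R / c%:R)) (K * (5 * c%:R))).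
- by move=> d; apply: hF.
- by move=> d s Bs; have [h _] := pF s Bs; apply: h.
- by move=> d; rewrite mulr_ge0// ltW// W_gt0.
- by apply: sum_leZ => //; apply: W_sum_int.
Qed.

Lemma tsum_telescope (h : int -> C) : abs_summable (fun d => h d - h (d + 1)) ->
  (forall e : R, 0 < e -> exists N, forall n : nat, (N <= n)%N ->
     cabs (h n%:Z) <= e /\ cabs (h (- n%:Z)) <= e) ->
  tsum (fun d => h d - h (d + 1)) = 0.
Proof.
move=> sh hh; apply: cabs_small_eq0 => e e0.
have e3 : 0 < e / 3 by rewrite divr_gt0.
pose S (n : nat) : {fset int} :=
  [fset x in [seq (i%:Z - n%:Z) | i <- index_iota 0 (n + n)]]%fset.
have memS n (x : int) : (x \in S n) = (- n%:Z <= x < n%:Z).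
  rewrite !inE /=; apply/seq.mapP/idP => [ [i hi ->] | hx].
    by move: hi; rewrite mem_index_iota; lia.
  exists (absz (x + n%:Z)); rewrite ?mem_index_iota; lia.
have [||N hN] := has_sum_exhaust (S := S) _ _ (summable_has_sum sh) e3.
- by move=> m n mn; apply/fsubsetP => x; rewrite !memS; lia.
- by move=> x; exists (absz x).+1; rewrite memS; lia.
have [N' hN'] := hh _ e3.
pose n := maxn N N'; have := hN n (leq_maxl _ _).
have [a1 a2] := hN' n (leq_maxr _ _).
have -> : \sum_(i <- S n) (h i - h (i + 1)) = h (- n%:Z) - h n%:Z.
  transitivity (\sum_(i <- [seq (i%:Z - n%:Z) | i <- index_iota 0 (n + n)]) (h i - h (i + 1))).
    apply: perm_big; apply: uniq_perm; rewrite ?fset_uniq//.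
      by rewrite map_inj_uniq ?iota_uniq// => i j ij; lia.
    by move=> x; rewrite inE.
  rewrite big_map; under eq_bigr => i _.
    have -> : i%:Z - n%:Z + 1 = i.+1%:Z - n%:Z by lia.
    over.
  have -> : h (- n%:Z) - h n%:Z = - (h ((n + n)%N%:Z - n%:Z) - h (0%N%:Z - n%:Z)).
    by rewrite PoszD addrK sub0r opprB.
  have T := @telescope_sumr C 0 (n + n) (fun i : nat => h (i%:Z - n%:Z)) (leq0n _).
  by rewrite -T -[RHS]sumrN; apply: eq_bigr => i _; rewrite opprB.
rewrite cabsBC => a3; set S0 := tsum _ in a3 *.
have -> : S0 = (S0 - (h (- n%:Z) - h n%:Z)) + (h (- n%:Z) - h n%:Z) by ring.
apply: le_trans (cabsD _ _) _; have := cabsB (h (- n%:Z)) (h n%:Z); lra.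
Qed.

(** At [s = 1] the profile in [d] is the derivative of [- (x + z)^-1], which vanishes
at both ends of the line, so its Riemann sums nearly telescope. *)
Lemma riemann_d_profile_at1 z : 0 < complex.Im z -> exists2 K : R, 0 <= K &
  forall c, (0 < c)%N -> cabs (riemann (d_profile z 1) c) <= K / c%:R.
Proof.
move=> z0; have zn : complex.Im z != 0 by rewrite gt_eqF.
have [k [k0 k1 hk]] := nonreal_lower zn.
have k3 : 0 < k ^+ 3 by rewrite exprn_gt0.
have WE (x : R) : (1 + `|x|) ^- 2 <= W x.
  have x1 : 1 <= 1 + `|x| by rewrite lerDl.
  rewrite W_powR -powR_invn ?(le_trans ler01)//.
  by apply: ler_powR => //; lra.
exists (5 / k ^+ 3); first by rewrite divr_ge0// ltW.
move=> c c0; have c0' : (0 : R) < c%:R by rewrite ltr0n.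
pose x (d : int) : R := d%:~R / c%:R.
pose v d : C := (x d)%:C%C + z.
have v_ge d : k * (1 + `|x d|) <= cabs (v d) := hk (x d).
have v_gt d : 0 < cabs (v d).
  by apply: lt_le_trans (v_ge d); rewrite mulr_gt0// ltr_wpDr.
have vn d : v d != 0 by rewrite -cabs_gt0.
have v_gek d : k <= cabs (v d).
  by apply: le_trans (v_ge d); rewrite ler_peMr ?lerDl// ltW.
pose h d : C := (v d)^-1.
have vS d : v (d + 1) = v d + (c%:R^-1)%:C%C.
  by rewrite /v /x intrD mulrDl mul1r rmorphD /=; ring.
have cC : (c%:R^-1)%:C%C = c%:R^-1 :> C by rewrite fmorphV rmorph_nat.
have cn : c%:R != 0 :> C by rewrite pnatr_eq0 -lt0n.
have dh d : h d - h (d + 1) = c%:R^-1 * ((v d)^-1 * (v (d + 1))^-1).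
  have vn1 := vn (d + 1); have vn0 := vn d; move: vn1; rewrite /h vS cC => vn1.
  by move: (c%:R^-1) vn1 => u vn1; field; rewrite vn0 vn1.
have inv_le d : cabs (v d)^-1 <= k^-1 * (1 + `|x d|)^-1.
  rewrite cabsV -invfM lef_pV2 ?posrE//.
  by rewrite mulr_gt0// ltr_wpDr.
have inv_lek d : cabs (v d)^-1 <= k^-1 by rewrite cabsV lef_pV2 ?posrE.
have ki : 0 < k^-1 by rewrite invr_gt0.
have G1 d : d_profile z 1 (x d) = (v d)^-1 ^+ 2.
  by rewrite /d_profile Pf_at1 -/(v d) -expr2 exprVn.
have sq d : cabs (v d)^-1 ^+ 2 <= k^-2 * W (x d).
  apply: (@le_trans _ _ ((k^-1 * (1 + `|x d|)^-1) ^+ 2)).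
    by rewrite lerXn2r ?nnegrE ?cabs_ge0// mulr_ge0 ?invr_ge0 ?addr_ge0// ltW.
  by rewrite exprMn !exprVn ler_wpM2l ?WE// invr_ge0 exprn_ge0// ltW.
have k2i : 0 <= k ^- 2 by rewrite invr_ge0 exprn_ge0// ltW.
have sG : abs_summable (fun d => d_profile z 1 (x d)).
  exists (k ^- 2 * (5 * c%:R)); apply: sum_le_le (sum_leZ k2i (W_sum_int R c0)) => d.
  by rewrite G1 cabsX.
have diff d : cabs (c%:R^-1 * d_profile z 1 (x d) - (h d - h (d + 1))) <=
    (k ^- 3 / c%:R ^+ 2) * W (x d).
  have -> : c%:R^-1 * d_profile z 1 (x d) - (h d - h (d + 1)) =
    c%:R^-1 ^+ 2 * ((v d)^-1 ^+ 2 * (v (d + 1))^-1).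
    rewrite G1 dh; have vn1 := vn (d + 1); have vn0 := vn d; move: vn1.
    by rewrite vS cC; move: (c%:R^-1) => u vn1; field; rewrite vn0 vn1.
  rewrite cabsM cabsX cabsV cabs_nat cabsM cabsX.
  have -> : k ^- 3 / c%:R ^+ 2 * W (x d) = c%:R^-1 ^+ 2 * (k ^- 2 * W (x d) * k^-1).
    by field; rewrite !gt_eqF.
  apply: ler_wpM2l; first by rewrite exprn_ge0// invr_ge0 ltW.
  by apply: ler_pM; rewrite ?exprn_ge0 ?cabs_ge0.
have k3i : 0 <= k ^- 3 / c%:R ^+ 2 by rewrite divr_ge0 ?invr_ge0 ?exprn_ge0// ltW.
have sd := sum_leZ k3i (W_sum_int R c0).
have sD : abs_summable (fun d => c%:R^-1 * d_profile z 1 (x d) - (h d - h (d + 1))).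
  by exists (k ^- 3 / c%:R ^+ 2 * (5 * c%:R)); apply: sum_le_le sd => d; apply: diff.
have sG' := abs_summableZ c%:R^-1 sG.
have sh : abs_summable (fun d => h d - h (d + 1)).
  have := abs_summableD sG' (abs_summableZ (-1) sD).
  by congr abs_summable; apply/funext => d; ring.
have h0 : tsum (fun d => h d - h (d + 1)) = 0.
  apply: tsum_telescope => // e e0.
  exists (Num.truncn (k^-1 / e * c%:R)).+1 => n hn.
  have nb : k^-1 / e * c%:R <= n%:R.
    apply: (@le_trans _ _ (Num.truncn (k^-1 / e * c%:R)).+1%:R); first by apply/ltW; rewrite truncnS_gt.
    by rewrite ler_nat.
  have nb2 : k^-1 / e <= 1 + n%:R / c%:R.
    by apply: ler_wpDl => //; rewrite ler_pdivlMr.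
  have key d : `|x d| = n%:R / c%:R -> cabs (h d) <= e.
    move=> xd; apply: le_trans (inv_le d) _; rewrite xd.
    by rewrite ler_pdivrMr ?ltr_wpDr ?divr_ge0// mulrC -ler_pdivrMr.
  by split; apply: key; rewrite /x ?intrN ?mulNr ?normrN ger0_norm// divr_ge0.
have -> : riemann (d_profile z 1) c =
    tsum (fun d => c%:R^-1 * d_profile z 1 (x d) - (h d - h (d + 1))).
  by rewrite tsumB// h0 subr0 tsumZ.
have -> : 5 / k ^+ 3 / c%:R = k ^- 3 / c%:R ^+ 2 * (5 * c%:R) by field; rewrite !gt_eqF.
by apply: tsum_le; apply: sum_le_le sd => d; apply: diff.
Qed.

End Means.

(** * Asymptotics for a fixed lower left entry *)

Section PairSumAsymptotics.
Variable R : realType.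
Local Notation C := R[i].
Variables z t : C.
Hypothesis z0 : 0 < complex.Im z.
Hypothesis t0 : 0 < complex.Im t.
Hypothesis zt : forall g : SL2Z, t <> moebius g z.

Implicit Types (s : C).

Lemma ord_intr_eq0 (p : nat) (x : int) : ((x%:~R : 'I_p.+2) == 0) = (p.+2%:Z %| x)%Z.
Proof.
have n0 : (p.+2%:Z)%:~R = 0 :> 'I_p.+2.
  by rewrite -pmulrn Zp_nat; apply: val_inj; rewrite /= modnn.
have E : x%:~R = (absz (x %% p.+2%:Z)%Z)%:R :> 'I_p.+2.
  rewrite {1}(divz_eq x p.+2%:Z) intrD intrM n0 mulr0 add0r.
  by rewrite pmulrn gez0_abs// modz_ge0.
have lt : (absz (x %% p.+2%:Z)%Z < p.+2)%N by lia.
rewrite E Zp_nat -val_eqE /= modn_small// absz_eq0; exact/eqP/dvdz_mod0P.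
Qed.

Lemma admissible_ord p d a : admissible p.+2 d a = ((a%:~R * d%:~R : 'I_p.+2) == 1).
Proof. by rewrite /admissible -ord_intr_eq0 intrB intrM subr_eq0. Qed.

Lemma Pf_pw n s : Pf (n.+1%:R ^+ 2) s = pw n (4 * s - 2).
Proof.
have n0 : (0 : R) < n.+1%:R by rewrite ltr0n.
rewrite /Pf /pw cabsX cabs_nat -powR_mulrn ?ltW// ln_powR.
have -> : (n.+1%:R ^+ 2)^* = cexp (2 * ln n.+1%:R)%:C%C :> C.
  rewrite cexp_real mulrC expRM lnK ?posrE// powR_mulrn ?ltW//.
  by rewrite rmorphXn /= conjC_nat rmorphXn /= rmorph_nat.
rewrite -cexpD; congr cexp; rewrite !rmorphM /= !rmorph_nat; ring.
Qed.

Lemma disk_region s : disk 1 (1 / 64) s -> region 2 s /\ 63 / 64 <= complex.Re s.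
Proof.
move=> Ds; have h : `|complex.Re (s - 1)| <= 1 / 64 := le_trans (normRe_le _) Ds.
have E : complex.Re (s - 1) = complex.Re s - 1 by case: (s).
rewrite E ler_norml in h; have h' : 63 / 64 <= complex.Re s by lra.
split => //; split; first by lra.
have -> : s = (s - 1) + 1 by ring.
apply: le_trans (cabsD _ _) _; rewrite cabs1; have : cabs (s - 1) <= 1 / 64 := Ds; lra.
Qed.

(** Up to the relative error [n ^ -2] the summand factors into a function of [d]
and a function of [a]; the sum of the error is estimated without the congruence. *)
Lemma pair_sum_factor (b : R) : 0 <= b -> exists2 K : R, 0 <= K & forall s n,
  region b s -> (0 < n)%N ->
  cabs (pair_sum z t n s - Pf (n%:R ^+ 2) s * tsum (fun q : int * int =>
    if admissible n q.1 q.2 then d_profile z s (q.1%:~R / n%:R) * a_profile t s (q.2%:~R / n%:R)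
    else 0)) <= K * cabs (Pf (n%:R ^+ 2) s).
Proof.
move=> b0; have [K K0 hK] := admissible_term_bound z0 t0 zt b0.
exists (25 * K); first by rewrite mulr_ge0.
move=> s n rs n0; have [pG pK h] := hK s rs.
have n0' : (0 : R) < n%:R by rewrite ltr0n.
set P := Pf _ s.
have sA : abs_summable (fun q : int * int => if admissible n q.1 q.2
    then d_profile z s (q.1%:~R / n%:R) * a_profile t s (q.2%:~R / n%:R) else 0).
  apply: (abs_summable_restr (fun q => admissible n q.1 q.2)).
  exact: abs_summable_prod (profile_summable pG n0) (profile_summable pK n0).
rewrite -tsumZ// -tsumB; [|exact: (pair_summable z0 t0 zt b0 rs n0)|exact: abs_summableZ].
have c0 : 0 <= K * cabs P / n%:R ^+ 2 by rewrite divr_ge0 ?mulr_ge0 ?cabs_ge0// exprn_ge0// ltW.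
have S := sum_leZ c0 (W_pair_sum R n0).
have -> : 25 * K * cabs P = K * cabs P / n%:R ^+ 2 * (5 * n%:R * (5 * n%:R)).
  by field; rewrite gt_eqF.
apply: tsum_le; apply: sum_le_le S => -[d a] /=.
case: ifP => [adm|_]; last by rewrite mulr0 subrr cabs0 mulr_ge0// mulr_ge0// ltW// W_gt0.
have [_ h2] := h n d a n0 adm; apply: le_trans h2 _.
by rewrite mulrAC.
Qed.

(** Here [I] and [J] are the mean values of the two profiles. The size of
[n ^ (2 - 4 s)] is at most [n ^ (- 31 / 16)] on this disc, and the sum over pairs
of residues is known up to [n ^ (7 / 8)], which gives the exponent [- 17 / 16]. *)
Lemma pair_sum_asymptotic : exists (I J : C -> C) (Q : R),
  [/\ uholo (disk 1 (1 / 64)) I, uholo (disk 1 (1 / 64)) J, I 1 = 0, 0 <= Q &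
   forall s p, disk 1 (1 / 64) s ->
    cabs (pair_sum z t p.+2 s - pw p.+1 (4 * s - 2) * (totient p.+2)%:R * (I s * J s)) <=
      Q * p.+2%:R `^ (- (17 / 16))].
Proof.
have b0 : 0 <= 2 :> R by [].
have bB : cbounded (disk (1 : C) (1 / 64)) := @disk_bounded _ _ _.
have rB s : disk 1 (1 / 64) s -> region 2 s by move=> /disk_region[].
have [K K0 hK] := admissible_term_bound z0 t0 zt b0.
have [K' K'0 hK'] := pair_sum_factor b0.
have [M M0 hM] := kloosterman_saving R.
have pG s : disk 1 (1 / 64) s -> profile K (d_profile z s) by move=> /rB /hK[].
have pK s : disk 1 (1 / 64) s -> profile K (a_profile t s) by move=> /rB /hK[].
have [I uI hI] := mean_family K0 bB (fun x => uholo_Pf _ bB) pG.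
have [J uJ hJ] := mean_family K0 bB (fun x => uholo_Pf _ bB) pK.
have K25 : 0 <= 25 * K ^+ 2 * M := mulr_ge0 (mulr_ge0 (ler0n _ 25) (exprn_ge0 2 K0)) M0.
have K200 : 0 <= 200 * K ^+ 2 := mulr_ge0 (ler0n _ 200) (exprn_ge0 2 K0).
exists I, J, (K' + 25 * K ^+ 2 * M + 200 * K ^+ 2); split; [exact: uI | exact: uJ | | |].
- apply: cabs_small_eq0 => e e0; have D1 : disk (1 : C) (1 / 64) 1.
    by rewrite /disk subrr cabs0 divr_ge0.
  have [L L0 hL] := riemann_d_profile_at1 z0.
  pose c := (Num.truncn ((10 * K + L) / e)).+1.
  have c1 : (10 * K + L) / e <= c%:R by apply/ltW; rewrite truncnS_gt.
  have c0' : (0 : R) < c%:R by rewrite ltr0n.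
  have -> : I 1 = riemann (d_profile z 1) c - (riemann (d_profile z 1) c - I 1) by ring.
  apply: le_trans (cabsB _ _) _.
  apply: (@le_trans _ _ ((10 * K + L) / c%:R)).
    by rewrite [10 * K + L]addrC mulrDl; apply: lerD; [exact: hL|exact: hI].
  by rewrite ler_pdivrMr// [e * _]mulrC -ler_pdivrMr.
- by rewrite !addr_ge0.
move=> s p Ds; have [rs s1] := disk_region Ds.
set n := p.+2; have n0 : (0 < n)%N by [].
have Pn : cabs (pw p.+1 (4 * s - 2)) <= n%:R `^ (- (31 / 16)).
  rewrite cabs_pw; apply: ler_powR; first by rewrite ler1n.
  have -> : complex.Re (4 * s - 2) = 4 * complex.Re s - 2.
    by rewrite -!(rmorph_nat (real_complex R)); case: (s) => x y /=; rewrite mul0r subr0.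
  by lra.
have := hK' s n rs n0; rewrite Pf_pw; set P := pw _ _ in Pn * => e1.
set G := d_profile z s in pG *; set H := a_profile t s.
have sG := profile_summable (pG s Ds) n0; have sH := profile_summable (pK s Ds) n0.
set A := tsum _ in e1.
set g := fun d : int => G (d%:~R / n%:R); set h := fun d : int => H (d%:~R / n%:R).
have n0' : (0 : R) < n%:R by rewrite ltr0n.
have n1 : (1 : R) <= n%:R by rewrite ler1n.
have nC : n%:R != 0 :> C by rewrite pnatr_eq0.
have gB : cabs (tsum g) <= n%:R * (5 * K).
  by rewrite mulrC; apply: tsum_le; apply: (profile_sum (pG s Ds) n0).
have hB : cabs (tsum h) <= n%:R * (5 * K).
  by rewrite mulrC; apply: tsum_le; apply: (profile_sum (pK s Ds) n0).
have := hM p g h _ sG sH (profile_variation (pG s Ds) n0) (profile_variation (pK s Ds) n0) gB hB.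
have -> : tsum (fun q : int * int => if q.2%:~R * q.1%:~R == 1 :> 'I_p.+2 then g q.1 * h q.2 else 0) = A.
  by apply: eq_tsum => q; rewrite -admissible_ord.
set phi := (totient p.+2)%:R => e2.
have gE : tsum g = n%:R * riemann G n by rewrite /riemann mulVKf.
have hE : tsum h = n%:R * riemann H n by rewrite /riemann mulVKf.
have E2 : phi / (p.+2 ^ 2)%:R * (tsum g * tsum h) = phi * (riemann G n * riemann H n).
  by rewrite gE hE natrX -/n; field.
rewrite E2 in e2.
have rG := hI s Ds n n0; have rH := hJ s Ds n n0.
have bH := cabs_riemann (pK s Ds) n0; have bG := cabs_riemann (pG s Ds) n0.
rewrite -/G in rG bG; rewrite -/H in rH bH.
have k0 : 0 <= 10 * K / n%:R by rewrite divr_ge0 ?mulr_ge0.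
have bI : cabs (I s) <= 15 * K.
  have -> : I s = riemann G n - (riemann G n - I s) by ring.
  have -> : 15 * K = 5 * K + 10 * K by ring.
  apply: le_trans (cabsB _ _) _; apply: lerD => //; apply: le_trans rG _.
  by rewrite ler_pdivrMr// ler_peMr// mulr_ge0.
have phin : cabs phi <= n%:R.
  rewrite /phi cabs_nat ler_nat; exact: totient_leq.
have e3 : cabs (phi * (riemann G n * riemann H n) - phi * (I s * J s)) <= 200 * K ^+ 2.
  have -> : phi * (riemann G n * riemann H n) - phi * (I s * J s) =
    phi * ((riemann G n - I s) * riemann H n + I s * (riemann H n - J s)) by ring.
  have -> : 200 * K ^+ 2 = n%:R * (10 * K / n%:R * (5 * K) + 15 * K * (10 * K / n%:R)).
    by field; rewrite gt_eqF.
  rewrite cabsM; apply: ler_pM; rewrite ?cabs_ge0//; apply: le_trans (cabsD _ _) _.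
  by rewrite 2!cabsM; apply: lerD; apply: ler_pM; rewrite ?cabs_ge0.
have w0 : 1 <= n%:R `^ (7 / 8) :> R.
  by rewrite -[leLHS](powRr0 n%:R) ler_powR.
have P0 := cabs_ge0 P.
have -> : pair_sum z t n s - P * phi * (I s * J s) =
  (pair_sum z t n s - P * A) + P * ((A - phi * (riemann G n * riemann H n)) +
   (phi * (riemann G n * riemann H n) - phi * (I s * J s))) by ring.
apply: le_trans (cabsD _ _) _.
rewrite [cabs (P * _)]cabsM.
have e4 := cabsD (A - phi * (riemann G n * riemann H n)) (phi * (riemann G n * riemann H n) - phi * (I s * J s)).
set X := cabs _ in e1 *; set Y := cabs (_ + _) in e4 *.
set w := n%:R `^ (7 / 8) in w0 e2.
have Yw : K' + Y <= (K' + 25 * K ^+ 2 * M + 200 * K ^+ 2) * w.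
  have e2' : cabs (A - phi * (riemann G n * riemann H n)) <= 25 * K ^+ 2 * M * w.
    by have -> : 25 * K ^+ 2 * M * w = (5 * K) ^+ 2 * (M * w) by ring.
  have -> : (K' + 25 * K ^+ 2 * M + 200 * K ^+ 2) * w =
    K' * w + (25 * K ^+ 2 * M * w + 200 * K ^+ 2 * w) by ring.
  apply: lerD; first by rewrite ler_peMr.
  apply: le_trans e4 _; apply: lerD => //; apply: le_trans e3 _.
  by rewrite ler_peMr// mulr_ge0 ?exprn_ge0.
apply: (@le_trans _ _ (cabs P * ((K' + 25 * K ^+ 2 * M + 200 * K ^+ 2) * w))).
  apply: (@le_trans _ _ (cabs P * (K' + Y))); last by rewrite ler_wpM2l.
  by rewrite mulrDr [cabs P * K']mulrC; apply: lerD e1 (lexx _).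
have -> : - (17 / 16) = - (31 / 16) + 7 / 8 :> R by field.
rewrite powRD; last by rewrite (gt_eqF n0') implybT.
rewrite -/w mulrCA; apply: ler_wpM2l; first by rewrite !addr_ge0.
by rewrite ler_wpM2r// (le_trans ler01).
Qed.

End PairSumAsymptotics.

(** * Continuation to the point 1 *)

Section Continuation.
Variable R : realType.
Local Notation C := R[i].
Variables z t : C.
Hypothesis z0 : 0 < complex.Im z.
Hypothesis t0 : 0 < complex.Im t.
Hypothesis zt : forall g : SL2Z, t <> moebius g z.

Implicit Types (s : C).

Lemma uholo_derivable_in (s0 s : C) (r : R) (f : C -> C) :
  cabs (s - s0) < r -> uholo (disk s0 r) f -> derivable (f : C^o -> C^o) s 1.
Proof.
move=> sr hf; apply: (@uholo_derivable _ s (r - cabs (s - s0))); first by rewrite subr_gt0.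
apply: uholo_sub hf => w hw; rewrite /disk.
have -> : w - s0 = (w - s) + (s - s0) by ring.
by apply: le_trans (cabsD _ _) _; rewrite -lerBrDr.
Qed.

Lemma derivable_quotient (N P Z : C -> C) s : Z s != 0 ->
  derivable (N : C^o -> C^o) s 1 -> derivable (P : C^o -> C^o) s 1 ->
  derivable (Z : C^o -> C^o) s 1 ->
  derivable ((fun s => N s + P s / Z s) : C^o -> C^o) s 1.
Proof.
move=> Zs dN dP dZ.
have dV := @derivableV C C^o Z s 1 Zs dZ.
have dM := @derivableM C C^o P _ s 1 dP dV.
exact: (@derivableD C C^o C^o N _ s 1 dN dM).
Qed.

(** The series of [pair_sum] minus its main term converges uniformly near 1. The
main terms add up to [I * J] times the totient series, whose simple pole at 1 is
cancelled by the zero of [I]. *)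
Lemma Xi_near_one : exists (F : C -> C) (rho : R), [/\ 0 < rho,
  forall s, cabs (s - 1) < rho -> derivable (F : C^o -> C^o) s 1 &
  forall s, cabs (s - 1) < rho -> 1 < complex.Re s -> F s = Xi 1 z t s].
Proof.
pose B := disk (1 : C) (1 / 64).
have r64 : 0 < 1 / 64 :> R by rewrite divr_gt0.
have bB : cbounded B := @disk_bounded _ _ _.
have [D [Z [uD uZ Z1 hDZ]]] := totient_series_continuation R.
have sub8 s : B s -> disk (1 : C) (1 / 8) s by move=> h; apply: le_trans h _; lra.
have {}uD : uholo B D := uholo_sub sub8 uD.
have {}uZ : uholo B Z := uholo_sub sub8 uZ.
have [I [J [Q [uI uJ I1 Q0 hQ]]]] := pair_sum_asymptotic z0 t0 zt.
have [i ui hi] := uholo_quotient r64 uI.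
have IE s : I s = (s - 1) * i s by rewrite -hi I1 subr0.
pose H (m : nat) s := pair_sum z t m.+1 s -
  pw m (4 * s - 2) * (totient m.+1)%:R * (I s * J s).
have b2 : 0 <= 2 :> R by [].
have rB s : B s -> region 2 s by move=> /disk_region[].
have uH m : uholo B (H m).
  apply: uholoB => //; first exact: (uholo_pair_sum z0 t0 zt b2 bB rB).
  apply: uholoM => //; last exact: uholoM.
  apply: uholoM => //; [exact: (uholo_pw m 4 (- 2) bB) | exact: uholo_cst].
have [M0 M00 hM0] := uholo_bounded bB (uH 0%N).
pose b (m : nat) : R := (M0 + Q) * m.+1%:R `^ (- (1 + 1 / 16)).
have b0 m : 0 <= b m by rewrite mulr_ge0 ?powR_ge0 ?addr_ge0.
have Hb m s : B s -> cabs (H m s) <= b m.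
  case: m => [|p] Bs; first by rewrite /b powR1 mulr1; apply: le_trans (hM0 s Bs) _; rewrite lerDl.
  apply: le_trans (hQ s p Bs) _; rewrite /b.
  have -> : - (17 / 16) = - (1 + 1 / 16) :> R by field.
  by rewrite ler_wpM2r ?powR_ge0// lerDr.
have h16 : 0 < 1 / 16 :> R by rewrite divr_gt0.
have Sb := sum_leZ (addr_ge0 M00 Q0) (pseries_sum_le h16).
have uS := uholo_tsum uH Hb b0 Sb.
pose N s := level z t 0 s + 2 * tsum (fun m => H m s).
pose P s := 2 * (J s * i s * D s).
have uN : uholo B N.
  by apply: uholoD; [exact: (uholo_level0 z0 t0 zt b2 bB rB) | exact: uholoZ].
have uP : uholo B P.
  by apply: uholoZ => //; apply: uholoM => //; apply: uholoM.
have Z1' : 0 < cabs (Z 1) / 2 by rewrite divr_gt0// cabs_gt0.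
have [d d0 hd] := uholo_continuous_center r64 uZ Z1'.
have Zn s : cabs (s - 1) <= d -> Z s != 0.
  move=> /hd; rewrite [1 + _]addrC subrK => h; apply/eqP => Zs; move: h.
  by rewrite Zs sub0r cabsN; move: Z1'; lra.
exists (fun s => N s + P s / Z s), (Num.min d (1 / 64)); split.
- by rewrite lt_min d0.
- move=> s; rewrite lt_min => /andP[sd s64].
  have dN := uholo_derivable_in s64 uN; have dP := uholo_derivable_in s64 uP.
  have dZ := uholo_derivable_in s64 uZ.
  exact: (derivable_quotient (Zn s (ltW sd)) dN dP dZ).
move=> s; rewrite lt_min => /andP[sd s64] s1.
have Bs : B s := ltW s64.
have Zs : Z s != 0 by apply: Zn; apply: ltW.
have [sP ->] := Xi_split z0 t0 zt s1.
have w2 : 2 < complex.Re (4 * s - 2).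
  have -> : complex.Re (4 * s - 2) = 4 * complex.Re s - 2.
    by rewrite -!(rmorph_nat (real_complex R)); case: (s) => x y /=; rewrite mul0r subr0.
  by lra.
have sT := totient_pw_summable w2.
have E := hDZ s (sub8 s Bs) s1.
set T := tsum _ in E.
have sT' := abs_summableZ (I s * J s) sT.
have -> : N s = level z t 0 s + 2 * (tsum (fun m => pair_sum z t m.+1 s) - I s * J s * T).
  rewrite /N; congr (_ + 2 * _); rewrite -tsumZ// -tsumB//.
  by apply: eq_tsum => m; rewrite /H; ring.
by rewrite /P -E IE; field.
Qed.

Lemma star_connected (U : set C^o) (a : C) :
  (forall s, U s -> forall x : R, 0 <= x <= 1 -> U (a + x%:C%C * (s - a))) -> U a ->
  connected U.
Proof.
move=> hU Ua.
pose g (s : C) (x : R) : C^o := a + x%:C%C * (s - a).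
have -> : U = \bigcup_(s in U) (g s @` [set` `[0, 1]]).
  apply/seteqP; split => [s Us | s [s' Us' [x hx <-]]].
    exists s => //; exists 1 => /=; first by rewrite in_itv /= ler01 lexx.
    by rewrite /g mul1r addrC subrK.
  by apply: hU Us' _ _; move: hx; rewrite /= in_itv.
apply: bigcup_connected => [|s Us].
  exists a => s Us; exists 0 => /=; first by rewrite in_itv /= lexx ler01.
  by rewrite /g mul0r addr0.
apply: connected_continuous_connected.
  exact: segment_connected.
apply: continuous_subspaceT => x; apply/cvgrPdist_le => e e0.
have eE : e = (complex.Re e)%:C%C.
  by move: (e0); rewrite ltcE => /andP[/eqP h _]; case: e h {e0} => u v /= ->.
have e0' : 0 < complex.Re e by move: e0; rewrite {1}eE ltcR.
have k0 : 0 < cabs (s - a) + 1 by rewrite ltr_wpDl ?cabs_ge0.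
have d0 : 0 < complex.Re e / (cabs (s - a) + 1) by rewrite divr_gt0.
near=> y.
have -> : g s x - g s y = (x - y)%:C%C * (s - a) by rewrite /g rmorphB /=; ring.
rewrite eE cabsE lecR cabsM cabs_real.
have hy : `|x - y| <= complex.Re e / (cabs (s - a) + 1).
  by near: y; apply/nbhs_ballP; exists (complex.Re e / (cabs (s - a) + 1)) => // y' /ltW.
apply: (@le_trans _ _ (complex.Re e / (cabs (s - a) + 1) * cabs (s - a))).
  by rewrite ler_wpM2r ?cabs_ge0.
by rewrite mulrAC ler_pdivrMr// ler_wpM2l ?(ltW e0')// lerDl.
Unshelve. all: by end_near.
Qed.

Lemma open_cabs (U : set C^o) : (forall s, U s -> exists2 r : R, 0 < r &
  forall w, cabs (w - s) < r -> U w) -> open U.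
Proof.
move=> h; rewrite openE => s /h[r r0 hr]; apply/nbhs_ballP.
exists r%:C%C => [|w]; first by rewrite /= ltcR.
by rewrite -ball_normE /= distrC cabsE ltcR; apply: hr.
Qed.

End Continuation.

Theorem theorem2 (R : realType) (z1 z2 : R[i])
    (hz1 : upper_half_plane z1) (hz2 : upper_half_plane z2)
    (hz : forall g : SL2Z, z2 <> moebius g z1) :
  (forall s : R[i], 1 < complex.Re s -> Xi_abs_cvg 1 z1 z2 s) /\
  exists (U : set R[i]^o) (F : R[i]^o -> R[i]^o),
    [/\ open U, connected U,
        [set s | 1 < complex.Re s] `|` [set 1] `<=` U,
        holomorphic_on U F
      & forall s : R[i], 1 < complex.Re s -> F s = Xi 1 z1 z2 s].
Proof.
split; first exact: Xi_abs_cvg_gt1.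
have [F0 [rho [rho0 dF0 F0E]]] := Xi_near_one hz1 hz2 hz.
pose F (s : R[i]) : R[i] := if 1 < complex.Re s then Xi 1 z1 z2 s else F0 s.
exists [set s | 1 < complex.Re s \/ cabs (s - 1) < rho], F.
have ReB (s w : R[i]) : complex.Re s - cabs (w - s) <= complex.Re w.
  have : `|complex.Re (w - s)| <= cabs (w - s) := normRe_le _.
  have -> : complex.Re (w - s) = complex.Re w - complex.Re s by case: (w) (s) => [? ?] [? ?].
  by rewrite ler_norml; lra.
have in1 (s : R[i]) : 1 < complex.Re s -> exists2 r : R, 0 < r &
    forall w, cabs (w - s) < r -> 1 < complex.Re w.
  move=> s1; exists (complex.Re s - 1); first by rewrite subr_gt0.
  by move=> w; have := ReB s w; lra.
have in2 (s : R[i]) : cabs (s - 1) < rho -> exists2 r : R, 0 < r &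
    forall w, cabs (w - s) < r -> cabs (w - 1) < rho.
  move=> s1; exists (rho - cabs (s - 1)); first by rewrite subr_gt0.
  move=> w ws; have -> : w - 1 = (w - s) + (s - 1) by ring.
  by apply: le_lt_trans (cabsD _ _) _; rewrite -ltrBrDr.
have nearE (s : R[i]) (G : R[i] -> R[i]) (r : R) : 0 < r ->
    (forall w, cabs (w - s) < r -> G w = F w) ->
    derivable (G : R[i]^o -> R[i]^o) s 1 -> derivable (F : R[i]^o -> R[i]^o) s 1.
  move=> r0 GF; apply: near_eq_derivable; apply/nbhs_ballP.
  exists r%:C%C => [|w]; first by rewrite /= ltcR.
  by rewrite -ball_normE /= distrC cabsE ltcR; apply: GF.
split.
- apply: open_cabs => s [/in1|/in2] [r r0 hr]; exists r => // w ws; [left|right]; exact: hr.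
- apply: (@star_connected R _ 1) => [s hs x /andP[x0 x1]|]; last first.
    by right; rewrite subrr cabs0.
  case: hs => [s1|sr].
    have [->|xn0] := eqVneq x 0; first by right; rewrite mul0r addr0 subrr cabs0.
    left; have -> : complex.Re (1 + x%:C%C * (s - 1)) = 1 + x * (complex.Re s - 1).
      by case: (s) => u v /=; rewrite mul0r subr0.
    by rewrite ltrDl mulr_gt0 ?subr_gt0// lt_neqAle eq_sym xn0.
  right; rewrite addrAC subrr add0r cabsM cabs_real ger0_norm//.
  by apply: le_lt_trans sr; rewrite ler_piMl ?cabs_ge0.
- by move=> s [s1|->]; [left|right; rewrite subrr cabs0].
- move=> s [s1|sr].
    have [r r0 hr] := in1 s s1; apply: (nearE s (Xi 1 z1 z2) r r0).
      by move=> w /hr w1; rewrite /F w1.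
    have [r' r'0 uX] := uholo_Xi hz1 hz2 hz s1; exact: uholo_derivable r'0 uX.
  have [r r0 hr] := in2 s sr; apply: (nearE s F0 r r0); last exact: dF0.
  by move=> w /hr wr; rewrite /F; case: ifP => // w1; apply: F0E.
by move=> s s1; rewrite /F s1.
Qed.
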